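(* Let $1<p<\infty$ and $a\in\mathbb{S}^{N-1}$. Then $$K(p,N)=\Theta(p,N;a).$$ In particular, $\Theta(p,N;a)$ does not depend on the direction $a$.
   Context: $K(p,N)=\frac1p\int_{\mathbb{S}^{N-1}}|\langle\sigma,\mathbf{e}\rangle|^p\,d\mathcal{H}^{N-1}(\sigma)$, independent of $\mathbf{e}\in\mathbb{S}^{N-1}$. $Q=(-1/2,1/2)^N$, and for $a\in\mathbb{R}^N$, $\Psi_a(x)=\langle a,x\rangle$. For $0<s<1$, $[u]_{W^{s,p}(Q)}=\left(\int_Q\int_Q\frac{|u(x)-u(y)|^p}{|x-y|^{N+sp}}\,dx\,dy\right)^{1/p}\in[0,+\infty]$. For $a\in\mathbb{S}^{N-1}$, $$\Theta(p,N;a)=\inf\Big\{\liminf_{s\nearrow1}(1-s)\,[u_s]^p_{W^{s,p}(Q)}\,:\,u_s\to\Psi_a\text{ in }L^p(Q)\Big\},$$ the infimum being over families $\{u_s\}\subset L^p(Q)$ converging to $\Psi_a$ in $L^p(Q)$ as $s\nearrow1$. *)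

(* Defs.v *)
From HB Require Import structures.
From mathcomp Require Import all_boot all_order all_algebra.
From mathcomp Require Import all_classical all_reals all_analysis.

Set Implicit Arguments.
Unset Strict Implicit.
Unset Printing Implicit Defensive.

Import Order.TTheory GRing.Theory Num.Theory.
Import numFieldTopology.Exports numFieldNormedType.Exports.

Local Open Scope classical_set_scope.
Local Open Scope ring_scope.

(* R^N is N.-tuple R, whose library sigma-algebra (the one generated by the
   coordinates) is the Borel sigma-algebra of R^N. *)

Section lebesgue_measure_tuple.
Variable R : realType.

Section step.
Variables (n : nat) (mu : {sigma_finite_measure set (n.-tuple R) -> \bar R}).

Definition tcons (z : measurableTypeR R * n.-tuple R) : n.+1.-tuple R :=
  [tuple of z.1 :: z.2].

Lemma measurable_tcons : measurable_fun setT tcons.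
Proof. exact: measurable_cons measurable_fst measurable_snd. Qed.

Definition lebesgue_step : set (n.+1.-tuple R) -> \bar R :=
  pushforward (@lebesgue_measure R \x mu)%E tcons.

Let lebesgue_step0 : lebesgue_step set0 = 0%E.
Proof. by rewrite /lebesgue_step /pushforward preimage_set0 measure0. Qed.

Let lebesgue_step_ge0 A : (0 <= lebesgue_step A)%E.
Proof. by rewrite /lebesgue_step /pushforward measure_ge0. Qed.

Let lebesgue_step_sigma_additive : semi_sigma_additive lebesgue_step.
Proof.
move=> F mF tF mUF; rewrite /lebesgue_step /pushforward preimage_bigcup.
apply: measure_semi_sigma_additive.
- by move=> k; rewrite -[X in measurable X]setTI; exact: measurable_tcons.
- apply/trivIsetP => i j _ _ ij; rewrite -preimage_setI.
  by move/trivIsetP : tF => /(_ _ _ _ _ ij) ->//; rewrite preimage_set0.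
- rewrite -preimage_bigcup -[X in measurable X]setTI.
  exact: measurable_tcons.
Qed.

HB.instance Definition _ := isMeasure.Build _ _ _ lebesgue_step
  lebesgue_step0 lebesgue_step_ge0 lebesgue_step_sigma_additive.

Let lebesgue_step_sigma_finite : sigma_finite setT lebesgue_step.
Proof.
have /sigma_finiteP[F [TF ndF Foo]] := sigma_finiteT (@lebesgue_measure R).
have /sigma_finiteP[G [TG ndG Goo]] := sigma_finiteT mu.
pose tuncons (t : n.+1.-tuple R) : measurableTypeR R * n.-tuple R :=
  (thead t, [tuple of behead t]).
have tconsK : cancel tcons tuncons.
  case=> x t; rewrite /tuncons /tcons /=; congr pair; exact/val_inj.
have mtuncons : measurable_fun setT tuncons.
  apply: measurable_fun_pair; last exact: measurable_behead.
  exact: measurable_tnth.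
exists (fun k => tuncons @^-1` (F k `*` G k)).
  apply/esym; rewrite -subTset => t _.
  have [i _ Fi] : (\bigcup_k F k) (thead t) by rewrite -TF.
  have [j _ Gj] : (\bigcup_k G k) [tuple of behead t] by rewrite -TG.
  exists (maxn i j) => //; split => /=.
    by move: Fi; exact/subsetPset/ndF/leq_maxl.
  by move: Gj; exact/subsetPset/ndG/leq_maxr.
move=> k; have [mF Fk] := Foo k; have [mG Gk] := Goo k.
have mFG : measurable (F k `*` G k) by exact: measurableX.
split; first by rewrite -[X in measurable X]setTI; exact: mtuncons.
rewrite /lebesgue_step /pushforward -comp_preimage.
rewrite (_ : tuncons \o tcons = id); last first.
  by apply/funext => z /=; rewrite tconsK.
by rewrite preimage_id product_measure1E// lte_mul_pinfty// ge0_fin_numE.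
Qed.

HB.instance Definition _ := Measure_isSigmaFinite.Build _ _ _ lebesgue_step
  lebesgue_step_sigma_finite.

End step.

Let lebesgue0 : {sigma_finite_measure set (0.-tuple R) -> \bar R} :=
  [the {sigma_finite_measure set (0.-tuple R) -> \bar R} of
     \d_([tuple] : 0.-tuple R)].

Fixpoint lebesgue_tuple (n : nat) :
    {sigma_finite_measure set (n.-tuple R) -> \bar R} :=
  if n is m.+1 then 
    [the {sigma_finite_measure set (m.+1.-tuple R) -> \bar R} of
       lebesgue_step (lebesgue_tuple m)]
  else lebesgue0.

End lebesgue_measure_tuple.

Section euclidean.
Context {R : realType} {N : nat}.
Implicit Types x y : N.-tuple R.

Definition dot x y : R := \sum_(i < N) tnth x i * tnth y i.

Definition eucl_dist x y : R :=
  Num.sqrt (\sum_(i < N) (tnth x i - tnth y i) ^+ 2).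

Definition usphere : set (N.-tuple R) := [set x | Num.sqrt (dot x x) = 1].

Definition uball : set (N.-tuple R) := [set x | Num.sqrt (dot x x) <= 1].

Definition cubeQ : set (N.-tuple R) :=
  [set x | forall i, - 2^-1 < tnth x i < 2^-1].

End euclidean.
Arguments usphere : clear implicits.
Arguments uball : clear implicits.
Arguments cubeQ : clear implicits.

Section hausdorff_measure.
Context {R : realType} {N : nat}.
Local Open Scope ereal_scope.
Implicit Types A : set (N.-tuple R).

(* diam set0 = -oo *)
Definition diam A : \bar R :=
  ereal_sup [set (eucl_dist z.1 z.2)%:E | z in A `*` A].

(* omega_m (diam A / 2)^m with omega_m the volume of the unit ball of R^m; for
   m = 0 this is 1 on nonempty sets, so that the 0-dimensional Hausdorff measure
   is the counting measure. *)
Definition hausdorff_gauge (m : nat) A : \bar R :=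
  if A == set0 then 0
  else lebesgue_tuple R m (uball R m) * (diam A * (2^-1)%:E) ^+ m.

Definition hausdorff_pre (m : nat) (delta : R) A : \bar R :=
  ereal_inf [set \sum_(0 <= k <oo) hausdorff_gauge m (C k) |
    C in [set C : (set (N.-tuple R))^nat |
      A `<=` \bigcup_k C k /\ forall k, diam (C k) <= delta%:E]].

(* The m-dimensional Hausdorff outer measure on R^N; integrals with respect to
   it only evaluate it on Borel sets, on which it is a measure. *)
Definition hausdorff (m : nat) A : \bar R :=
  ereal_sup [set hausdorff_pre m delta A | delta in [set d : R | (0 < d)%R]].

End hausdorff_measure.

Section theta.
Context {R : realType} {N : nat}.
Variable p : R.
Local Open Scope ereal_scope.
Local Notation leb := (lebesgue_tuple R N).
Local Notation Q := (cubeQ R N).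

Definition Kconst (e : N.-tuple R) : \bar R :=
  (p^-1)%:E * \int[hausdorff N.-1]_(sigma in usphere R N)
                (`|dot sigma e| `^ p)%:E.

(* At x = y the integrand is 0 because 0^-1 = 0. *)
Definition gagliardo (s : R) (u : N.-tuple R -> R) : \bar R :=
  (\int[leb]_(x in Q) \int[leb]_(y in Q)
     (`|u x - u y| `^ p / eucl_dist x y `^ (N%:R + s * p))%:E) `^ (p^-1).

Definition LpQ_norm (u : N.-tuple R -> R) : \bar R :=
  'N[leb]_p%:E[EFin \o (u \_ Q)].

Definition LpQ : set (N.-tuple R -> R) :=
  [set u | measurable_fun Q u /\ LpQ_norm u < +oo].

(* The families u_s, 0 < s < 1, in L^p(Q) with u_s -> Psi_a in L^p(Q). *)
Definition approx_family (a : N.-tuple R) : set (R -> N.-tuple R -> R) :=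
  [set u | (forall s, (0 < s < 1)%R -> LpQ (u s)) /\
           LpQ_norm (fun x => u s x - dot a x)%R @[s --> 1^'-] --> 0].

Definition Theta (a : N.-tuple R) : \bar R :=
  ereal_inf [set limf_einf (fun s : R => (1 - s)%:E * gagliardo s (u s) `^ p)
                           1^'- | u in approx_family a].

End theta.

(* Main.v *)
(* Write Psi for the linear function <a, .>, and w = u - Psi.

   Upper bound. For the constant family Psi, polar coordinates bound
   (1 - s) [Psi]^p by K(p,N) (sqrt N)^(p(1-s)), which tends to K(p,N).

   Lower bound. With c = <a, x - y>, the tangent line of |.|^p at c gives
   |u(x) - u(y)|^p >= |c|^p + p |c|^(p-2) c (w(x) - w(y)). Integrate this
   against eta(x) |x - y|^(-N-sp) on rho < |x - y| <= r, where eta is a Lipschitz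
   cutoff function of the cube. The kernel in front of w is odd in x - y, so the
   terms with w(x) cancel, and those with w(y) only involve the differences
   eta(y + h) - eta(y - h) = O(|h|): they contribute O(|w|_1 / (1 - s)) uniformly
   in rho. After rho -> 0 and multiplication by 1 - s, the error vanishes as
   s -> 1, since w -> 0 in L^1, and the main term tends to K(p,N) times the
   integral of eta, hence to K(p,N) as r -> 0.

   Polar coordinates need the Hausdorff measure of the sphere. It is identified
   with N times the volume of cones: the isodiametric inequality bounds it from
   below, coverings by balls from above, and gnomonic charts, which are nearly
   isometric near their poles, transfer both bounds from the hyperplane to the
   sphere. The independence of K(p,N) of the direction follows by reflections. *)

Require Import Defs.
From mathcomp Require Import all_boot all_order all_algebra.
From mathcomp Require Import all_classical all_reals all_analysis.
From mathcomp Require Import measurable_realfun ring lra zify.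
Set Implicit Arguments.
Unset Strict Implicit.
Unset Printing Implicit Defensive.
Import Order.TTheory GRing.Theory Num.Theory.
Import numFieldTopology.Exports numFieldNormedType.Exports.
Local Open Scope classical_set_scope.
Local Open Scope ring_scope.

(** * Euclidean geometry of tuples *)

(** Integrals of extended reals can be rearranged freely only for nonnegative functions, and this
    shapes the lower bound. The odd kernel is split into a nonnegative function [m] and its mirror
    image, w into its positive and negative parts, and each of the eight resulting products is put
    on the side of the inequality where it has a plus sign. Tonelli then suffices, and the
    cancellation is a subtraction of finite numbers. This is the role of rho > 0: it makes the total
    mass of [m] finite.

    Reflections replace rotations throughout: one of them exchanges any two vectors of equal norm,
    and that they preserve Lebesgue measure follows from a convolution with the unit ball, without
    determinants. The isodiametric inequality comes from the Prekopa-Leindler inequality instead of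
    symmetrization.

    [hausdorff] is a bare set function, with no additivity at hand. Its integral is therefore
    compared with that of a genuine measure through their values on measurable subsets of the
    sphere. *)

Section vectors.
Context {R : realType} {N : nat}.
Implicit Types (x y z : N.-tuple R) (c : R).

Definition vadd x y : N.-tuple R := [tuple tnth x i + tnth y i | i < N].
Definition vsub x y : N.-tuple R := [tuple tnth x i - tnth y i | i < N].
Definition vscale c x : N.-tuple R := [tuple c * tnth x i | i < N].
Definition vnorm x : R := Num.sqrt (dot x x).

Lemma tnth_vadd x y i : tnth (vadd x y) i = tnth x i + tnth y i.
Proof. by rewrite tnth_mktuple. Qed.

Lemma tnth_vsub x y i : tnth (vsub x y) i = tnth x i - tnth y i.
Proof. by rewrite tnth_mktuple. Qed.

Lemma tnth_vscale c x i : tnth (vscale c x) i = c * tnth x i.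
Proof. by rewrite tnth_mktuple. Qed.

Definition tnthE := (tnth_vadd, tnth_vsub, tnth_vscale).

Lemma dotC x y : dot x y = dot y x.
Proof. by apply: eq_bigr => i _; rewrite mulrC. Qed.

Lemma dotDl x y z : dot (vadd x y) z = dot x z + dot y z.
Proof.
by rewrite /dot -big_split; apply: eq_bigr => i _; rewrite tnthE mulrDl.
Qed.

Lemma dotBl x y z : dot (vsub x y) z = dot x z - dot y z.
Proof.
by rewrite /dot -sumrB; apply: eq_bigr => i _; rewrite tnthE mulrBl.
Qed.

Lemma dotZl c x z : dot (vscale c x) z = c * dot x z.
Proof.
by rewrite /dot mulr_sumr; apply: eq_bigr => i _; rewrite tnthE mulrA.
Qed.

Lemma dotDr x y z : dot z (vadd x y) = dot z x + dot z y.
Proof. by rewrite dotC dotDl !(dotC z). Qed.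

Lemma dotBr x y z : dot z (vsub x y) = dot z x - dot z y.
Proof. by rewrite dotC dotBl !(dotC z). Qed.

Lemma dotZr c x z : dot z (vscale c x) = c * dot z x.
Proof. by rewrite dotC dotZl (dotC z). Qed.

Definition dotE := (dotDl, dotBl, dotZl, dotDr, dotBr, dotZr).

Lemma dotxx_ge0 x : 0 <= dot x x.
Proof. by apply: sumr_ge0 => i _; rewrite -expr2 sqr_ge0. Qed.

Lemma sqr_vnorm x : vnorm x ^+ 2 = dot x x.
Proof. by rewrite sqr_sqrtr// dotxx_ge0. Qed.

Lemma vnorm_ge0 x : 0 <= vnorm x.
Proof. exact: sqrtr_ge0. Qed.

Lemma vnorm_le c x : 0 <= c -> (vnorm x <= c) = (dot x x <= c ^+ 2).
Proof.
by move=> c0; rewrite -(@ler_pXn2r _ 2)// ?nnegrE// ?vnorm_ge0// sqr_vnorm.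
Qed.

Lemma eucl_distE x y : eucl_dist x y = vnorm (vsub x y).
Proof.
by congr Num.sqrt; apply: eq_bigr => i _; rewrite tnthE expr2.
Qed.

Lemma Cauchy_Schwarz x y : `|dot x y| <= vnorm x * vnorm y.
Proof.
have H : dot x y ^+ 2 <= dot x x * dot y y.
  have [y0|y0] := eqVneq (dot y y) 0.
    have yi i : tnth y i = 0.
      apply/eqP; rewrite -sqrf_eq0 expr2; move/eqP: y0.
      rewrite psumr_eq0 => [/allP/(_ i (mem_index_enum i))//|j _].
      by rewrite -expr2 sqr_ge0.
    by rewrite y0 mulr0 /dot big1 ?expr0n// => i _; rewrite yi mulr0.
  have {}y0 : 0 < dot y y by rewrite lt0r y0 dotxx_ge0.
  have := dotxx_ge0 (vsub (vscale (dot y y) x) (vscale (dot x y) y)).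
  rewrite !dotE (dotC y x).
  rewrite [leRHS](_ : _ = dot y y * (dot x x * dot y y - dot x y ^+ 2)); last by ring.
  by rewrite pmulr_rge0// subr_ge0.
rewrite -(@ler_pXn2r _ 2)// ?nnegrE ?mulr_ge0 ?vnorm_ge0//.
by rewrite exprMn !sqr_vnorm real_normK ?num_real.
Qed.

Lemma vnormD x y : vnorm (vadd x y) <= vnorm x + vnorm y.
Proof.
rewrite vnorm_le ?addr_ge0 ?vnorm_ge0// !dotE sqrrD !sqr_vnorm (dotC y x).
have := le_trans (ler_norm _) (Cauchy_Schwarz x y); lra.
Qed.

Lemma vnormZ c x : vnorm (vscale c x) = `|c| * vnorm x.
Proof.
by rewrite /vnorm !dotE mulrA -expr2 sqrtrM ?sqr_ge0// sqrtr_sqr.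
Qed.

Lemma vsubE x y : vsub x y = vadd x (vscale (-1) y).
Proof. by apply: eq_from_tnth => i; rewrite !tnthE mulN1r. Qed.

Lemma vsubC x y : vsub x y = vscale (-1) (vsub y x).
Proof. by apply: eq_from_tnth => i; rewrite !tnthE; ring. Qed.

Lemma vnorm_subC x y : vnorm (vsub x y) = vnorm (vsub y x).
Proof. by rewrite vsubC vnormZ normrN normr1 mul1r. Qed.

Lemma eucl_distC x y : eucl_dist x y = eucl_dist y x.
Proof. by rewrite !eucl_distE vnorm_subC. Qed.

Lemma eucl_dist_ge0 x y : 0 <= eucl_dist x y.
Proof. by rewrite eucl_distE vnorm_ge0. Qed.

Lemma eucl_dist_triangle y x z :
  eucl_dist x z <= eucl_dist x y + eucl_dist y z.
Proof.
rewrite !eucl_distE (_ : vsub x z = vadd (vsub x y) (vsub y z)) ?vnormD//.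
by apply: eq_from_tnth => i; rewrite !tnthE; ring.
Qed.

Lemma ler_tnth_vnorm x i : `|tnth x i| <= vnorm x.
Proof.
rewrite -sqrtr_sqr ler_wsqrtr// /dot (bigD1 i)//= -expr2 lerDl.
by apply: sumr_ge0 => j _; rewrite -expr2 sqr_ge0.
Qed.

Lemma vnorm_le_sup c x : 0 <= c -> (forall i, `|tnth x i| <= c) ->
  vnorm x <= Num.sqrt N%:R * c.
Proof.
move=> c0 xc.
rewrite vnorm_le ?mulr_ge0 ?sqrtr_ge0// exprMn sqr_sqrtr//.
rewrite (_ : _ * _ = \sum_(i < N) c ^+ 2); last first.
  by rewrite sumr_const card_ord mulr_natl.
apply: ler_sum => i _; rewrite -expr2 -real_normK ?num_real//.
by rewrite ler_pXn2r// ?nnegrE.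
Qed.

Lemma vnorm_eq0 x : (vnorm x == 0) = [forall i, tnth x i == 0].
Proof.
apply/eqP/forallP => [x0 i|x0].
  by have := ler_tnth_vnorm x i; rewrite x0 normr_le0.
by rewrite /vnorm /dot big1 ?sqrtr0// => i _; rewrite (eqP (x0 i)) mulr0.
Qed.

Lemma vscale1 x : vscale 1 x = x.
Proof. by apply: eq_from_tnth => i; rewrite !tnthE mul1r. Qed.

Lemma vscaleA c1 c2 x : vscale c1 (vscale c2 x) = vscale (c1 * c2) x.
Proof. by apply: eq_from_tnth => i; rewrite !tnthE mulrA. Qed.

Lemma vaddC x y : vadd x y = vadd y x.
Proof. by apply: eq_from_tnth => i; rewrite !tnthE addrC. Qed.

End vectors.

Lemma dot_cons {R : realType} n (t s : R) (x y : n.-tuple R) :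
  dot (tcons (t, x)) (tcons (s, y)) = t * s + dot x y.
Proof.
rewrite /dot big_ord_recl /=; congr (_ + _).
by apply: eq_bigr => i _; rewrite !tnthS.
Qed.

Section reflection.
Context {R : realType} {N : nat}.
Implicit Types (x y v : N.-tuple R).

(** The Householder reflection in the hyperplane orthogonal to v. As 0^-1 = 0, it is the identity
    for v = 0, so that [reflect_swap] covers the case a = b. *)
Definition reflect v x := vsub x (vscale (2 * dot v x / dot v v) v).

Lemma reflectD v x y : reflect v (vadd x y) = vadd (reflect v x) (reflect v y).
Proof.
by apply: eq_from_tnth => i; rewrite !(tnthE, dotE); ring.
Qed.

Lemma reflectK v : involutive (reflect v).
Proof.
move=> x; have [v0|v0] := eqVneq (dot v v) 0.
  by apply: eq_from_tnth => i; rewrite !(tnthE, dotE) v0 invr0; ring.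
by apply: eq_from_tnth => i; rewrite !(tnthE, dotE); field.
Qed.

Lemma dot_reflect v x y : dot (reflect v x) (reflect v y) = dot x y.
Proof.
have [v0|v0] := eqVneq (dot v v) 0.
  by rewrite !(tnthE, dotE) v0 invr0; ring.
by rewrite !(tnthE, dotE) (dotC x v); field.
Qed.

Lemma vnorm_reflect v x : vnorm (reflect v x) = vnorm x.
Proof. by rewrite /vnorm dot_reflect. Qed.

Lemma reflectB v x y : reflect v (vsub x y) = vsub (reflect v x) (reflect v y).
Proof.
by apply: eq_from_tnth => i; rewrite !(tnthE, dotE); ring.
Qed.

Lemma eucl_dist_reflect v x y :
  eucl_dist (reflect v x) (reflect v y) = eucl_dist x y.
Proof. by rewrite !eucl_distE -reflectB vnorm_reflect. Qed.

(** For v = a - b and |a| = |b|, 2 <v, a> = <v, v>, so exactly v is subtracted from a. *)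
Lemma reflect_swap a b : vnorm a = vnorm b -> reflect (vsub a b) a = b.
Proof.
move=> ab; have {}ab : dot a a = dot b b by rewrite -!sqr_vnorm ab.
have [v0|v0] := eqVneq (dot (vsub a b) (vsub a b)) 0.
  have : vnorm (vsub a b) == 0 by rewrite /vnorm v0 sqrtr0.
  rewrite vnorm_eq0 => /forallP ab0; apply: eq_from_tnth => i.
  have /eqP := ab0 i; rewrite !tnthE => /eqP; rewrite subr_eq0 => /eqP E.
  by rewrite E subrr mulr0 subr0.
apply: eq_from_tnth => i; move: v0.
rewrite !(tnthE, dotE) ab (dotC b a) => v0.
have -> : 2 * (dot b b - dot a b) /
  (dot b b - dot a b - (dot a b - dot b b)) = 1.
  by rewrite (_ : 2 * _ = dot b b - dot a b - (dot a b - dot b b)) ?divff//; ring.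
ring.
Qed.

End reflection.

(** * Lebesgue measure on tuples *)

Notation leb R n := (lebesgue_tuple R n).

Definition image_measure d1 d2 (T1 : measurableType d1)
    (T2 : measurableType d2) (R : realType) (mu : {measure set T1 -> \bar R})
    (f : T1 -> T2) (mf : measurable_fun setT f) :
    {measure set T2 -> \bar R} :=
  measure_function_pushforward__canonical__measure_function_Measure mu mf.

Lemma ge0_integral_image d1 d2 (T1 : measurableType d1)
    (T2 : measurableType d2) (R : realType) (mu : {measure set T1 -> \bar R})
    (f : T1 -> T2) (mf : measurable_fun setT f) (g : T2 -> \bar R) :
  measurable_fun setT g -> (forall x, 0 <= g x)%E ->
  (\int[image_measure mu mf]_x g x = \int[mu]_x g (f x))%E.
Proof.
move=> mg g0.
have := @ge0_integral_pushforward _ _ _ _ R _ mf mu setT g measurableT mg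
  (fun x _ => g0 x).
by rewrite preimage_setT => <-.
Qed.

Section measurability.
Context {R : realType} {N : nat} {d : measure_display} {T : measurableType d}.
Implicit Types f g : T -> N.-tuple R.

Lemma measurable_mktuple (h : 'I_N -> T -> R) :
  (forall i, measurable_fun setT (h i)) ->
  measurable_fun setT (fun x => [tuple h i x | i < N] : N.-tuple R).
Proof.
move=> mh; apply/measurable_fun_tnthP => i.
by rewrite (_ : _ \o _ = h i)//; apply/funext => x /=; rewrite tnth_mktuple.
Qed.

Lemma measurable_tnthT f i : measurable_fun setT f ->
  measurable_fun setT (fun x => tnth (f x) i).
Proof.
move=> mf.
by apply: (@measurableT_comp _ _ _ _ _ _ (fun x => tnth x i)) => //; exact: measurable_tnth.
Qed.

Lemma measurable_vadd f g : measurable_fun setT f -> measurable_fun setT g ->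
  measurable_fun setT (fun x => vadd (f x) (g x)).
Proof.
move=> mf mg; apply: measurable_mktuple => i.
by apply: measurable_funD; exact: measurable_tnthT.
Qed.

Lemma measurable_vsub f g : measurable_fun setT f -> measurable_fun setT g ->
  measurable_fun setT (fun x => vsub (f x) (g x)).
Proof.
move=> mf mg; apply: measurable_mktuple => i.
by apply: measurable_funB; exact: measurable_tnthT.
Qed.

Lemma measurable_vscale (c : T -> R) f : measurable_fun setT c ->
  measurable_fun setT f -> measurable_fun setT (fun x => vscale (c x) (f x)).
Proof.
move=> mc mf; apply: measurable_mktuple => i.
by apply: measurable_funM => //; exact: measurable_tnthT.
Qed.

Lemma measurable_dot f g : measurable_fun setT f -> measurable_fun setT g ->
  measurable_fun setT (fun x => dot (f x) (g x)).
Proof.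
move=> mf mg; apply: measurable_sum => i.
by apply: measurable_funM; exact: measurable_tnthT.
Qed.

Lemma measurable_vnorm f : measurable_fun setT f ->
  measurable_fun setT (fun x => vnorm (f x)).
Proof.
move=> mf; have ms : measurable_fun setT (Num.sqrt : R -> R).
  by apply: continuous_measurable_fun; exact: sqrt_continuous.
exact: (measurableT_comp ms (measurable_dot mf mf)).
Qed.

Lemma measurable_eucl_dist f g : measurable_fun setT f ->
  measurable_fun setT g -> measurable_fun setT (fun x => eucl_dist (f x) (g x)).
Proof.
move=> mf mg; under eq_fun do rewrite eucl_distE.
by apply: measurable_vnorm; exact: measurable_vsub.
Qed.

End measurability.

Section measurability_id.
Context {R : realType} {n : nat}.
Implicit Types x : n.-tuple R.

Lemma measurable_dotr x : measurable_fun setT (dot x).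
Proof. by apply: measurable_dot; [exact: measurable_cst|exact: measurable_id]. Qed.

Lemma measurable_vsubr x : measurable_fun setT (vsub x).
Proof. by apply: measurable_vsub; [exact: measurable_cst|exact: measurable_id]. Qed.

Lemma measurable_vsubl x : measurable_fun setT (vsub ^~ x).
Proof. by apply: measurable_vsub; [exact: measurable_id|exact: measurable_cst]. Qed.

Lemma measurable_vnormT : measurable_fun setT (@vnorm R n).
Proof. exact: measurable_vnorm. Qed.

Lemma measurable_powR_vnorm (b : R) :
  measurable_fun setT (fun x => vnorm x `^ b).
Proof. exact: (measurableT_comp (measurable_powR b) measurable_vnormT). Qed.

End measurability_id.

Section measurable_sets.
Context {R : realType} {N : nat} {d : measure_display} {T : measurableType d}.

Lemma measurable_ler (f g : T -> R) : measurable_fun setT f ->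
  measurable_fun setT g -> measurable [set x | f x <= g x].
Proof.
move=> mf mg.
have := measurable_fun_ler mf mg => /(_ measurableT [set true]).
by rewrite setTI; apply.
Qed.

Lemma measurable_ltr (f g : T -> R) : measurable_fun setT f ->
  measurable_fun setT g -> measurable [set x | f x < g x].
Proof.
move=> mf mg.
have := measurable_fun_ltr mf mg => /(_ measurableT [set true]).
by rewrite setTI; apply.
Qed.

End measurable_sets.

Section lebesgue_affine1.
Context {R : realType}.
Local Notation mu := (@lebesgue_measure R).
Local Open Scope ereal_scope.

(** Lebesgue measure is determined by its values on half-open intervals, and there c times the image
    measure under x -> b + c x has the right value. *)
Lemma lebesgue_measure_affine (c b : R) (A : set R) : (0 < c)%R ->
  measurable A ->
  mu ((fun x => b + c * x)%R @^-1` A) = (c^-1)%:E * mu A.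
Proof.
move=> c0 mA.
have mphi : measurable_fun setT (fun x : R => b + c * x : measurableTypeR R)%R.
  by apply: measurable_funD => //; apply: measurable_funM.
have c0' : (0 <= c)%R by exact: ltW.
pose nu := mscale (NngNum c0') (image_measure mu mphi).
suff H : mu A = nu A.
  rewrite H /nu/= /mscale /= muleA -EFinM mulVf ?gt_eqF// mul1e//.
apply: lebesgue_measure_unique => // _ [[u v]] _ <-.
rewrite /nu /= /mscale /= /pushforward.
rewrite (_ : _ @^-1` _ = `](c^-1 * (u - b))%R, (c^-1 * (v - b))%R]%classic); last first.
  apply/seteqP; split => x /=; rewrite !in_itv/= ler_pdivlMl// ltr_pdivrMl//;
    by move=> /andP[? ?]; apply/andP; split; lra.
rewrite !lebesgue_measure_itv/= !lte_fin ltr_pM2l ?invr_gt0// ltrD2r.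
case: ifPn => // uv; rewrite ?mule0// -!EFinD -EFinM; congr EFin.
by field; rewrite gt_eqF.
Qed.

Lemma ge0_integral_affine1 (c b : R) (f : measurableTypeR R -> \bar R) :
  c != 0%R -> measurable_fun setT f -> (forall x, 0 <= f x) ->
  \int[mu]_x f (b + c * x)%R = (`|c|^-1)%:E * \int[mu]_x f x.
Proof.
move=> c0 mf f0.
have maff c' b' : measurable_fun setT
    (fun x : measurableTypeR R => b' + c' * x : measurableTypeR R)%R.
  by apply: measurable_funD => //; apply: measurable_funM.
have pos c' b' (g : measurableTypeR R -> \bar R) : (0 < c')%R ->
    measurable_fun setT g -> (forall x, 0 <= g x) ->
    \int[mu]_x g (b' + c' * x)%R = (c'^-1)%:E * \int[mu]_x g x.
  move=> c'0 mg g0.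
  rewrite -(ge0_integral_image mu (maff c' b') mg g0).
  have c'i : (0 <= c'^-1)%R by rewrite invr_ge0 ltW.
  rewrite -(@ge0_integral_mscale _ _ _ mu setT measurableT (NngNum c'i))//.
  apply: eq_measure_integral => A mA _.
  exact: lebesgue_measure_affine.
have neg (g : measurableTypeR R -> \bar R) : measurable_fun setT g ->
    (forall x, 0 <= g x) -> \int[mu]_x g (- x)%R = \int[mu]_x g x.
  move=> mg g0.
  have mN : measurable_fun setT
      (-%R : measurableTypeR R -> measurableTypeR R) by [].
  rewrite -(ge0_integral_image mu mN mg g0).
  apply: eq_measure_integral => A mA _.
  exact: lebesgue_measureN.
have [c1|c1] := ltP 0%R c; first by rewrite pos// gtr0_norm.
have {c0}c1 : (c < 0)%R by rewrite lt_neqAle c0.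
have Nc1 : (0 < - c)%R by rewrite oppr_gt0.
rewrite ltr0_norm//.
rewrite -(pos _ b)// -[LHS]neg//; last first.
  by apply: measurableT_comp => //; exact: maff.
by under eq_integral do rewrite mulrN -mulNr.
Qed.

End lebesgue_affine1.

Section lebesgue_tuple_theory.
Context {R : realType}.
Local Notation mu := (@lebesgue_measure R).
Local Open Scope ereal_scope.
Implicit Types n : nat.

Lemma ge0_integral_tuple0 (f : 0.-tuple R -> \bar R) :
  measurable_fun setT f -> (forall x, 0 <= f x) ->
  \int[leb R 0]_x f x = f [tuple].
Proof. by move=> mf f0; rewrite integral_dirac// diracT mul1e. Qed.

Lemma measurable_fun_tconsl n (f : n.+1.-tuple R -> \bar R) t :
  measurable_fun setT f ->
  measurable_fun setT (fun y : n.-tuple R => f (tcons (t, y))).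
Proof.
move=> mf; apply: (measurableT_comp mf).
exact: (measurableT_comp (@measurable_tcons R n) (measurable_pair1 t)).
Qed.

Lemma ge0_integral_tupleS n (f : n.+1.-tuple R -> \bar R) :
  measurable_fun setT f -> (forall x, 0 <= f x) ->
  \int[leb R n.+1]_x f x = \int[mu]_t \int[leb R n]_y f (tcons (t, y)).
Proof.
move=> mf f0.
have -> : \int[leb R n.+1]_x f x =
    \int[(mu \x leb R n)%E]_z f (tcons z).
  by rewrite -(ge0_integral_image _ (@measurable_tcons R n) mf f0).
by rewrite fubini_tonelli1//; exact: (measurableT_comp mf (@measurable_tcons R n)).
Qed.

Lemma measurable_integral_tcons n (f : n.+1.-tuple R -> \bar R) :
  measurable_fun setT f -> (forall x, 0 <= f x) ->
  measurable_fun setT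
    (fun t : measurableTypeR R => \int[leb R n]_y f (tcons (t, y))).
Proof.
move=> mf f0; apply: (@measurable_fun_fubini_tonelli_F _ _ _ _ _ (leb R n)
  (fun z => f (tcons z))) => //.
exact: (measurableT_comp mf (@measurable_tcons R n)).
Qed.

Lemma vaddscale_tcons n c (b x : n.-tuple R) (s t : R) :
  vadd (tcons (s, b)) (vscale c (tcons (t, x))) =
  tcons ((s + c * t)%R, vadd b (vscale c x)).
Proof.
apply: eq_from_tnth => i; rewrite !tnthE.
by have [j ->|->] := unliftP ord0 i; rewrite ?tnthS ?tnthE// !tnth0.
Qed.

Lemma tcons_eta n (x : n.+1.-tuple R) : x = tcons (thead x, [tuple of behead x]).
Proof. by rewrite [LHS]tuple_eta. Qed.

Lemma ge0_integral_affine n (c : R) (b : n.-tuple R) (f : n.-tuple R -> \bar R) :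
  c != 0%R -> measurable_fun setT f -> (forall x, 0 <= f x) ->
  \int[leb R n]_x f (vadd b (vscale c x)) =
    ((`|c|^-1) ^+ n)%:E * \int[leb R n]_x f x.
Proof.
move=> c0; elim: n b f => [|n IH] b f mf f0.
  rewrite expr0 mul1e !ge0_integral_tuple0//; first by rewrite [vadd _ _]tuple0.
  apply: (measurableT_comp mf); apply: measurable_vadd => //.
  by apply: measurable_vscale => //; exact: measurable_id.
have maff : measurable_fun setT (fun x : n.+1.-tuple R => vadd b (vscale c x)).
  by apply: measurable_vadd => //; apply: measurable_vscale => //; exact: measurable_id.
rewrite !ge0_integral_tupleS//; last exact: measurableT_comp.
transitivity (\int[mu]_t (((`|c|^-1) ^+ n)%:E *
    \int[leb R n]_y f (tcons ((thead b + c * t)%R, y)))).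
  apply: eq_integral => t _.
  rewrite -(IH [tuple of behead b]
    (fun y => f (tcons ((thead b + c * t)%R, y))))//.
    by apply: eq_integral => y _; rewrite [in LHS](tcons_eta b) vaddscale_tcons.
  exact: measurable_fun_tconsl.
rewrite ge0_integralZl//; last 2 first.
- apply: (measurableT_comp (f := fun t : measurableTypeR R => \int[leb R n]_y f (tcons (t, y)))).
    exact: measurable_integral_tcons.
  by apply: measurable_funD => //; apply: measurable_funM.
- by move=> t _; exact: integral_ge0.
rewrite (ge0_integral_affine1 (thead b) (f := fun t => \int[leb R n]_y f (tcons (t, y))))//.
- by rewrite muleA -EFinM exprSr.
- exact: measurable_integral_tcons.
- by move=> t; exact: integral_ge0.
Qed.

Lemma ge0_integral_vadd n (b : n.-tuple R) (f : n.-tuple R -> \bar R) :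
  measurable_fun setT f -> (forall x, 0 <= f x) ->
  \int[leb R n]_x f (vadd b x) = \int[leb R n]_x f x.
Proof.
move=> mf f0; have := ge0_integral_affine b (oner_neq0 R) mf f0.
rewrite normr1 invr1 expr1n mul1e => <-.
by under [in RHS]eq_integral do rewrite vscale1.
Qed.

Lemma ge0_integral_vsub n (b : n.-tuple R) (f : n.-tuple R -> \bar R) :
  measurable_fun setT f -> (forall x, 0 <= f x) ->
  \int[leb R n]_x f (vsub b x) = \int[leb R n]_x f x.
Proof.
move=> mf f0.
have N1 : (-1 : R)%R != 0%R by rewrite oppr_eq0 oner_neq0.
have := ge0_integral_affine b N1 mf f0.
rewrite normrN normr1 invr1 expr1n mul1e => <-.
by under eq_integral do rewrite vsubE.
Qed.

Lemma ge0_integral_vscale n (c : R) (f : n.-tuple R -> \bar R) : c != 0%R ->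
  measurable_fun setT f -> (forall x, 0 <= f x) ->
  \int[leb R n]_x f (vscale c x) = ((`|c|^-1) ^+ n)%:E * \int[leb R n]_x f x.
Proof.
move=> c0 mf f0; rewrite -(ge0_integral_affine [tuple 0%R | _ < n] c0 mf f0).
apply: eq_integral => x _; congr f; apply: eq_from_tnth => i.
by rewrite !tnthE tnth_mktuple add0r.
Qed.

Lemma measurable_cube n (I : set (measurableTypeR R)) : measurable I ->
  measurable [set x : n.-tuple R | forall i, I (tnth x i)].
Proof.
move=> mI; rewrite [X in measurable X](_ : _ =
    \bigcap_(i in [set: 'I_n]) ((fun x => tnth x i) @^-1` I)).
  apply: fin_bigcap_measurable => // i _.
  by rewrite -[X in measurable X]setTI; exact: measurable_tnth.
by apply/seteqP; split => x /= h i; [move=> _; exact: h|exact: h].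
Qed.

Lemma leb_cube n (I : set (measurableTypeR R)) : measurable I ->
  leb R n [set x | forall i, I (tnth x i)] = mu I ^+ n.
Proof.
move=> mI.
elim: n => [|n IH]; first by rewrite expe0 /= /dirac indicE mem_set// => -[].
rewrite expeS -IH -product_measure1E//; last exact: measurable_cube.
rewrite [LHS]/= /lebesgue_step /pushforward; congr (_ _).
apply/seteqP; split => -[t x] /= h.
  split; first exact: (h ord0).
  by move=> i; have := h (lift ord0 i); rewrite tnthS.
move=> i; have [j ->|->] := unliftP ord0 i; rewrite ?tnthS ?tnth0//; last exact: h.1.
exact: h.2.
Qed.

End lebesgue_tuple_theory.

Section ball.
Context {R : realType} {n : nat}.
Local Open Scope ereal_scope.

Lemma measurable_uball : measurable (uball R n).
Proof.
apply: measurable_ler => //; apply: measurable_vnorm; exact: measurable_id.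
Qed.

Lemma leb_uball_lty : leb R n (uball R n) < +oo.
Proof.
pose I : set (measurableTypeR R) := `[(-1)%R, 1%R]%classic.
have mI : measurable I by exact: measurable_itv.
apply: (@le_lt_trans _ _ (leb R n [set x | forall i, I (tnth x i)])).
  apply: le_measure; rewrite ?inE; [exact: measurable_uball| |].
    exact: (measurable_cube mI).
  move=> x /= xb i; rewrite /I/= in_itv/= -ler_norml.
  exact: le_trans (ler_tnth_vnorm x i) xb.
rewrite (leb_cube n mI) lebesgue_measure_itv/=.
by case: ifPn => _; rewrite -?EFinD -?EFin_expe ?ltry.
Qed.

Lemma leb_uball_gt0 : 0 < leb R n (uball R n).
Proof.
(* The cube of half-side 1/(n + 1) lies in the unit ball because sqrt n <= n + 1; the successor
   keeps the choice meaningful for n = 0. *)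
pose c : R := (n.+1%:R^-1)%R.
pose I : set (measurableTypeR R) := `[(- c)%R, c]%classic.
have mI : measurable I by exact: measurable_itv.
apply: (@lt_le_trans _ _ (leb R n [set x | forall i, I (tnth x i)])).
  rewrite (leb_cube n mI) lebesgue_measure_itv/=.
  have c0 : (0 < c)%R by rewrite invr_gt0.
  have cc : (- c < c)%R by rewrite (lt_trans _ c0)// oppr_lt0.
  by rewrite lte_fin cc -EFinD -EFin_expe lte_fin exprn_gt0// subr_gt0.
apply: le_measure; rewrite ?inE.
- exact: (measurable_cube mI).
- exact: measurable_uball.
move=> x /= xc; apply: (@le_trans _ _ (Num.sqrt n%:R * c)%R).
  apply: vnorm_le_sup; first by rewrite invr_ge0.
  by move=> i; rewrite ler_norml; have := xc i; rewrite /I/= in_itv.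
rewrite ler_pdivrMr// mul1r -(ger0_norm (ler0n R n.+1)) -sqrtr_sqr.
by rewrite ler_wsqrtr// expr2 -natrM ler_nat; nia.
Qed.

End ball.

(** * Invariance of Lebesgue measure under reflections and translations *)

Section invariance.
Context {R : realType} {n : nat}.
Local Open Scope ereal_scope.
Implicit Types (x y b v : n.-tuple R) (A : set (n.-tuple R)).

Lemma measurable_affine (c : R) b :
  measurable_fun setT (fun x => vadd b (vscale c x)).
Proof.
apply: measurable_vadd; first exact: measurable_cst.
by apply: measurable_vscale; [exact: measurable_cst|exact: measurable_id].
Qed.

Lemma measurable_reflect v : measurable_fun setT (reflect v).
Proof.
apply: measurable_vsub; first exact: measurable_id.
apply: measurable_vscale; last exact: measurable_cst.
apply: measurable_funM; last exact: measurable_cst.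
apply: measurable_funM; first exact: measurable_cst.
exact: measurable_dotr.
Qed.

Lemma leb_affine (c : R) b A : c != 0%R -> measurable A ->
  leb R n ((fun x => vadd b (vscale c x)) @^-1` A) =
  ((`|c|^-1) ^+ n)%:E * leb R n A.
Proof.
move=> c0 mA; rewrite -[in RHS](setIT A) -integral_indic//.
rewrite -(ge0_integral_affine b c0); last 2 first.
- by apply/measurable_EFinP; exact: measurable_indic.
- by move=> x; rewrite lee_fin.
rewrite -[in LHS](setIT (_ @^-1` _)) -integral_indic//.
by rewrite -[X in measurable X]setTI; exact: measurable_affine.
Qed.

(** Let T be the reflection and b the indicator of the unit ball, so that b o T = b. Translations
    and x -> z - x preserve the measure, hence the integral of b times that of f o T is the double
    integral of b(y) f(y - T x), then of b(T x + y) f(y). Since b(T x + y) = b(x + T y), this is the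
    integral of b times that of f. The integral of b is positive and finite and cancels. *)
Lemma ge0_integral_reflect v (f : n.-tuple R -> \bar R) :
  measurable_fun setT f -> (forall x, 0 <= f x) ->
  \int[leb R n]_x f (reflect v x) = \int[leb R n]_x f x.
Proof.
move=> mf f0; pose b x : \bar R := (\1_(uball R n) x)%:E.
have mb : measurable_fun setT b.
  by apply/measurable_EFinP/measurable_indic; exact: measurable_uball.
have b0 x : 0 <= b x by rewrite lee_fin.
have mT := measurable_reflect v.
have bT x : b (reflect v x) = b x.
  rewrite /b !indicE (_ : (_ \in _) = (x \in uball R n))//.
  by apply/idP/idP; rewrite !inE /uball/= -!/(vnorm _) vnorm_reflect.
have Lb : \int[leb R n]_x b x = leb R n (uball R n).
  by rewrite integral_indic ?setIT//; exact: measurable_uball.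
have Lbfin : \int[leb R n]_x b x \is a fin_num.
  by rewrite Lb ge0_fin_numE ?leb_uball_lty.
suff H : \int[leb R n]_x b x * \int[leb R n]_x f (reflect v x) =
         \int[leb R n]_x b x * \int[leb R n]_x f x.
  have Lb0 : 0 < \int[leb R n]_x b x by rewrite Lb leb_uball_gt0.
  by apply/eqP; rewrite eq_le -(lee_pmul2l Lbfin Lb0) -[X in _ && X](lee_pmul2l Lbfin Lb0) H lexx.
have prod (g h : n.-tuple R -> \bar R) : measurable_fun setT g ->
  measurable_fun setT h -> (forall x, 0 <= g x) -> (forall x, 0 <= h x) ->
  \int[leb R n]_y \int[leb R n]_x (g y * h x) =
  \int[leb R n]_y g y * \int[leb R n]_x h x.
  move=> mg mh g0 h0.
  under eq_integral do rewrite ge0_integralZl//.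
  by rewrite ge0_integralZr//; exact: integral_ge0.
have m1 : measurable_fun setT (@fst (n.-tuple R) (n.-tuple R)) by [].
have m2 : measurable_fun setT (@snd (n.-tuple R) (n.-tuple R)) by [].
rewrite -prod//; last exact: measurableT_comp.
transitivity (\int[leb R n]_y \int[leb R n]_x
    (b y * f (vsub y (reflect v x)))).
  apply: eq_integral => y _.
  rewrite -(ge0_integral_vsub (reflect v y)); last 2 first.
  - by apply: measurable_funeM; exact: measurableT_comp.
  - by move=> x; exact: mule_ge0.
  by apply: eq_integral => x _; rewrite reflectB reflectK.
rewrite (fubini_tonelli (fun z => b z.1 * f (vsub z.1 (reflect v z.2)))); last 2 first.
- apply: emeasurable_funM; first exact: measurableT_comp.
  apply: (measurableT_comp mf); apply: measurable_vsub => //.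
  exact: measurableT_comp.
- by move=> z; exact: mule_ge0.
transitivity (\int[leb R n]_x \int[leb R n]_y
    (b (vadd (reflect v x) y) * f y)).
  apply: eq_integral => x _ /=.
  rewrite -(ge0_integral_vadd (reflect v x)); last 2 first.
  - apply: emeasurable_funM => //.
    by apply: (measurableT_comp mf); apply: measurable_vsub.
  - by move=> y; exact: mule_ge0.
  apply: eq_integral => y _; congr (_ * f _).
  by apply: eq_from_tnth => i; rewrite !tnthE; ring.
rewrite (fubini_tonelli (fun z => b (vadd (reflect v z.1) z.2) * f z.2)); last 2 first.
- apply: emeasurable_funM; last exact: measurableT_comp.
  apply: (measurableT_comp mb); apply: measurable_vadd => //.
  exact: measurableT_comp.
- by move=> z; exact: mule_ge0.
rewrite [RHS]muleC -[RHS](prod f b mf mb f0 b0).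
apply: eq_integral => y _.
rewrite -[RHS](ge0_integral_vadd (reflect v y)); last 2 first.
- exact: measurable_funeM.
- by move=> x; exact: mule_ge0.
apply: eq_integral => x _.
by rewrite muleC -[in RHS]bT reflectD reflectK vaddC.
Qed.

Lemma leb_reflect v A : measurable A -> leb R n (reflect v @^-1` A) = leb R n A.
Proof.
move=> mA; rewrite -[in RHS](setIT A) -integral_indic//.
rewrite -(ge0_integral_reflect v); last 2 first.
- by apply/measurable_EFinP; exact: measurable_indic.
- by move=> x; rewrite lee_fin.
rewrite -[in LHS](setIT (_ @^-1` _)) -integral_indic//.
by rewrite -[X in measurable X]setTI; exact: measurable_reflect.
Qed.

Lemma leb_ball (t : R) b : (0 <= t)%R ->
  leb R n [set x | (eucl_dist b x <= t)%R] = (t ^+ n)%:E * leb R n (uball R n).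
Proof.
(* The ball of radius 0 is a point, written as a translate of a cube over {0}. Its measure is 0,
   except in dimension 0, where it is 1 = 0^0. *)
rewrite le_eqVlt => /predU1P[<-|t0].
  have -> : [set x | (eucl_dist b x <= 0)%R] =
    (fun x => vadd (vscale (-1) b) (vscale 1 x)) @^-1`
      [set x | forall i, [set 0%R : measurableTypeR R] (tnth x i)].
    apply/seteqP; split => x /=.
      rewrite eucl_distE => h i; rewrite !tnthE.
      have : vnorm (vsub b x) == 0%R by rewrite eq_le h vnorm_ge0.
      rewrite vnorm_eq0 => /forallP/(_ i); rewrite tnthE => /eqP; lra.
    move=> h; rewrite eucl_distE le_eqVlt; apply/orP; left.
    by rewrite vnorm_eq0; apply/forallP => i; have := h i; rewrite !tnthE => ?; apply/eqP; lra.
  rewrite leb_affine ?oner_neq0//; last exact: measurable_cube.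
  rewrite normr1 invr1 expr1n mul1e leb_cube// lebesgue_measure_set1.
  case: n => [|m]; last by rewrite expeS mul0e expr0n mul0e.
  by rewrite expr0 mul1e expe0/= /dirac indicE mem_set// /uball/= /dot big_ord0 sqrtr0.
have -> : [set x | (eucl_dist b x <= t)%R] =
    (fun x => vadd (vscale (- t^-1) b) (vscale (t^-1) x)) @^-1` uball R n.
  apply/funext => x; rewrite /preimage /uball /= -/(vnorm _) eucl_distE.
  rewrite (_ : vadd _ _ = vscale (- t^-1) (vsub b x)).
    by rewrite vnormZ normrN gtr0_norm ?invr_gt0// ler_pdivrMl// mulr1.
  by apply: eq_from_tnth => i; rewrite !tnthE; ring.
rewrite leb_affine//; last 2 first.
- by rewrite invr_eq0 gt_eqF.
- exact: measurable_uball.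
by rewrite gtr0_norm ?invr_gt0// invrK.
Qed.

End invariance.

(** * The isodiametric inequality *)

Section layer_cake.
Context {R : realType} {d : measure_display} {T : measurableType d}.
Variable m : {sigma_finite_measure set T -> \bar R}.
Local Notation mu := (@lebesgue_measure R).
Local Open Scope ereal_scope.

Let level (f : T -> R) : set (T * measurableTypeR R) :=
  [set z | (0 <= z.2 < f z.1)%R].

Let measurable_level (f : T -> R) : measurable_fun setT f -> measurable (level f).
Proof.
move=> mf; have mfst : measurable_fun setT (fun z : T * measurableTypeR R => f z.1).
  exact: measurableT_comp.
rewrite [level f](_ : _ = [set z | (0 <= z.2)%R] `&` [set z | (z.2 < f z.1)%R]).
  by apply: measurableI; [exact: measurable_ler|exact: measurable_ltr].
by apply/seteqP; split => z /=; rewrite /level/= => /andP.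
Qed.

Lemma measurable_superlevel_set (f : T -> R) (t : R) : measurable_fun setT f ->
  measurable [set x | (0 <= t < f x)%R].
Proof.
move=> mf.
rewrite [X in measurable X](_ : _ = (if (0 <= t)%R then [set x | (t < f x)%R] else set0)).
  by case: ifP => // _; exact: measurable_ltr.
by case: ifP => t0; apply/seteqP; split => x //=; rewrite ?t0.
Qed.

Let integral_level (f : T -> R) (t : R) : measurable_fun setT f ->
  m [set x | (0 <= t < f x)%R] = \int[m]_x (\1_(level f) (x, t))%:E.
Proof.
move=> mf.
rewrite (_ : (fun x => _) = (fun x => (\1_[set x | (0 <= t < f x)%R] x)%:E)).
  by rewrite integral_indic ?setIT//; exact: measurable_superlevel_set.
by apply/funext => x; rewrite !indicE /level !mem_setE.
Qed.

Let measurable_indic_level (f : T -> R) : measurable_fun setT f ->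
  measurable_fun setT (fun z => (\1_(level f) z)%:E : \bar R).
Proof.
by move=> mf; apply/measurable_EFinP; apply: measurable_indic; exact: measurable_level.
Qed.

Lemma measurable_superlevel (f : T -> R) : measurable_fun setT f ->
  measurable_fun setT
    (fun t : measurableTypeR R => m [set x | (0 <= t < f x)%R]).
Proof.
move=> mf; rewrite (_ : (fun t => _) =
    (fun t => \int[m]_x (\1_(level f) (x, t))%:E)).
  apply: (@measurable_fun_fubini_tonelli_G _ _ _ _ _ m
    (fun z => (\1_(level f) z)%:E)); first exact: measurable_indic_level.
  by move=> z; rewrite lee_fin.
by apply/funext => t; exact: integral_level.
Qed.

(** Tonelli for the region under the graph. The level sets keep the condition [0 <= t], so that the
    outer integral runs over the whole line. *)
Lemma layer_cake (f : T -> R) : measurable_fun setT f ->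
  (forall x, (0 <= f x)%R) ->
  \int[m]_x (f x)%:E = \int[mu]_t m [set x | (0 <= t < f x)%R].
Proof.
move=> mf f0.
transitivity (\int[m]_x \int[mu]_y (\1_(level f) (x, y))%:E).
  apply: eq_integral => x _.
  pose J : set (measurableTypeR R) := `[0%R, f x[%classic.
  have mJ : measurable J by exact: measurable_itv.
  transitivity (\int[mu]_y (\1_J y : R)%:E).
    rewrite integral_indic//= setIT.
    rewrite lebesgue_measure_itv/= lte_fin sube0.
    by have := f0 x; rewrite le_eqVlt => /predU1P[<-|->//]; rewrite ltxx.
  by apply: eq_integral => y _; rewrite !indicE /level /J !mem_setE in_itv.
rewrite (@fubini_tonelli _ _ T (measurableTypeR R) R m mu
  (fun z => (\1_(level f) z)%:E) (measurable_indic_level mf)).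
  by apply: eq_integral => t _; rewrite integral_level.
by move=> z; rewrite lee_fin.
Qed.

End layer_cake.

(** * The Prekopa-Leindler inequality *)

Section Prekopa_Leindler1.
Context {R : realType}.
Local Notation mu := (@lebesgue_measure R).
Local Open Scope ereal_scope.
Implicit Types A B H : set (measurableTypeR R).

(** Take a0 in A close to sup A and b0 in B close to inf B, with midpoint c. The midpoints of b0
    with points of A up to a0 lie in H to the left of c, those of a0 with points of B beyond b0 lie
    in H to the right of c, and halving lengths gives the factor 2. The neglected parts of A and B
    lie in intervals of length e / 2. *)
Lemma Brunn_Minkowski1 A B H : measurable A -> measurable B -> measurable H ->
  A !=set0 -> B !=set0 -> has_ubound A -> has_lbound B ->
  (forall x y : R, A x -> B y -> H (2^-1 * x + 2^-1 * y)%R) ->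
  mu A + mu B <= 2%:E * mu H.
Proof.
move=> mA mB mH A0 B0 uA lB ABH.
apply/lee_addgt0Pr => e e0; pose e2 := (e / 2)%R.
have e20 : (0 < e2)%R by rewrite divr_gt0.
have [a0 Aa0 sa0] := @sup_adherent _ A e2 e20 (conj A0 uA).
have [b0 Bb0 ib0] := @inf_adherent _ B e2 e20 (conj B0 lB).
pose c := (2^-1 * a0 + 2^-1 * b0)%R.
pose H1 : set (measurableTypeR R) := H `&` `]-oo, c]%classic.
pose H2 : set (measurableTypeR R) := H `&` `]c, +oo[%classic.
have mH1 : measurable H1 by apply: measurableI => //; exact: measurable_itv.
have mH2 : measurable H2 by apply: measurableI => //; exact: measurable_itv.
have half (s : R) (K : set (measurableTypeR R)) : measurable K ->
    mu ((fun x => s + 2^-1 * x)%R @^-1` K) = 2%:E * mu K.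
  by move=> mK; rewrite lebesgue_measure_affine// invrK.
have mpre (s : R) (K : set (measurableTypeR R)) : measurable K ->
    measurable (((fun x => s + 2^-1 * x)%R : measurableTypeR R -> measurableTypeR R) @^-1` K).
  move=> mK; rewrite -[X in measurable X]setTI.
  have : measurable_fun setT (fun x : measurableTypeR R => s + 2^-1 * x : measurableTypeR R)%R.
    by apply: measurable_funD => //; apply: measurable_funM.
  by apply.
have HA : mu A <= 2%:E * mu H1 + e2%:E.
  rewrite -(half (2^-1 * b0)%R)//.
  have -> : e2%:E = mu `](sup A - e2)%R, (sup A)]%classic.
    by rewrite lebesgue_measure_itv/= lte_fin gtrBl// e20 -EFinD; congr EFin; ring.
  apply: le_trans (measureU2 _ _ _); [|exact: mpre|exact: measurable_itv].
  apply: le_measure; rewrite ?inE//.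
    by apply: measurableU; [exact: mpre|exact: measurable_itv].
  move=> x Ax; have [xa|xa] := leP x a0.
    left; split => /=; first by rewrite addrC; exact: ABH.
    by rewrite in_itv/= /c; lra.
  right; rewrite /= in_itv/= (lt_trans sa0 xa)/=.
  exact: ub_le_sup.
have HB : mu B <= 2%:E * mu H2 + e2%:E.
  rewrite -(half (2^-1 * a0)%R)//.
  have -> : e2%:E = mu `[(inf B), (inf B + e2)%R]%classic.
    by rewrite lebesgue_measure_itv/= lte_fin ltrDl e20 -EFinD; congr EFin; ring.
  apply: le_trans (measureU2 _ _ _); [|exact: mpre|exact: measurable_itv].
  apply: le_measure; rewrite ?inE//.
    by apply: measurableU; [exact: mpre|exact: measurable_itv].
  move=> x Bx; have [xa|xa] := leP x b0.
    right; rewrite /= in_itv/= (ge_inf lB Bx)/=.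
    exact: ltW (le_lt_trans xa ib0).
  left; split => /=; first exact: ABH.
  by rewrite in_itv/= /c andbT; lra.
apply: (le_trans (leeD HA HB)).
rewrite addeACA -EFinD -[(e2 + e2)%R]mulr2n -[(e2 *+ 2)%R]mulr_natr divfK// leeD2r//.
rewrite -ge0_muleDr// lee_pmul2l ?lte_fin//.
rewrite -measureU//; last first.
  apply/seteqP; split => x //= -[[_ +] [_ +]].
  by rewrite /= !in_itv/= andbT => /le_lt_trans/[apply]; rewrite ltxx.
by apply: le_measure; rewrite ?inE//; [exact: measurableU|move=> x [|] []].
Qed.

Definition tame1 (f : measurableTypeR R -> R) := [/\ measurable_fun setT f,
  (forall x, (0 <= f x)%R) & exists M B : R, (0 <= M)%R /\
  forall x, (f x <= M * \1_[set y | (`|y| <= B)%R] x)%R].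

Lemma tame1_integral_fin f : tame1 f -> \int[mu]_x (f x)%:E \is a fin_num.
Proof.
move=> [mf f0 [M [B [M0 fMB]]]].
pose J : set (measurableTypeR R) := [set y | (`|y| <= B)%R].
have JE : J = `[(- B)%R, B]%classic.
  by apply/seteqP; split => x; rewrite /J /= in_itv/= -ler_norml.
have mJ : measurable J by rewrite JE; exact: measurable_itv.
rewrite ge0_fin_numE; last by apply: integral_ge0 => x _; rewrite lee_fin.
apply: (@le_lt_trans _ _ (\int[mu]_x (M * \1_J x)%:E)).
  apply: ge0_le_integral => //=.
  - by move=> x _; rewrite lee_fin.
  - exact/measurable_EFinP.
  - by apply/measurable_EFinP; apply: measurable_funM => //; exact: measurable_indic.
  - by move=> x _; rewrite lee_fin.
under eq_integral do rewrite EFinM.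
rewrite ge0_integralZl//; last by apply/measurable_EFinP; exact: measurable_indic.
rewrite integral_indic// setIT; apply: lte_mul_pinfty; rewrite ?lee_fin//.
have : mu J < +oo.
  by rewrite JE lebesgue_measure_itv/=; case: ifP => _; rewrite ?ltry// -EFinD ltry.
by [].
Qed.

Lemma tame1_sup f : tame1 f -> exists2 a, (0 <= a)%R &
  (forall x, (f x <= a)%R) /\ (forall t, (0 <= t < a)%R -> exists x, (t < f x)%R).
Proof.
move=> [mf f0 [M [B [M0 fMB]]]].
have sf : has_sup (range f).
  split; first by exists (f 0%R), 0%R.
  exists M => _ [x _ <-]; apply: (le_trans (fMB x)).
  by rewrite ler_piMr// indicE; case: (_ \in _).
have fa x : (f x <= sup (range f))%R.
  by apply: (ub_le_sup sf.2); exists x.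
exists (sup (range f)); first exact: le_trans (f0 0%R) (fa _).
split => // t /andP[t0 ta].
have e0 : (0 < sup (range f) - t)%R by rewrite subr_gt0.
have [_ [x _ <-]] := sup_adherent e0 sf.
by rewrite subKr => tx; exists x.
Qed.

Lemma tame1_bounded f t : tame1 f ->
  has_ubound [set x | (0 <= t < f x)%R] /\ has_lbound [set x | (0 <= t < f x)%R].
Proof.
move=> [mf f0 [M [B [M0 fMB]]]].
have fB x : (0 <= t < f x)%R -> (`|x| <= B)%R.
  move=> /andP[t0 tfx]; have := fMB x; rewrite indicE.
  case: (asboolP (`|x| <= B)%R) => // nB.
  rewrite memNset// mulr0 => /(lt_le_trans tfx).
  by rewrite ltNge t0.
by split; [exists B|exists (- B)%R] => x /= /fB; rewrite ler_norml => /andP[].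
Qed.

Lemma tame1_scale (c : R) f : (0 <= c)%R -> tame1 f ->
  tame1 (fun x => c * f x)%R /\
  \int[mu]_x (c * f x)%:E = c%:E * \int[mu]_x (f x)%:E.
Proof.
move=> c0 [mf f0 [M [B [M0 fMB]]]]; split; last first.
  under eq_integral do rewrite EFinM.
  rewrite ge0_integralZl//; first exact/measurable_EFinP.
  by move=> x _; rewrite lee_fin.
split; first exact: measurable_funM.
  by move=> x; rewrite mulr_ge0.
exists (c * M)%R, B; split; first by rewrite mulr_ge0.
by move=> x; rewrite -mulrA ler_wpM2l.
Qed.

(** Divide f and g by their suprema a and b, and h by c = sqrt (a b). For 0 <= t < 1 the sets where
    f/a and g/b exceed t are nonempty and their midpoints lie where h/c exceeds t, so the
    one-dimensional Brunn-Minkowski inequality applies; for other t the left-hand sets are empty.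
    Without the normalization one of the two sets could be empty while the other is not. *)
Lemma Prekopa_Leindler1 (f g h : measurableTypeR R -> R) :
  tame1 f -> tame1 g -> tame1 h ->
  (forall x y, f x * g y <= h (2^-1 * x + 2^-1 * y) ^+ 2)%R ->
  (\int[mu]_x (f x)%:E) * (\int[mu]_x (g x)%:E) <= (\int[mu]_x (h x)%:E) ^+ 2.
Proof.
move=> tf tg th fgh.
have [a a0 [fa af]] := tame1_sup tf.
have [b b0 [gb bg]] := tame1_sup tg.
have int0 k : \int[mu]_x (k x)%:E = 0 ->
    \int[mu]_x (f x)%:E = \int[mu]_x (k x)%:E \/
    \int[mu]_x (g x)%:E = \int[mu]_x (k x)%:E ->
  (\int[mu]_x (f x)%:E) * (\int[mu]_x (g x)%:E) <= (\int[mu]_x (h x)%:E) ^+ 2.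
  by move=> -> [->|->]; rewrite ?mul0e ?mule0 expe2 sqre_ge0.
have [az|{}a0] := eqVneq a 0%R.
  apply: (int0 (fun=> 0%R)); first exact: integral0.
  left; apply: eq_integral => x _; congr EFin; apply/eqP.
  by rewrite eq_le; case: tf => _ -> _; rewrite -az fa.
have [bz|{}b0] := eqVneq b 0%R.
  apply: (int0 (fun=> 0%R)); first exact: integral0.
  right; apply: eq_integral => x _; congr EFin; apply/eqP.
  by rewrite eq_le; case: tg => _ -> _; rewrite -bz gb.
have {}a0 : (0 < a)%R by rewrite lt_neqAle eq_sym a0; case: tf => _ /(_ 0%R) /le_trans -> //.
have {}b0 : (0 < b)%R by rewrite lt_neqAle eq_sym b0; case: tg => _ /(_ 0%R) /le_trans -> //.
pose c := Num.sqrt (a * b).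
have c0 : (0 < c)%R by rewrite sqrtr_gt0 mulr_gt0.
have c2 : (c ^+ 2 = a * b)%R by rewrite sqr_sqrtr// mulr_ge0// ltW.
have ai : (0 <= a^-1)%R by rewrite invr_ge0 ltW.
have bi : (0 <= b^-1)%R by rewrite invr_ge0 ltW.
have ci : (0 <= c^-1)%R by rewrite invr_ge0 ltW.
have [tf' If] := tame1_scale ai tf; have [mf' f'0 _] := tf'.
have [tg' Ig] := tame1_scale bi tg; have [mg' g'0 _] := tg'.
have [th' Ih] := tame1_scale ci th; have [mh' h'0 _] := th'.
have key : \int[mu]_x (a^-1 * f x)%:E + \int[mu]_x (b^-1 * g x)%:E <=
    2%:E * \int[mu]_x (c^-1 * h x)%:E.
  rewrite !layer_cake// -ge0_integralD//; [|exact: measurable_superlevel..].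
  rewrite -ge0_integralZl//; last exact: measurable_superlevel.
  apply: ge0_le_integral => //.
  - by move=> t _; rewrite adde_ge0.
  - by apply: emeasurable_funD; exact: measurable_superlevel.
  - by apply: measurable_funeM; exact: measurable_superlevel.
  move=> t _; rewrite /=.
  have em (S : set (measurableTypeR R)) : (forall x, ~ S x) -> mu S = 0.
    by move=> S0; rewrite (_ : S = set0) ?measure0//; apply/seteqP; split => x // /S0.
  case/boolP: (t < 0)%R => [t0|]; last rewrite -leNgt => t0.
    by rewrite !em ?mule0 ?adde0// => x /andP[]; rewrite leNgt t0.
  case/boolP: (1 <= t)%R => [t1|]; last rewrite -ltNge => t1.
    rewrite em; last first.
      move=> x /andP[_]; rewrite ltr_pdivlMl// => /lt_le_trans/(_ (fa x)).
      by rewrite gtr_pMr// ltNge t1.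
    rewrite em; last first.
      move=> x /andP[_]; rewrite ltr_pdivlMl// => /lt_le_trans/(_ (gb x)).
      by rewrite gtr_pMr// ltNge t1.
    by rewrite adde0 mule_ge0.
  apply: (Brunn_Minkowski1 (measurable_superlevel_set t mf')
    (measurable_superlevel_set t mg') (measurable_superlevel_set t mh')).
  - have [|x ?] := af (a * t)%R; first by rewrite (mulr_ge0 (ltW a0) t0)/= gtr_pMr.
    by exists x; rewrite /= t0 ltr_pdivlMl.
  - have [|x ?] := bg (b * t)%R; first by rewrite (mulr_ge0 (ltW b0) t0)/= gtr_pMr.
    by exists x; rewrite /= t0 ltr_pdivlMl.
  - exact: (tame1_bounded t tf').1.
  - exact: (tame1_bounded t tg').2.
  move=> x y /=; rewrite t0 /= ltr_pdivlMl// ltr_pdivlMl// ltr_pdivlMl// => fx gy.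
  have [_ hp _] := th.
  rewrite -(@ltr_pXn2r _ 2)// ?nnegrE ?mulr_ge0 ?hp// ?ltW//.
  apply: lt_le_trans (fgh x y); rewrite exprMn c2.
  rewrite (_ : a * b * t ^+ 2 = (a * t) * (b * t))%R; last by ring.
  by apply: ltr_pM => //; rewrite mulr_ge0// ltW.
rewrite If Ig Ih in key.
move: key; rewrite -(fineK (tame1_integral_fin tf)) -(fineK (tame1_integral_fin tg)).
rewrite -(fineK (tame1_integral_fin th)) -!EFinM -EFinD -EFin_expe !lee_fin.
have fine0 k : tame1 k -> (0 <= fine (\int[mu]_x (k x)%:E))%R.
  by move=> [_ k0 _]; apply: fine_ge0; apply: integral_ge0 => x _; rewrite lee_fin.
move: (fine0 _ tf) (fine0 _ tg) (fine0 _ th).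
set F := fine _; set G := fine _; set H := fine _ => F0 G0 H0 key.
have {}key : (c * (a^-1 * F + b^-1 * G) / 2 <= H)%R.
  rewrite ler_pdivrMr// -ler_pdivlMl//; apply: (le_trans key).
  by rewrite le_eqVlt; apply/orP; left; apply/eqP; ring.
have k0 : (0 <= c * (a^-1 * F + b^-1 * G) / 2)%R.
  by rewrite !mulr_ge0 ?addr_ge0 ?mulr_ge0// ltW.
apply: le_trans (_ : (c * (a^-1 * F + b^-1 * G) / 2) ^+ 2 <= _)%R; last first.
  by rewrite ler_pXn2r// nnegrE.
(* The arithmetic-geometric mean inequality for F/a and G/b, using c^2 = a b. *)
rewrite !exprMn c2 -subr_ge0.
rewrite (_ : (_ - _)%R = (a * b * (2^-1 * (a^-1 * F - b^-1 * G)) ^+ 2)%R).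
  by rewrite mulr_ge0 ?sqr_ge0// mulr_ge0 ?ltW.
by field; rewrite !gt_eqF.
Qed.

End Prekopa_Leindler1.

Section Prekopa_Leindler.
Context {R : realType}.
Local Notation mu := (@lebesgue_measure R).
Local Open Scope ereal_scope.

Definition cube n (B : R) : set (n.-tuple R) :=
  [set y | forall i, (`|tnth y i| <= B)%R].
Local Arguments cube : clear implicits.

Let cubeE n B : cube n B = [set y | forall i, [set r : measurableTypeR R | (`|r| <= B)%R] (tnth y i)].
Proof. by []. Qed.

Let absE (B : R) : [set r : measurableTypeR R | (`|r| <= B)%R] = `[(- B)%R, B]%classic.
Proof. by apply/seteqP; split => x; rewrite /= in_itv/= -ler_norml. Qed.

Let mabs B : measurable [set r : measurableTypeR R | (`|r| <= B)%R].
Proof. by rewrite absE; exact: measurable_itv. Qed.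

Lemma measurable_cubeB n B : measurable (cube n B).
Proof. by apply: (measurable_cube (mabs B)). Qed.

Lemma leb_cubeB_lty n B : leb R n (cube n B) < +oo.
Proof.
rewrite cubeE (leb_cube n (mabs B)).
rewrite absE lebesgue_measure_itv/=.
by case: ifP => _; rewrite -?EFinD -?EFin_expe ?ltry.
Qed.

(** A class that keeps all integrals finite and is stable under sections and under integrating out
    coordinates, as the induction on the dimension requires. *)
Definition tame n (f : n.-tuple R -> R) := [/\ measurable_fun setT f,
  (forall x, (0 <= f x)%R) & exists M B : R, (0 <= M)%R /\
  forall x, (f x <= M * \1_(cube n B) x)%R].

Let cube_cons n B t (y : n.-tuple R) :
  (\1_(cube n.+1 B) (tcons (t, y)) : R) =
  (\1_[set r : measurableTypeR R | `|r| <= B] t * \1_(cube n B) y)%R.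
Proof.
rewrite !indicE.
rewrite -natrM mulnb; congr ((_ : bool)%:R).
apply/idP/idP => [|/andP[]]; rewrite !inE.
  move=> h; apply/andP; split; rewrite inE; first exact: (h ord0).
  by move=> i; have := h (lift ord0 i); rewrite tnthS.
move=> h0 h i; have [j ->|->] := unliftP ord0 i; rewrite ?tnthS ?tnth0//; exact: h.
Qed.

Lemma indic_cubeS n B t (y : n.-tuple R) :
  (\1_(cube n.+1 B) (tcons (t, y)) <= (\1_(cube n B) y : R))%R.
Proof.
rewrite cube_cons indicE; case: (_ \in _); rewrite ?mul1r ?mul0r//.
Qed.

Lemma tame_section n (f : n.+1.-tuple R -> R) t : tame f ->
  tame (fun y => f (tcons (t, y))).
Proof.
move=> [mf f0 [M [B [M0 fMB]]]]; split => //.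
  apply: (measurableT_comp mf).
  exact: (measurableT_comp (@measurable_tcons R n) (measurable_pair1 t)).
exists M, B; split=> // y; apply: (le_trans (fMB _)).
by rewrite ler_wpM2l// indic_cubeS.
Qed.

Let integral_indic_cube n (c : R) B : (0 <= c)%R ->
  \int[leb R n]_x (c * \1_(cube n B) x)%:E = c%:E * leb R n (cube n B).
Proof.
move=> c0; under eq_integral do rewrite EFinM.
rewrite ge0_integralZl//; last first.
  by apply/measurable_EFinP; apply: measurable_indic; exact: measurable_cubeB.
by rewrite integral_indic ?setIT//; exact: measurable_cubeB.
Qed.

Lemma tame_le_integral n (f : n.-tuple R -> R) (c B : R) :
  measurable_fun setT f -> (forall x, 0 <= f x)%R -> (0 <= c)%R ->
  (forall x, f x <= c * \1_(cube n B) x)%R ->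
  \int[leb R n]_x (f x)%:E <= c%:E * leb R n (cube n B).
Proof.
move=> mf f0 c0 fc; rewrite -integral_indic_cube//.
apply: ge0_le_integral => //.
- by move=> x _; rewrite lee_fin.
- exact/measurable_EFinP.
- apply/measurable_EFinP; apply: measurable_funM => //.
  by apply: measurable_indic; exact: measurable_cubeB.
- by move=> x _; rewrite lee_fin.
Qed.

Lemma tame_integral_fin n (f : n.-tuple R -> R) : tame f ->
  \int[leb R n]_x (f x)%:E \is a fin_num.
Proof.
move=> [mf f0 [M [B [M0 fMB]]]].
rewrite ge0_fin_numE; last by apply: integral_ge0 => x _; rewrite lee_fin.
apply: le_lt_trans (tame_le_integral mf f0 M0 fMB) _.
by apply: lte_mul_pinfty; rewrite ?lee_fin// leb_cubeB_lty.
Qed.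

Lemma tame1_integral n (f : n.+1.-tuple R -> R) : tame f ->
  tame1 (fun t => fine (\int[leb R n]_y (f (tcons (t, y)))%:E)) /\
  \int[leb R n.+1]_x (f x)%:E =
  \int[mu]_t (fine (\int[leb R n]_y (f (tcons (t, y)))%:E))%:E.
Proof.
move=> tf; have [mf f0 [M [B [M0 fMB]]]] := tf.
have mEf : measurable_fun setT (EFin \o f) by exact/measurable_EFinP.
split; last first.
  rewrite ge0_integral_tupleS//.
  by apply: eq_integral => t _; rewrite fineK//; exact: (tame_integral_fin (tame_section t tf)).
split.
- apply: (measurableT_comp (f := fine)); first exact: fine_measurable.
  by apply: (@measurable_integral_tcons _ n (EFin \o f)) => // x; rewrite lee_fin.
- by move=> t; apply: fine_ge0; apply: integral_ge0 => y _; rewrite lee_fin.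
exists (M * fine (leb R n (cube n B)))%R, B.
have Cfin : leb R n (cube n B) \is a fin_num.
  by rewrite ge0_fin_numE// leb_cubeB_lty.
split; first by rewrite mulr_ge0// fine_ge0.
move=> t; set i := \1_ _ t : R.
have i0 : (0 <= i)%R by rewrite /i.
rewrite mulrAC -lee_fin EFinM (fineK Cfin).
rewrite fineK; last exact: (tame_integral_fin (tame_section t tf)).
apply: tame_le_integral.
- by case: (tame_section t tf).
- by case: (tame_section t tf).
- by rewrite mulr_ge0.
by move=> y; apply: (le_trans (fMB _)); rewrite cube_cons mulrA.
Qed.

(** For fixed first coordinates s and t, the sections of f, g and h satisfy the hypothesis in
    dimension n. The induction hypothesis then says precisely that their integrals, as functions of
    s and t, satisfy the hypothesis in dimension 1. *)
Lemma Prekopa_Leindler n (f g h : n.-tuple R -> R) :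
  tame f -> tame g -> tame h ->
  (forall x y, f x * g y <= h (vadd (vscale 2^-1 x) (vscale 2^-1 y)) ^+ 2)%R ->
  (\int[leb R n]_x (f x)%:E) * (\int[leb R n]_x (g x)%:E) <=
  (\int[leb R n]_x (h x)%:E) ^+ 2.
Proof.
elim: n f g h => [|n IH] f g h tf tg th fgh.
  have [mf f0 _] := tf; have [mg g0 _] := tg; have [mh h0 _] := th.
  rewrite !ge0_integral_tuple0//; try exact/measurable_EFinP;
    try by move=> x; rewrite lee_fin.
  rewrite -EFinM -EFin_expe lee_fin; apply: le_trans (fgh _ _) _.
  by rewrite (tuple0 (vadd _ _)).
have [tF ->] := tame1_integral tf.
have [tG ->] := tame1_integral tg.
have [tH ->] := tame1_integral th.
apply: Prekopa_Leindler1 => // s t.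
rewrite -lee_fin EFinM EFin_expe !fineK; first last.
- exact: (tame_integral_fin (tame_section _ tf)).
- exact: (tame_integral_fin (tame_section _ tg)).
- exact: (tame_integral_fin (tame_section _ th)).
apply: IH; [exact: tame_section..|].
move=> x y; apply: le_trans (fgh _ _) _.
suff -> : vadd (vscale 2^-1 (tcons (s, x))) (vscale 2^-1 (tcons (t, y))) =
  tcons ((2^-1 * s + 2^-1 * t)%R, vadd (vscale 2^-1 x) (vscale 2^-1 y)) by [].
apply: eq_from_tnth => i; rewrite !tnthE.
by have [j ->|->] := unliftP ord0 i; rewrite ?tnthS ?tnthE// !tnth0.
Qed.

End Prekopa_Leindler.

Section isodiametric.
Context {R : realType} {n : nat}.
Local Open Scope ereal_scope.

Lemma tame_indic (A : set (n.-tuple R)) (B : R) : measurable A ->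
  (forall x i, A x -> `|tnth x i| <= B)%R -> tame (\1_A : n.-tuple R -> R).
Proof.
move=> mA AB; split => //.
exists 1%R, B; split => // x; rewrite mul1r !indicE.
have [xA|] := boolP (x \in A); last by rewrite ler0n.
rewrite mem_set// => i; apply: AB; exact/set_mem.
Qed.

(* Prekopa-Leindler for the indicators of A and - A: half the difference of two
   points of A lies in the ball of radius d / 2. *)
Theorem isodiametric (A : set (n.-tuple R)) (d : R) : measurable A -> A !=set0 ->
  (forall x y, A x -> A y -> eucl_dist x y <= d)%R ->
  leb R n A <= ((d / 2) ^+ n)%:E * leb R n (uball R n).
Proof.
move=> mA [a Aa] Ad.
have d0 : (0 <= d)%R by apply: le_trans (Ad a a Aa Aa); exact: eucl_dist_ge0.
pose z : n.-tuple R := [tuple 0%R | _ < n].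
pose A' := (fun x => vadd z (vscale (-1) x)) @^-1` A.
have N10 : (-1 : R)%R != 0%R by rewrite oppr_eq0 oner_neq0.
have mA' : measurable A'.
  by rewrite -[X in measurable X]setTI; exact: measurable_affine.
have LA' : leb R n A' = leb R n A.
  by rewrite leb_affine// normrN normr1 invr1 expr1n mul1e.
pose D := [set x | (eucl_dist z x <= d / 2)%R].
have mD : measurable D.
  by apply: measurable_ler => //; apply: measurable_eucl_dist;
    [exact: measurable_cst|exact: measurable_id].
have dist0 x : eucl_dist z x = vnorm x.
  rewrite eucl_distE (_ : vsub z x = vscale (-1) x).
    by rewrite vnormZ normrN normr1 mul1r.
  by apply: eq_from_tnth => i; rewrite !tnthE tnth_mktuple; ring.
have bndA x i : A x -> (`|tnth x i| <= vnorm a + d)%R.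
  move=> Ax; apply: (le_trans (ler_tnth_vnorm x i)).
  by rewrite -!dist0 (le_trans (eucl_dist_triangle a _ _))// lerD2l Ad.
have bndA' x i : A' x -> (`|tnth x i| <= vnorm a + d)%R.
  by move=> /(bndA _ i); rewrite !tnthE tnth_mktuple add0r mulN1r normrN.
have bndD x i : D x -> (`|tnth x i| <= d / 2)%R.
  by rewrite /D/= dist0; apply: le_trans; exact: ler_tnth_vnorm.
have := Prekopa_Leindler (tame_indic mA bndA) (tame_indic mA' bndA')
  (tame_indic mD bndD).
have Iind S : measurable S -> \int[leb R n]_x (\1_S x : R)%:E = leb R n S.
  by move=> mS; rewrite integral_indic// setIT.
rewrite (Iind _ mA) (Iind _ mA') (Iind _ mD) LA' leb_ball ?divr_ge0//.
move=> H; have {H} : leb R n A * leb R n A <=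
    (((d / 2) ^+ n)%:E * leb R n (uball R n)) ^+ 2.
  apply: H => x y; rewrite !indicE.
  have [xA|] := boolP (x \in A); last by rewrite mul0r sqr_ge0.
  have [yA|] := boolP (y \in A'); last by rewrite mulr0 sqr_ge0.
  rewrite mul1r mem_set ?expr1n// /D/= dist0.
  rewrite (_ : vadd _ _ = vscale 2^-1 (vsub x (vadd z (vscale (-1) y)))); last first.
    by apply: eq_from_tnth => i; rewrite !tnthE tnth_mktuple; ring.
  rewrite vnormZ gtr0_norm ?invr_gt0// mulrC ler_wpM2r ?invr_ge0//.
  by rewrite -eucl_distE Ad//; exact/set_mem.
have ufin : leb R n (uball R n) \is a fin_num.
  by rewrite ge0_fin_numE// leb_uball_lty.
have Afin : leb R n A \is a fin_num.
  rewrite ge0_fin_numE//; apply: le_lt_trans (leb_cubeB_lty n (vnorm a + d)).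
  apply: le_measure; rewrite ?inE//; first exact: measurable_cubeB.
  by move=> x Ax i; exact: bndA.
rewrite -(fineK Afin) -(fineK ufin) -!EFinM -EFin_expe !lee_fin -expr2.
by rewrite ler_pXn2r// nnegrE ?mulr_ge0 ?exprn_ge0 ?divr_ge0 ?fine_ge0.
Qed.

End isodiametric.

(** * Hausdorff measure of subsets of the sphere *)

Lemma lee_expe (R : realType) (m : nat) (x y : \bar R) :
  (0 <= x -> x <= y -> x ^+ m <= y ^+ m)%E.
Proof.
move=> x0 xy; elim: m => // m IH.
by rewrite !expeS lee_pmul// expe_ge0.
Qed.

Section hausdorff_theory.
Context {R : realType} {N : nat}.
Local Open Scope ereal_scope.
Implicit Types (A B : set (N.-tuple R)) (m : nat) (delta : R).

Lemma diam_ge x y A : A x -> A y -> (eucl_dist x y)%:E <= diam A.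
Proof. by move=> Ax Ay; apply: ereal_sup_ubound; exists (x, y). Qed.

Lemma diam_le A (b : \bar R) :
  (forall x y, A x -> A y -> (eucl_dist x y)%:E <= b) -> diam A <= b.
Proof.
by move=> Ab; apply: ge_ereal_sup => _ [[x y] [/= Ax Ay] <-]; exact: Ab.
Qed.

Lemma diam_ge0 A : A !=set0 -> 0 <= diam A.
Proof.
by move=> [x Ax]; apply: le_trans (diam_ge Ax Ax); rewrite lee_fin eucl_dist_ge0.
Qed.

Lemma diam_set0 : diam (set0 : set (N.-tuple R)) = -oo.
Proof. by apply/eqP; rewrite -leeNy_eq; apply: diam_le. Qed.

Lemma hausdorff_gauge_ge0 m A : 0 <= hausdorff_gauge m A.
Proof.
rewrite /hausdorff_gauge; case: ifPn => // /set0P A0.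
by rewrite mule_ge0// expe_ge0// mule_ge0// diam_ge0.
Qed.

Lemma hausdorff_gauge0 m : hausdorff_gauge m (set0 : set (N.-tuple R)) = 0.
Proof. by rewrite /hausdorff_gauge eqxx. Qed.

Lemma hausdorff_gauge_le m A (b : R) : (0 <= b)%R ->
  (forall x y, A x -> A y -> (eucl_dist x y <= b)%R) ->
  hausdorff_gauge m A <= leb R m (uball R m) * ((b / 2) ^+ m)%:E.
Proof.
move=> b0 Ab; rewrite /hausdorff_gauge; case: ifPn => [_|/set0P A0].
  by rewrite mule_ge0// lee_fin exprn_ge0// divr_ge0.
apply: lee_wpmul2l => //; rewrite EFin_expe EFinM; apply: lee_expe.
- by rewrite mule_ge0// diam_ge0.
- apply: lee_wpmul2r => //; apply: diam_le => x y Ax Ay.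
  by rewrite lee_fin Ab.
Qed.

Lemma hausdorff_pre_ge0 m delta A : 0 <= hausdorff_pre m delta A.
Proof.
apply: le_ereal_inf_tmp => _ [C _ <-]; apply: nneseries_ge0 => k _ _.
exact: hausdorff_gauge_ge0.
Qed.

Lemma le_hausdorff_pre m delta A B : A `<=` B ->
  hausdorff_pre m delta A <= hausdorff_pre m delta B.
Proof.
move=> AB; apply: ereal_inf_le_tmp => _ [C [BC dC] <-].
by exists C => //; split => //; exact: subset_trans BC.
Qed.

Lemma hausdorff_pre_le_gauge m delta A : diam A <= delta%:E ->
  hausdorff_pre m delta A <= hausdorff_gauge m A.
Proof.
move=> dA; apply: ereal_inf_lbound.
exists (fun k => if k == 0%N then A else set0).
  split; first by move=> x Ax; exists 0%N.
  by move=> k; case: ifP => // _; rewrite diam_set0 leNye.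
rewrite (@nneseriesD1 _ _ 0%N)//=; last by move=> k _; exact: hausdorff_gauge_ge0.
by rewrite eseries0 ?adde0// => k _ /negbTE /= ->; rewrite hausdorff_gauge0.
Qed.

Lemma hausdorff_pre_set0 m delta :
  hausdorff_pre m delta (set0 : set (N.-tuple R)) = 0.
Proof.
apply/eqP; rewrite eq_le hausdorff_pre_ge0 andbT.
apply: le_trans (hausdorff_pre_le_gauge _ _) _; first by rewrite diam_set0 leNye.
by rewrite hausdorff_gauge0.
Qed.

Lemma nneseries_pair (a : nat * nat -> \bar R) (f : nat -> nat * nat) :
  (forall i, 0 <= a i) -> bijective f ->
  \sum_(k <oo) a (f k) = \sum_(i <oo) \sum_(j <oo) a (i, j).
Proof.
move=> a0 [g fK gK].
rewrite nneseries_esumT//.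
transitivity (\esum_(k in [set: nat] `*`` (fun=> [set: nat])) a k).
  rewrite -(@reindex_esum R _ _ setT ([set: nat] `*`` (fun=> [set: nat])) f a)//.
  split => //.
  - by move=> i j _ _; apply: (can_inj fK).
  - by move=> z _; exists (g z).
transitivity (\esum_(i in [set: nat]) \esum_(j in [set: nat]) a (i, j)).
  by rewrite (@esum_esum R _ _ _ _ (fun i j => a (i, j)))//; apply: eq_esum => -[].
rewrite [RHS]nneseries_esumT; last by move=> i; exact: nneseries_ge0.
by apply: eq_esum => i _; rewrite nneseries_esumT.
Qed.

Lemma nat_pair_bij : exists f : nat -> nat * nat, bijective f.
Proof.
have /card_esym/ppcard_eqP[f] := card_nat2.
exists f; exists (f^-1)%FUN => x; first by rewrite funK ?inE.
by rewrite invK ?inE.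
Qed.

Lemma hausdorff_pre_sigma_subadditive m delta (A : (set (N.-tuple R))^nat) :
  hausdorff_pre m delta (\bigcup_k A k) <=
  \sum_(k <oo) hausdorff_pre m delta (A k).
Proof.
have [[i ioo]|] := pselect (exists i, hausdorff_pre m delta (A i) = +oo).
  rewrite (eseries_pinfty _ _ ioo) ?leey// => k _.
  by rewrite -ltNye (lt_le_trans _ (hausdorff_pre_ge0 _ _ _)).
rewrite -forallNE => Aoo; apply/lee_addgt0Pr => e e0.
apply: le_trans (epsilon_trick xpredT _ (ltW e0)); last first.
  by move=> k; exact: hausdorff_pre_ge0.
have /choice[G PG] : forall k, exists C : (set (N.-tuple R))^nat,
    [/\ A k `<=` \bigcup_j C j, forall j, diam (C j) <= delta%:E &
    \sum_(j <oo) hausdorff_gauge m (C j) <=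
    hausdorff_pre m delta (A k) + (e / (2 ^ k.+1)%:R)%:E].
  move=> k.
  have Afin : hausdorff_pre m delta (A k) \is a fin_num.
    by rewrite ge0_fin_numE ?hausdorff_pre_ge0// ltey; exact/eqP/Aoo.
  have ek : (0 < e / (2 ^ k.+1)%:R)%R by rewrite divr_gt0// ltr0n expn_gt0.
  have [_ [C [AC dC] <-] lC] := lb_ereal_inf_adherent ek Afin.
  by exists C; split => //; exact: ltW.
have [f bf] := nat_pair_bij; have [g fK gK] := bf.
apply: (@le_trans _ _ (\sum_(k <oo) hausdorff_gauge m (G (f k).1 (f k).2))).
  apply: ereal_inf_lbound; exists (fun k => G (f k).1 (f k).2) => //; split.
    move=> x [i _ Aix]; have [/(_ x Aix)[j _ Gx] _ _] := PG i.
    by exists (g (i, j)) => //; rewrite gK.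
  by move=> k; have [_ + _] := PG (f k).1; exact.
rewrite (@nneseries_pair (fun z => hausdorff_gauge m (G z.1 z.2)))//; last first.
  by move=> z; exact: hausdorff_gauge_ge0.
apply: lee_nneseries => k _ /=.
  by move=> _; apply: nneseries_ge0 => j _ _; exact: hausdorff_gauge_ge0.
by have [_ _] := PG k.
Qed.

Lemma hausdorff_pre_le_hausdorff m delta A : (0 < delta)%R ->
  hausdorff_pre m delta A <= hausdorff m A.
Proof. by move=> d0; apply: ereal_sup_ubound; exists delta. Qed.

End hausdorff_theory.

Section hausdorff_lipschitz.
Context {R : realType} {N M : nat}.
Local Open Scope ereal_scope.

Lemma hausdorff_pre_image m delta (f : N.-tuple R -> M.-tuple R)
    (A : set (N.-tuple R)) :
  (forall x y, eucl_dist (f x) (f y) <= eucl_dist x y)%R ->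
  hausdorff_pre m delta (f @` A) <= hausdorff_pre m delta A.
Proof.
move=> f1; have diamf C : diam (f @` C) <= diam C.
  apply: diam_le => _ _ [x Cx <-] [y Cy <-]; apply: le_trans (diam_ge Cx Cy).
  by rewrite lee_fin.
apply: le_ereal_inf_tmp => _ [C [AC dC] <-].
apply: (@le_trans _ _ (\sum_(k <oo) hausdorff_gauge m (f @` C k))).
  apply: ereal_inf_lbound; exists (fun k => f @` C k) => //; split.
    by move=> _ [x /AC[k _ Cx] <-]; exists k => //; exists x.
  by move=> k; exact: le_trans (diamf _) (dC k).
apply: lee_nneseries => k _; first by move=> _; exact: hausdorff_gauge_ge0.
rewrite /hausdorff_gauge; case: ifPn => [_|/set0P [_ [x Cx _]]].
  exact: hausdorff_gauge_ge0.
rewrite ifN; last by apply/set0P; exists x.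
apply: lee_wpmul2l => //; apply: lee_expe.
  by rewrite mule_ge0// diam_ge0//; exists (f x), x.
by apply: lee_wpmul2r.
Qed.

End hausdorff_lipschitz.

(** * Dyadic cubes and the sets they generate *)

Section dyadic.
Context {R : realType} {n : nat}.
Local Open Scope ereal_scope.
Implicit Types (x y : n.-tuple R) (k : nat) (U V E : set (n.-tuple R))
  (v : n.-tuple int).

Definition dyadic_index k x : n.-tuple int :=
  [tuple Num.floor (2 ^+ k * tnth x i)%R | i < n].

Definition dyadic_cube k v : set (n.-tuple R) := [set x | dyadic_index k x = v].

Definition dyadic_saturated k E :=
  forall x, E x -> dyadic_cube k (dyadic_index k x) `<=` E.

(** The largest union of cubes of generation k contained in U. *)
Definition dyadic_core k U : set (n.-tuple R) :=
  [set x | dyadic_cube k (dyadic_index k x) `<=` U].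

(** The unions of dyadic cubes. Euclidean open sets and the half-open cubes themselves are both of
    this kind, and each such set is a countable disjoint union of cubes, which spares a covering
    theorem. *)
Definition dyadic_open U := forall x, U x -> exists k, dyadic_core k U x.

Lemma dyadic_cubeE k v : dyadic_cube k v =
  (fun x => vadd [tuple (- (tnth v i)%:~R)%R | i < n] (vscale (2 ^+ k) x)) @^-1`
    [set x | forall i, [set r : measurableTypeR R | (0 <= r < 1)%R] (tnth x i)].
Proof.
apply/seteqP; split => x.
  move=> /= kx i; rewrite !tnthE tnth_mktuple -kx tnth_mktuple.
  by have /andP[] := floor_itv (2 ^+ k * tnth x i)%R; rewrite intrD1; lra.
move=> /= kx; apply: eq_from_tnth => i; rewrite tnth_mktuple; apply: floor_def.
by have := kx i; rewrite !tnthE tnth_mktuple intrD1; lra.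
Qed.

Let I01E : [set r : measurableTypeR R | (0 <= r < 1)%R] = `[0%R, 1%R[%classic.
Proof. by apply/seteqP; split => r; rewrite /= in_itv. Qed.

Let mI01 : measurable [set r : measurableTypeR R | (0 <= r < 1)%R].
Proof. by rewrite I01E; exact: measurable_itv. Qed.

Lemma measurable_dyadic_cube k v : measurable (dyadic_cube k v).
Proof.
rewrite dyadic_cubeE -[X in measurable X]setTI; apply: measurable_affine => //.
exact: measurable_cube.
Qed.

Lemma leb_dyadic_cube k v : leb R n (dyadic_cube k v) = ((2 ^- k) ^+ n)%:E.
Proof.
have k0 : (2 ^+ k : R)%R != 0%R by rewrite expf_neq0// pnatr_eq0.
rewrite dyadic_cubeE leb_affine//; last exact: measurable_cube.
rewrite leb_cube// I01E lebesgue_measure_itv/= lte_fin ltr01 sube0.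
by rewrite -EFin_expe expr1n mule1 ger0_norm// exprn_ge0.
Qed.

Lemma dyadic_cube_dist k v x y : dyadic_cube k v x -> dyadic_cube k v y ->
  (eucl_dist x y <= Num.sqrt n%:R * 2 ^- k)%R.
Proof.
have k0 : (0 < 2 ^+ k :> R)%R by rewrite exprn_gt0.
rewrite dyadic_cubeE /= => kx ky; rewrite eucl_distE; apply: vnorm_le_sup.
  by rewrite invr_ge0 ltW.
move=> i; move: (kx i) (ky i); rewrite !tnthE tnth_mktuple.
move=> xi yi; rewrite -[leRHS]mul1r ler_pdivlMr// -[X in (_ * X)%R]gtr0_norm// -normrM.
by rewrite mulrBl ler_norml ![(_ * 2 ^+ k)%R]mulrC; lra.
Qed.

(** The floor of 2u determines that of u, since it is twice the latter or one more; the cubes of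
    successive generations are therefore nested. *)
Lemma dyadic_index_succ k x y : dyadic_index k.+1 x = dyadic_index k.+1 y ->
  dyadic_index k x = dyadic_index k y.
Proof.
move=> xy; apply: eq_from_tnth => i; rewrite !tnth_mktuple.
move: (congr1 (fun t => tnth t i) xy); rewrite !tnth_mktuple exprS -!mulrA.
move: (2 ^+ k * tnth x i)%R (2 ^+ k * tnth y i)%R => u w uw.
apply/esym/floor_def.
have /andP[ul uu] := floor_itv u; have /andP[wl wu] := floor_itv (2 * w)%R.
have h1 : (2 * Num.floor u <= Num.floor (2 * w))%R.
  by rewrite -uw floor_ge_int intrM; lra.
have h2 : (Num.floor (2 * w) + 1 <= 2 * (Num.floor u + 1))%R.
  by rewrite -uw lezD1 -(ltr_int R) !(intrM, intrD); have := floor_le (2 * u)%R; move: uu; rewrite intrD1; lra.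
have := h1; rewrite -(ler_int R) intrM => h1'.
have := h2; rewrite -(ler_int R) intrM => h2'.
by lra.
Qed.

Lemma dyadic_index_le k j x y : (k <= j)%N ->
  dyadic_index j x = dyadic_index j y -> dyadic_index k x = dyadic_index k y.
Proof.
move=> /subnKC <-; elim: (j - k)%N => [|m IH]; first by rewrite addn0.
by rewrite addnS => /dyadic_index_succ.
Qed.

Lemma dyadic_core_sub k U : dyadic_core k U `<=` U.
Proof. by move=> x; apply. Qed.

Lemma dyadic_core_saturated k U : dyadic_saturated k (dyadic_core k U).
Proof. by move=> x Ux y /= yx; rewrite /dyadic_core /= yx. Qed.

Lemma dyadic_core_le k j U : (k <= j)%N -> dyadic_core k U `<=` dyadic_core j U.
Proof. by move=> kj x Ux y /(dyadic_index_le kj) /Ux. Qed.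

Lemma dyadic_saturated_le k j E : (k <= j)%N ->
  dyadic_saturated k E -> dyadic_saturated j E.
Proof. by move=> kj sE x Ex y /(dyadic_index_le kj) /(sE _ Ex). Qed.

Lemma dyadic_saturated_open k E : dyadic_saturated k E -> dyadic_open E.
Proof. by move=> sE x Ex; exists k; exact: sE. Qed.

Lemma dyadic_saturatedC k E : dyadic_saturated k E -> dyadic_saturated k (~` E).
Proof.
by move=> sE x nEx y yx Ey; apply: nEx; apply: (sE _ Ey); rewrite /dyadic_cube/= yx.
Qed.

Lemma dyadic_saturatedD k E U : dyadic_saturated k E -> dyadic_saturated k U ->
  dyadic_saturated k (E `\` U).
Proof.
move=> sE sU x [Ex nUx] y yx; split; first exact: (sE x).
exact: (dyadic_saturatedC sU nUx).
Qed.

Lemma dyadic_openE U k : dyadic_open U ->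
  U = \bigcup_j dyadic_core (k + j) U.
Proof.
move=> oU; apply/seteqP; split => [x Ux|x [j _ /dyadic_core_sub]//].
have [j Uj] := oU x Ux; exists j => //.
by apply: dyadic_core_le Uj; rewrite leq_addl.
Qed.

Lemma dyadic_open_bigcup (U : nat -> set (n.-tuple R)) :
  (forall i, dyadic_open (U i)) -> dyadic_open (\bigcup_i U i).
Proof.
move=> oU x [i _ Uix]; have [k Uk] := oU i x Uix.
by exists k => y /Uk; exists i.
Qed.

Lemma dyadic_openI U V : dyadic_open U -> dyadic_open V -> dyadic_open (U `&` V).
Proof.
move=> oU oV x [/oU[k Uk] /oV[j Vj]]; exists (maxn k j) => y xy; split.
  by apply: (dyadic_core_le (leq_maxl k j) Uk).
by apply: (dyadic_core_le (leq_maxr k j) Vj).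
Qed.

Lemma dyadic_openT : dyadic_open setT.
Proof. by move=> x _; exists 0%N. Qed.

Lemma dyadic_open0 : dyadic_open set0.
Proof. by []. Qed.

(** The cubes of generation k inside E, enumerated by the codes of their integer indices. Numbers
    that encode no cube of E give the empty set, and distinct numbers give disjoint sets. *)
Definition dyadic_piece k E (m : nat) : set (n.-tuple R) :=
  if pickle_inv m is Some v then
    if `[< dyadic_cube k v `<=` E >] then dyadic_cube k v else set0
  else set0.

Lemma measurable_dyadic_piece k E m : measurable (dyadic_piece k E m).
Proof.
rewrite /dyadic_piece; case: pickle_inv => // v; case: ifP => // _.
exact: measurable_dyadic_cube.
Qed.

Lemma bigcup_dyadic_piece k E : dyadic_saturated k E ->
  E = \bigcup_m dyadic_piece k E m.
Proof.
move=> sE; apply/seteqP; split => [x Ex|x [m _]].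
  exists (pickle (dyadic_index k x)) => //; rewrite /dyadic_piece pickleK_inv.
  by rewrite asboolT//; exact: sE.
by rewrite /dyadic_piece; case: pickle_inv => // v; case: asboolP => // + xv; apply.
Qed.

Lemma trivIset_dyadic_piece k E : trivIset setT (dyadic_piece k E).
Proof.
apply/trivIsetP => i j _ _ ij; apply/seteqP; split => // x [].
rewrite /dyadic_piece.
have := @pickle_invK (n.-tuple int) i; have := @pickle_invK (n.-tuple int) j.
case: pickle_inv => [w|]//= wj; case: pickle_inv => [v|]//= vi.
case: ifP => // _ /= xv; case: ifP => // _ /= xw.
by move: ij; rewrite -vi -wj -xv -xw eqxx.
Qed.

Lemma dyadic_saturated_measurable k E : dyadic_saturated k E -> measurable E.
Proof.
move=> /bigcup_dyadic_piece ->; apply: bigcupT_measurable => m.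
exact: measurable_dyadic_piece.
Qed.

Lemma dyadic_open_measurable U : dyadic_open U -> measurable U.
Proof.
move=> /(dyadic_openE 0) ->; apply: bigcupT_measurable => j.
exact: dyadic_saturated_measurable (@dyadic_core_saturated _ _).
Qed.

End dyadic.

Lemma nonincreasing_measure_le d (T : measurableType d) (R : realType)
    (mu : {measure set T -> \bar R}) (F : (set T)^nat) (e : \bar R) :
  (mu (F 0%N) < +oo)%E -> (forall i, measurable (F i)) ->
  nonincreasing_seq F -> (mu (\bigcap_i F i) < e)%E ->
  exists i, (mu (F i) <= e)%E.
Proof.
move=> F0 mF niF Fe; apply: contrapT => /forallNP nFe.
have mI : measurable (\bigcap_i F i) by exact: bigcapT_measurable.
have cF := nonincreasing_cvg_mu F0 mF mI niF.
have : (e <= limn (mu \o F))%E.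
  apply: lime_ge; first by apply/cvg_ex; exists (mu (\bigcap_i F i)).
  by apply: nearW => i /=; rewrite ltW// ltNge; apply/negP/nFe.
by rewrite (cvg_lim _ cF)// leNgt Fe.
Qed.

Lemma half_power_small (R : realType) (c r : R) : 0 < r ->
  exists k : nat, c * 2 ^- k < r.
Proof.
move=> r0; have [c0|c0] := leP c 0.
  by exists 0%N; rewrite expr0 invr1 mulr1 (le_lt_trans c0).
have cr0 : 0 <= c / r by rewrite divr_ge0// ltW.
exists (Num.bound (c / r)); rewrite ltr_pdivrMr ?exprn_gt0// mulrC -ltr_pdivrMr//.
rewrite (lt_trans (archi_boundP cr0))// -natrX ltr_nat.
exact: ltn_expl.
Qed.

(** * Outer regularity by dyadic open sets *)

Section regularity.
Context {R : realType} {n : nat}.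
Local Open Scope ereal_scope.
Implicit Types (U V E : set (n.-tuple R)).

Lemma dyadic_open_metric U :
  (forall x, U x -> exists2 r : R, (0 < r)%R &
    forall y, (eucl_dist x y < r)%R -> U y) -> dyadic_open U.
Proof.
move=> oU x Ux; have [r r0 Ur] := oU x Ux.
have [k kr] := half_power_small (Num.sqrt n%:R) r0.
exists k => y xy; apply: Ur; apply: le_lt_trans kr.
exact: (@dyadic_cube_dist _ _ k (dyadic_index k x)).
Qed.

Variable v : n.-tuple int.
Let Q := dyadic_cube 0 v : set (n.-tuple R).
Let mQ : measurable Q. Proof. exact: measurable_dyadic_cube. Qed.

Let Qfin E : measurable E -> leb R n (E `&` Q) < +oo.
Proof.
move=> mE; apply: (@le_lt_trans _ _ (leb R n Q)).
  by apply: le_measure; rewrite ?inE//; exact: measurableI.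
by rewrite leb_dyadic_cube ltry.
Qed.

(** Enclosing both E and its complement makes the condition symmetric, hence stable under
    complements. The overlap is measured inside one unit cube so that continuity from above
    applies. *)
Let approx E := forall e : R, (0 < e)%R -> exists U V,
  [/\ dyadic_open U, dyadic_open V, E `<=` U, ~` E `<=` V &
      leb R n (U `&` V `&` Q) <= e%:E].

(** The complement of a core of U is again a union of cubes, and the cores increase to U, so the
    overlaps decrease to the empty set. *)
Let approx_open U : dyadic_open U -> approx U.
Proof.
move=> oU e e0; pose F k := U `&` ~` dyadic_core k U `&` Q.
have oC k : dyadic_open (~` dyadic_core k U).
  exact: dyadic_saturated_open (dyadic_saturatedC (@dyadic_core_saturated _ _ k U)).
have mF k : measurable (F k).
  by apply: measurableI => //; apply: dyadic_open_measurable; exact: dyadic_openI.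
have [||||k Fk] := @nonincreasing_measure_le _ _ _ (leb R n) F e%:E.
- by apply: Qfin; apply: dyadic_open_measurable; exact: dyadic_openI.
- exact: mF.
- apply/nonincreasing_seqP => k; apply/subsetPset => x [[Ux nUx] Qx].
  by split => //; split => //; apply: contra_not nUx; exact: dyadic_core_le.
- rewrite (_ : \bigcap_i F i = set0) ?measure0 ?lte_fin//.
  apply/seteqP; split => // x Fx.
  have [[Ux _] _] := Fx 0%N I; have [k Uk] := oU x Ux.
  by have [[_]] := Fx k I.
exists U, (~` dyadic_core k U); split => //.
by apply: subsetC; exact: dyadic_core_sub.
Qed.

Let approxC E : approx E -> approx (~` E).
Proof.
move=> aE e /aE[U [V [oU oV EU EV UV]]]; exists V, U; split => //.
  by rewrite setCK.
by rewrite (setIC V).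
Qed.

Let approx_bigcup (E : nat -> set (n.-tuple R)) :
  (forall i, approx (E i)) -> approx (\bigcup_i E i).
Proof.
move=> aE e e0; pose e2 := (e / 2)%R.
have e20 : (0 < e2)%R by rewrite divr_gt0.
have /choice[UV HUV] : forall i, exists UV : set (n.-tuple R) * set (n.-tuple R),
    [/\ dyadic_open UV.1, dyadic_open UV.2, E i `<=` UV.1, ~` E i `<=` UV.2 &
      leb R n (UV.1 `&` UV.2 `&` Q) <= (e2 / (2 ^ i.+1)%:R)%:E].
  move=> i; have ei : (0 < e2 / (2 ^ i.+1)%:R)%R.
    by rewrite divr_gt0// ltr0n expn_gt0.
  by have [U [V [? ? ? ? ?]]] := aE i _ ei; exists (U, V).
pose U := \bigcup_i (UV i).1.
have oU : dyadic_open U by apply: dyadic_open_bigcup => i; have [] := HUV i.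
(* The complement of the union lies in every second enclosing set, but an infinite intersection of
   dyadic open sets need not be dyadic open. Only finitely many are kept; the overlap with the full
   intersection is at most e / 2 by summation, and continuity from above provides m. *)
pose W m := \bigcap_(i < m) (UV i).2.
have oW m : dyadic_open (W m).
  rewrite /W bigcap_mkord; elim: m => [|m IH].
    by rewrite big_ord0; exact: dyadic_openT.
  by rewrite big_ord_recr/=; apply: dyadic_openI => //; have [] := HUV m.
pose F m := U `&` W m `&` Q.
have mF m : measurable (F m).
  by apply: measurableI => //; apply: dyadic_open_measurable; exact: dyadic_openI.
have [||||m Fm] := @nonincreasing_measure_le _ _ _ (leb R n) F e%:E.
- by apply: Qfin; apply: dyadic_open_measurable; exact: dyadic_openI.
- exact: mF.
- apply/nonincreasing_seqP => k; apply/subsetPset => x [[Ux Wx] Qx].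
  by split => //; split => // i /= ik; apply: Wx => /=; exact: ltnW.
- apply: (@le_lt_trans _ _ (\sum_(i <oo) leb R n ((UV i).1 `&` (UV i).2 `&` Q))).
    have mUV i : measurable ((UV i).1 `&` (UV i).2 `&` Q).
      apply: measurableI => //; have [? ? _ _ _] := HUV i.
      by apply: dyadic_open_measurable; exact: dyadic_openI.
    have mUUV := bigcupT_measurable _ mUV.
    apply: (le_trans _ (generalized_Boole_inequality _ mUV mUUV)).
    apply: le_measure; rewrite ?inE//; first exact: bigcapT_measurable.
    move=> x Fx; have [[[i _ Ux] _] Qx] := Fx 0%N I.
    exists i => //; split => //; split => //.
    by have [[_ +] _] := Fx i.+1 I; apply => /=.
  apply: (@le_lt_trans _ _ e2%:E); last by rewrite lte_fin /e2; lra.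
  apply: le_trans (epsilon_trick0 xpredT (ltW e20)).
  by apply: lee_nneseries => // i _; have [] := HUV i.
exists U, (W m); split => //.
  by move=> x [i _ Eix]; exists i => //; have [_ _ + _ _] := HUV i; apply.
move=> x nEx i _; have [_ _ _ + _] := HUV i; apply.
by apply: contra_not nEx => ?; exists i.
Qed.

Let approx_sigma_algebra : sigma_algebra setT approx.
Proof.
split.
- exact/approx_open/dyadic_open0.
- by move=> A aA; rewrite setTD; exact: approxC.
- by move=> A aA; exact: approx_bigcup.
Qed.

Let measurable_approx E : measurable E -> approx E.
Proof.
move: E; apply: smallest_sub; first exact: approx_sigma_algebra.
rewrite -bigcup_seq => _ [i _ [B mB <-]]; rewrite setTI.
suff : measurable `<=` [set C : set (measurableTypeR R) | approx ((fun x => tnth x i) @^-1` C)].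
  by apply.
rewrite RGenOInfty.measurableE; apply: smallest_sub.
  split => /=.
  - by rewrite preimage_set0; exact/approx_open/dyadic_open0.
  - by move=> A aA; rewrite setTD preimage_setC; exact: approxC.
  - by move=> A aA; rewrite preimage_bigcup; exact: approx_bigcup.
move=> _ [a ->] /=; apply: approx_open; apply: dyadic_open_metric => x /=.
rewrite in_itv/= andbT => ax; exists (tnth x i - a)%R; first by rewrite subr_gt0.
move=> y; rewrite in_itv/= andbT eucl_distE => xy.
have := le_lt_trans (ler_tnth_vnorm (vsub x y) i) xy.
by rewrite tnthE ltr_norml; lra.
Qed.

Lemma outer_regularity E (e : R) : measurable E -> E `<=` Q -> (0 < e)%R ->
  exists U, [/\ dyadic_open U, E `<=` U & leb R n U <= leb R n E + e%:E].
Proof.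
move=> mE EQ e0; have [U [V [oU oV EU EV UV]]] := measurable_approx mE e0.
exists (U `&` Q); split.
- apply: dyadic_openI => //; apply: (@dyadic_saturated_open _ _ 0%N).
  by move=> x Qx y; rewrite /Q /dyadic_cube/= => ->.
- by move=> x Ex; split; [exact: EU|exact: EQ].
have mUVQ : measurable (U `&` V `&` Q).
  by apply: measurableI => //; apply: dyadic_open_measurable; exact: dyadic_openI.
apply: (@le_trans _ _ (leb R n E + leb R n (U `&` V `&` Q))); last exact: leeD2l.
apply: le_trans (measureU2 _ _ _) => //.
apply: le_measure; rewrite ?inE.
- by apply: measurableI => //; exact: dyadic_open_measurable.
- exact: measurableU.
move=> x [Ux Qx]; have [Ex|nEx] := pselect (E x); first by left.
by right; split => //; split => //; exact: EV.
Qed.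

End regularity.

Lemma measure_bigcupT d (T : measurableType d) (R : realType)
    (mu : {measure set T -> \bar R}) (F : (set T)^nat) :
  (forall i, measurable (F i)) -> trivIset setT F ->
  (mu (\bigcup_i F i) = \sum_(i <oo) mu (F i))%E.
Proof.
move=> mF tF; rewrite measure_bigcup//.
by apply: eq_eseriesl => i; rewrite in_setT.
Qed.

(** * Hausdorff premeasure against Lebesgue measure in R^n *)

Section hausdorff_flat.
Context {R : realType} {n : nat}.
Variable delta : R.
Hypothesis delta0 : 0 < delta.
Local Open Scope ereal_scope.
Local Notation H := (@hausdorff_pre R n n delta).
Implicit Types (U E : set (n.-tuple R)) (v : n.-tuple int).

Let k0 : {k : nat | (Num.sqrt n%:R * 2 ^- k < delta)%R} :=
  cid (half_power_small (Num.sqrt n%:R) delta0).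

(** From generation [sval k0] on, cubes have diameter at most delta and may themselves serve in
    coverings. *)
Let ratio_le (c : R) := forall (k : nat) v, (sval k0 <= k)%N ->
  H (dyadic_cube k v) <= c%:E * leb R n (dyadic_cube k v).

Let small_cube k v x y : (sval k0 <= k)%N ->
  dyadic_cube k v x -> dyadic_cube k v y -> (eucl_dist x y <= delta)%R.
Proof.
move=> kk xk yk; apply: le_trans (dyadic_cube_dist xk yk) _.
apply: le_trans (ltW (svalP k0)); apply: ler_wpM2l; first exact: sqrtr_ge0.
rewrite lef_pV2 ?posrE ?exprn_gt0//; apply: ler_weXn2l => //.
by rewrite ler1n.
Qed.

Let ratio_saturated c k E : ratio_le c -> (0 <= c)%R -> (sval k0 <= k)%N ->
  dyadic_saturated k E -> H E <= c%:E * leb R n E.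
Proof.
move=> Pc c0 kk sE; rewrite [in leLHS](bigcup_dyadic_piece sE).
apply: le_trans (hausdorff_pre_sigma_subadditive _ _ _) _.
rewrite [in leRHS](bigcup_dyadic_piece sE) measure_bigcupT; last 2 first.
- by move=> m; exact: measurable_dyadic_piece.
- exact: trivIset_dyadic_piece.
rewrite -nneseriesZl//; apply: lee_nneseries => m _.
  by move=> _; exact: hausdorff_pre_ge0.
rewrite /dyadic_piece; case: pickle_inv => [v|]; last first.
  by rewrite hausdorff_pre_set0 mule_ge0// lee_fin.
case: ifP => _; first exact: Pc.
by rewrite hausdorff_pre_set0 mule_ge0// lee_fin.
Qed.

Let ratio_open c U : ratio_le c -> (0 <= c)%R -> dyadic_open U ->
  H U <= c%:E * leb R n U.
Proof.
move=> Pc c0 oU; pose F j := dyadic_core (sval k0 + j) U.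
have ndF : nondecreasing_seq F.
  by move=> i j ij; apply/subsetPset; apply: dyadic_core_le; rewrite leq_add2l.
have sF j : dyadic_saturated (sval k0 + j) (seqD F j).
  case: j => [|j]; first by rewrite /seqD; exact: dyadic_core_saturated.
  apply: dyadic_saturatedD; first exact: dyadic_core_saturated.
  apply: dyadic_saturated_le (@dyadic_core_saturated _ _ (sval k0 + j) U).
  by rewrite leq_add2l.
rewrite (dyadic_openE (sval k0) oU) -/F -eq_bigcup_seqD.
apply: le_trans (hausdorff_pre_sigma_subadditive _ _ _) _.
rewrite measure_bigcupT; last 2 first.
- by move=> j; exact: dyadic_saturated_measurable (sF j).
- exact: trivIset_seqD.
rewrite -nneseriesZl//; apply: lee_nneseries => j _.
  by move=> _; exact: hausdorff_pre_ge0.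
by apply: ratio_saturated (sF j) => //; rewrite leq_addr.
Qed.

Let omega := fine (leb R n (uball R n)).

Let omegaE : leb R n (uball R n) = omega%:E.
Proof. by rewrite fineK// ge0_fin_numE// leb_uball_lty. Qed.

Let omega0 : (0 < omega)%R.
Proof. by rewrite -lte_fin -omegaE leb_uball_gt0. Qed.

(** The cube covers itself; this crude constant starts the improvement. *)
Let ratio_bound : ratio_le (omega * (Num.sqrt n%:R / 2) ^+ n).
Proof.
move=> k v kk.
have s0 : (0 <= Num.sqrt n%:R * 2 ^- k :> R)%R.
  by rewrite mulr_ge0 ?sqrtr_ge0// invr_ge0 exprn_ge0.
apply: (@le_trans _ _ (hausdorff_gauge n (dyadic_cube k v))).
  apply: hausdorff_pre_le_gauge; apply: diam_le => x y xk yk.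
  by rewrite lee_fin (small_cube kk xk yk).
apply: le_trans (hausdorff_gauge_le n s0 _) _.
  by move=> x y; exact: dyadic_cube_dist.
rewrite omegaE leb_dyadic_cube -!EFinM lee_fin.
by rewrite (mulrAC _ (2 ^- k)%R) exprMn mulrA.
Qed.

Let theta := (omega * (4^-1) ^+ n)%R.

(* The ball inscribed in a dyadic cube occupies the fraction theta of it, and its
   gauge is exactly its volume; the rest of the cube is a dyadic open set. *)
Let ratio_step c : ratio_le c -> (0 <= c)%R -> ratio_le (theta + c * (1 - theta)).
Proof.
move=> Pc c0 k v kk.
pose a : n.-tuple R := [tuple ((tnth v i)%:~R + 2^-1) * 2 ^- k | i < n]%R.
(* A quarter of the side and not half of it: the closed ball then stays inside the half-open cube.
   This is the origin of 4^-1 in [theta]. *)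
pose r : R := (4^-1 * 2 ^- k)%R.
have k2 : (0 < 2 ^+ k :> R)%R by rewrite exprn_gt0.
have r0 : (0 <= r)%R by rewrite mulr_ge0// invr_ge0// ltW.
pose B := [set x | (eucl_dist a x <= r)%R].
have mB : measurable B.
  by apply: measurable_ler => //; apply: measurable_eucl_dist.
have BQ : B `<=` dyadic_cube k v.
  move=> x Bx; rewrite dyadic_cubeE /= => i; rewrite !tnthE tnth_mktuple.
  move: Bx; rewrite /B /= eucl_distE => Bx.
  have := le_trans (ler_tnth_vnorm (vsub a x) i) Bx.
  rewrite tnthE tnth_mktuple /r ler_norml => /andP[h1 h2].
  have {}h1 : (- 4^-1 <= (tnth v i)%:~R + 2^-1 - 2 ^+ k * tnth x i)%R.
    rewrite -(ler_pM2r (_ : 0 < 2 ^- k)%R) ?invr_gt0// mulNr; apply: (le_trans h1).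
    by rewrite le_eqVlt; apply/orP; left; apply/eqP; field; rewrite gt_eqF.
  have {}h2 : ((tnth v i)%:~R + 2^-1 - 2 ^+ k * tnth x i <= 4^-1)%R.
    rewrite -(ler_pM2r (_ : 0 < 2 ^- k)%R) ?invr_gt0//; apply: (le_trans _ h2).
    by rewrite le_eqVlt; apply/orP; left; apply/eqP; field; rewrite gt_eqF.
  by lra.
have lB : leb R n B = theta%:E * leb R n (dyadic_cube k v).
  by rewrite leb_ball// leb_dyadic_cube omegaE -!EFinM /theta -mulrA -exprMn mulrC.
have HB : H B <= leb R n B.
  apply: (@le_trans _ _ (hausdorff_gauge n B)).
    apply: hausdorff_pre_le_gauge; apply: diam_le => x y xk yk.
    by rewrite lee_fin (small_cube kk (BQ _ xk) (BQ _ yk)).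
  rewrite leb_ball// muleC.
  have -> : r = ((2 * r) / 2)%R by field.
  apply: hausdorff_gauge_le; first by rewrite mulr_ge0.
  move=> x y Bx By; rewrite mulr_natl mulr2n.
  apply: le_trans (eucl_dist_triangle a _ _) _.
  by rewrite lerD// eucl_distC.
have sQ : dyadic_saturated k (dyadic_cube k v : set (n.-tuple R)).
  by move=> x Qx y; rewrite /dyadic_cube/= => ->.
have oQB : dyadic_open (dyadic_cube k v `\` B).
  apply: dyadic_openI; first exact: dyadic_saturated_open sQ.
  apply: dyadic_open_metric => x /negP; rewrite -ltNge => xr.
  exists (eucl_dist a x - r)%R; first by rewrite subr_gt0.
  move=> y xy ay; have := eucl_dist_triangle y a x.
  rewrite (eucl_distC y x) => h; move: xy ay h; rewrite /B /=; lra.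
have mQ := measurable_dyadic_cube k v : measurable (dyadic_cube k v : set (n.-tuple R)).
have lQB : leb R n (dyadic_cube k v `\` B) =
    (1 - theta)%:E * leb R n (dyadic_cube k v).
  have -> : leb R n (dyadic_cube k v `\` B) =
      leb R n (dyadic_cube k v) - leb R n B.
    by rewrite measureD ?setIidr//=; rewrite leb_dyadic_cube ltry.
  rewrite lB leb_dyadic_cube -!EFinM -EFinD.
  by congr EFin; ring.
have -> : H (dyadic_cube k v) = H (B `|` (dyadic_cube k v `\` B)).
  by rewrite setDUK.
rewrite (_ : B `|` _ = \bigcup_i
   (if i == 0%N then B else if i == 1%N then dyadic_cube k v `\` B else set0)).
  apply: le_trans (hausdorff_pre_sigma_subadditive _ _ _) _.
  rewrite (@nneseries_split _ _ 0%N 2%N); last first.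
    by move=> i _; exact: hausdorff_pre_ge0.
  rewrite eseries0 ?adde0; last first.
    by move=> [|[|i]] //= _ _; exact: hausdorff_pre_set0.
  rewrite add0n big_nat_recr//= big_nat1/=.
  rewrite EFinD (EFinM c) muleDl ?fin_num_adde_defl//; last first.
    by rewrite leb_dyadic_cube.
  apply: leeD; first by rewrite -lB.
  by rewrite -muleA -lQB; exact: ratio_open.
apply/seteqP; split => [x [Bx|Qx]|x [[|[|i]] _]//=].
- by exists 0%N.
- by exists 1%N.
- by left.
- by right.
Qed.

Let theta_gt0 : (0 < theta)%R.
Proof. by rewrite mulr_gt0// exprn_gt0// invr_gt0. Qed.

(** The infimum c of the admissible constants is itself admissible, because a cube has volume at
    most 1. If c > 1, then theta + c (1 - theta) < c is admissible as well, against the choice of c.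
    Iterating the removal of balls is thus replaced by one application to the best constant. *)
Let ratio_le1 : ratio_le 1.
Proof.
pose S := [set c : R | (0 <= c)%R /\ ratio_le c].
have S0 : S (omega * (Num.sqrt n%:R / 2) ^+ n)%R.
  split; last exact: ratio_bound.
  apply: mulr_ge0; first exact: ltW.
  by rewrite exprn_ge0// divr_ge0// sqrtr_ge0.
have Slb : has_lbound S by exists 0%R => x [].
have iS : has_inf S by split => //; exists (omega * (Num.sqrt n%:R / 2) ^+ n)%R.
pose c := inf S.
have c0 : (0 <= c)%R by apply: lb_le_inf => //; [exact: iS.1|move=> x []].
have Pc : ratio_le c.
  move=> k v kk; apply/lee_addgt0Pr => e e0.
  have [c' [c'0 Pc'] cc'] := inf_adherent e0 iS.
  apply: le_trans (Pc' k v kk) _; rewrite leb_dyadic_cube -!EFinM -EFinD lee_fin.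
  have q1 : ((2 ^- k) ^+ n <= 1 :> R)%R.
    by rewrite exprn_ile1 ?invr_ge0 ?exprn_ge0// invf_le1 ?exprn_gt0// exprn_ege1// ler1n.
  have q0 : (0 <= (2 ^- k) ^+ n :> R)%R by rewrite exprn_ge0// invr_ge0 exprn_ge0.
  apply: (@le_trans _ _ ((c + e) * (2 ^- k) ^+ n)%R).
    by rewrite ler_wpM2r// ltW.
  by rewrite mulrDl lerD2l ler_piMr// ltW.
have [c1|c1] := leP c 1%R.
  by move=> k v kk; apply: le_trans (Pc k v kk) _; rewrite lee_wpmul2r// lee_fin.
have Pstep := ratio_step Pc c0.
have sc : (theta + c * (1 - theta) < c)%R.
  rewrite -subr_gt0 (_ : _ - _ = theta * (c - 1))%R; last by ring.
  by rewrite mulr_gt0// subr_gt0.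
(* [S] contains only nonnegative constants. A negative admissible constant is below 1, so the claim
   then holds at once. *)
have [s0|s0] := leP 0%R (theta + c * (1 - theta))%R.
  have : (c <= theta + c * (1 - theta))%R by apply: ge_inf => //; split.
  by rewrite leNgt sc.
move=> k v kk; apply: le_trans (Pstep k v kk) _.
by rewrite lee_wpmul2r// lee_fin ltW// (lt_trans s0).
Qed.

(** E is cut along unit cubes, where outer regularity is available. The inequality is exact on each
    piece, with its own arbitrary e, so that no errors have to be summed. *)
Lemma hausdorff_pre_le_leb E : measurable E -> H E <= leb R n E.
Proof.
move=> mE.
have sT : dyadic_saturated 0 [set: n.-tuple R] by [].
pose A i := E `&` dyadic_piece 0 setT i.
have EA : E = \bigcup_i A i.
  by rewrite /A -setI_bigcupr -(bigcup_dyadic_piece sT) setIT.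
have mA i : measurable (A i).
  by apply: measurableI => //; exact: measurable_dyadic_piece.
rewrite {1}EA; apply: le_trans (hausdorff_pre_sigma_subadditive _ _ _) _.
rewrite EA measure_bigcupT//; last first.
  apply: trivIset_setIl; exact: trivIset_dyadic_piece.
apply: lee_nneseries => i _.
  by move=> _; exact: hausdorff_pre_ge0.
have [v Av] : exists v, A i `<=` dyadic_cube 0 v.
  rewrite /A /dyadic_piece; case: pickle_inv => [v|].
    by exists v; case: ifP => _ x [].
  by exists [tuple 0%R | _ < n] => x [].
apply/lee_addgt0Pr => e e0.
have [U [oU AU lU]] := outer_regularity (mA i) Av e0.
apply: le_trans lU; apply: le_trans (le_hausdorff_pre _ _ AU) _.
by have := ratio_open ratio_le1 ler01 oU; rewrite mul1e.
Qed.

End hausdorff_flat.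

Section radial.
Context {R : realType} {N : nat}.
Local Open Scope ereal_scope.
Implicit Types (x : N.-tuple R) (A : set (N.-tuple R)).

Definition vdir x := vscale (vnorm x)^-1 x.

(* Sent off the sphere outside the punctured unit ball, so that the preimage of
   a subset of the sphere is the cone over it. *)
Definition rad x : N.-tuple R :=
  if (0 < vnorm x <= 1)%R then vdir x else [tuple 0%R | _ < N].

Lemma measurable_vnorm_inv : measurable_fun setT (fun x => (vnorm x)^-1)%R.
Proof.
under eq_fun do rewrite -powR_inv1 ?vnorm_ge0//.
exact: measurable_powR_vnorm.
Qed.

Lemma measurable_vdir : measurable_fun setT vdir.
Proof.
by apply: measurable_vscale; [exact: measurable_vnorm_inv|exact: measurable_id].
Qed.

Lemma measurable_rad : measurable_fun setT rad.
Proof.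
have mv := @measurable_vnormT R N.
apply: measurable_fun_ifT; [|exact: measurable_vdir|exact: measurable_cst].
by apply: measurable_and; [exact: measurable_fun_ltr|exact: measurable_fun_ler].
Qed.

Lemma vnorm_vdir x : (0 < vnorm x)%R -> vnorm (vdir x) = 1%R.
Proof.
by move=> x0; rewrite vnormZ gtr0_norm ?invr_gt0// mulVf// gt_eqF.
Qed.

Lemma vdir_scale (c : R) x : (0 < c)%R -> vdir (vscale c x) = vdir x.
Proof.
move=> c0; rewrite /vdir vnormZ gtr0_norm// vscaleA invfM.
by rewrite mulrAC mulVf ?mul1r// gt_eqF.
Qed.

(** With u = |x|, w = |y|, s = u w and c = <x, y>, the difference of the squares of the two
    distances is (u - w)^2 + 2 (s - 1)(1 - c/s). It is nonnegative since s >= 1 and c <= s. *)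
Lemma vdir_lipschitz x y : (1 <= vnorm x)%R -> (1 <= vnorm y)%R ->
  (eucl_dist (vdir x) (vdir y) <= eucl_dist x y)%R.
Proof.
move=> x1 y1.
have x0 : (0 < vnorm x)%R by exact: lt_le_trans x1.
have y0 : (0 < vnorm y)%R by exact: lt_le_trans y1.
rewrite !eucl_distE vnorm_le ?vnorm_ge0// sqr_vnorm !dotE (dotC y x) -!sqr_vnorm.
set u := vnorm x in x0 x1 *; set w := vnorm y in y0 y1 *; set c := dot x y.
have cuw : (c <= u * w)%R by exact: le_trans (ler_norm _) (Cauchy_Schwarz x y).
pose s := (u * w)%R.
have s1 : (1 <= s)%R by rewrite /s mulr_ege1.
have s0 : (0 < s)%R by exact: lt_le_trans s1.
rewrite [leLHS](_ : _ = 2 - 2 * (c / s))%R; last by rewrite /s; field; rewrite !gt_eqF.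
have h : (c / s <= 1)%R by rewrite ler_pdivrMr// mul1r.
have h2 : (0 <= (s - 1) * (1 - c / s))%R by rewrite mulr_ge0// subr_ge0.
have h3 : (s * (c / s) = c)%R by rewrite mulrC divfK// gt_eqF.
have h4 : (0 <= (u - w) ^+ 2)%R by exact: sqr_ge0.
move: h2 h4 h3; rewrite -/s; move: (c / s)%R => t h2 h4 h3.
rewrite -subr_ge0.
rewrite (_ : (_ - _)%R = ((u - w) ^+ 2 + 2 * ((s - 1) * (1 - t)))%R); last first.
  by rewrite -h3 /s; ring.
by rewrite addr_ge0// mulr_ge0.
Qed.

End radial.

Lemma leb_vscale (R : realType) (n : nat) (c : R) (A : set (n.-tuple R)) :
  c != 0 -> measurable A ->
  (leb R n ((fun x => vscale c x) @^-1` A) = ((`|c|^-1) ^+ n)%:E * leb R n A)%E.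
Proof.
move=> c0 mA; rewrite -(leb_affine [tuple 0 | _ < n] c0 mA); congr (leb R n _).
apply/funext => x; rewrite /preimage /=; congr A.
by apply: eq_from_tnth => i; rewrite !tnthE tnth_mktuple add0r.
Qed.

Lemma integral_exprn (R : realType) (n : nat) (c : R) : 0 < c ->
  (\int[@lebesgue_measure R]_(w in `]0%R, c]) (w ^+ n)%:E =
   (c ^+ n.+1 / n.+1%:R)%:E)%E.
Proof.
move=> c0; rewrite integral_itv_obnd_cbnd; last first.
  by apply/measurable_EFinP; apply: measurable_funTS; exact: exprn_measurable.
have dX x : derivable (fun y : R => y ^+ n.+1) x 1 by exact: exprn_derivable.
have cF x : {for x, continuous (fun y : R => y ^+ n.+1 * n.+1%:R^-1)}.
  by apply: cvgM; [exact: exprn_continuous|exact: cvg_cst].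
rewrite (@continuous_FTC2 _ _ (fun y => y ^+ n.+1 * n.+1%:R^-1)%R)//=.
- by rewrite expr0n mul0r sube0.
- by apply: continuous_in_subspaceT => x _; exact: exprn_continuous.
- split.
  + by move=> y _; apply: derivableM.
  + exact/cvg_at_right_filter/cF.
  + exact/cvg_at_left_filter/cF.
- move=> x _; rewrite derive1Mr// derive1E exp_derive//= scaler1.
  by rewrite mulrAC divff ?mul1r// pnatr_eq0.
Qed.

(** * Gnomonic charts and the volume of cones *)

Section gnomonic.
Context {R : realType} {n : nat}.
Local Notation mu := (@lebesgue_measure R).
Local Open Scope ereal_scope.
Implicit Types (q y : n.-tuple R) (x : n.+1.-tuple R) (A : set (n.+1.-tuple R)).

(* The inverse of the central projection of the upper half-sphere onto its
   tangent hyperplane at the pole (1, 0, ..., 0). *)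
Definition gnomonic_inv q : n.+1.-tuple R := vdir (tcons (1%R, q)).

Definition gnomonic x : n.-tuple R := vscale (thead x)^-1 [tuple of behead x].

Lemma measurable_gnomonic_inv : measurable_fun setT gnomonic_inv.
Proof.
apply: (measurableT_comp measurable_vdir).
by apply: measurable_cons; [exact: measurable_cst|exact: measurable_id].
Qed.

Lemma dot_tcons (t s : R) y q :
  dot (tcons (t, y)) (tcons (s, q)) = (t * s + dot y q)%R.
Proof. exact: dot_cons. Qed.

Lemma vnorm_tcons1 q : (1 <= vnorm (tcons (1%R, q)))%R.
Proof.
rewrite -[leLHS]sqrtr1 /vnorm ler_wsqrtr// dot_tcons mulr1 lerDl.
exact: dotxx_ge0.
Qed.

Lemma vscale_tcons (c t : R) y : vscale c (tcons (t, y)) = tcons ((c * t)%R, vscale c y).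
Proof.
apply: eq_from_tnth => i; rewrite !tnthE.
by have [j ->|->] := unliftP ord0 i; rewrite ?tnthS ?tnthE// !tnth0.
Qed.

Lemma vsub_tcons (t s : R) y q :
  vsub (tcons (t, y)) (tcons (s, q)) = tcons ((t - s)%R, vsub y q).
Proof.
apply: eq_from_tnth => i; rewrite !tnthE.
by have [j ->|->] := unliftP ord0 i; rewrite ?tnthS ?tnthE// !tnth0.
Qed.

Lemma gnomonic_inv_lipschitz q y :
  (eucl_dist (gnomonic_inv q) (gnomonic_inv y) <= eucl_dist q y)%R.
Proof.
apply: le_trans (vdir_lipschitz (vnorm_tcons1 _) (vnorm_tcons1 _)) _.
rewrite !eucl_distE vsub_tcons subrr vnorm_le ?vnorm_ge0// sqr_vnorm.
by rewrite dot_tcons mulr0 add0r.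
Qed.

Lemma vdir_gnomonic (w : R) y : (0 < w)%R ->
  vdir (tcons (w, y)) = gnomonic_inv (vscale w^-1 y).
Proof.
move=> w0; rewrite -(vdir_scale (tcons (w, y)) (_ : 0 < w^-1)%R) ?invr_gt0//.
by rewrite vscale_tcons mulVf// gt_eqF.
Qed.

Lemma vdir_id x : vnorm x = 1%R -> vdir x = x.
Proof. by move=> x1; rewrite /vdir x1 invr1 vscale1. Qed.

Lemma gnomonicK x : vnorm x = 1%R -> (0 < thead x)%R ->
  gnomonic_inv (gnomonic x) = x.
Proof.
by move=> x1 h0; rewrite -vdir_gnomonic// -tcons_eta vdir_id.
Qed.

Definition pole : n.+1.-tuple R := tcons (1%R, [tuple 0%R | _ < n]).

Lemma vnorm_behead (t : R) y : (vnorm y <= vnorm (tcons (t, y)))%R.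
Proof. by rewrite ler_wsqrtr// dot_tcons lerDr -expr2 sqr_ge0. Qed.

Lemma thead_tcons (t : R) y : thead (tcons (t, y)) = t.
Proof. by []. Qed.

Lemma behead_tcons (t : R) y : [tuple of behead (tcons (t, y))] = y :> n.-tuple R.
Proof. exact/val_inj. Qed.

Lemma eucl_dist_thead x x' : (`|thead x - thead x'| <= eucl_dist x x')%R.
Proof.
by rewrite eucl_distE; apply: le_trans (ler_tnth_vnorm _ ord0); rewrite tnthE.
Qed.

Lemma thead_pole (d : R) x : (eucl_dist x pole <= d)%R -> (1 - d <= thead x)%R.
Proof.
move=> /(le_trans (eucl_dist_thead x pole)); rewrite thead_tcons ler_norml.
lra.
Qed.

(** Write x = (z, y) and x' = (z', y'). Then y/z - y'/z' = (y - y')/z + (z' - z) y'/(z z'), where z,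
    z' >= 1 - d and |y'| <= d. The constant is 1/(1 - d) + d/(1 - d)^2 = 1/(1 - d)^2. *)
Lemma gnomonic_lipschitz (d : R) x x' : (d < 1)%R ->
  (eucl_dist x pole <= d)%R -> (eucl_dist x' pole <= d)%R ->
  (eucl_dist (gnomonic x) (gnomonic x') <= eucl_dist x x' / (1 - d) ^+ 2)%R.
Proof.
move=> d1 xd x'd.
have d0 : (0 <= d)%R by apply: le_trans xd; exact: eucl_dist_ge0.
have zd := thead_pole xd; have z'd := thead_pole x'd.
have zz := eucl_dist_thead x x'.
have y'd : (vnorm [tuple of behead x'] <= d)%R.
  apply: le_trans x'd; rewrite eucl_distE.
  have := vnorm_behead (thead x' - 1) (vsub [tuple of behead x'] [tuple 0%R | _ < n]).
  rewrite -vsub_tcons -tcons_eta; congr (is_true (vnorm _ <= _)%R).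
  by apply: eq_from_tnth => i; rewrite !tnthE tnth_mktuple subr0.
have yy : (vnorm (vsub [tuple of behead x] [tuple of behead x']) <= eucl_dist x x')%R.
  have := vnorm_behead (thead x - thead x') (vsub [tuple of behead x] [tuple of behead x']).
  by rewrite -vsub_tcons -!tcons_eta eucl_distE.
rewrite [leLHS]eucl_distE /gnomonic.
set z := thead x in zd zz *; set z' := thead x' in z'd zz *.
set y := [tuple of behead x] in yy *; set y' := [tuple of behead x'] in y'd yy *.
set D := eucl_dist x x' in zz yy *.
have c0 : (0 < 1 - d)%R by rewrite subr_gt0.
have z0 : (0 < z)%R by exact: lt_le_trans zd.
have z'0 : (0 < z')%R by exact: lt_le_trans z'd.
have D0 : (0 <= D)%R by apply: le_trans yy; exact: vnorm_ge0.
rewrite (_ : vsub _ _ = vadd (vscale z^-1 (vsub y y')) (vscale ((z' - z) / (z * z')) y')); last first.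
  by apply: eq_from_tnth => i; rewrite !tnthE; field; rewrite !gt_eqF.
apply: le_trans (vnormD _ _) _; rewrite !vnormZ normrM.
rewrite (gtr0_norm (_ : 0 < z^-1)%R) ?invr_gt0// (gtr0_norm (_ : 0 < (z * z')^-1)%R) ?invr_gt0 ?mulr_gt0//.
have h1 : (z^-1 * vnorm (vsub y y') <= (1 - d)^-1 * D)%R.
  apply: ler_pM => //; [by rewrite invr_ge0 ltW|exact: vnorm_ge0|].
  by rewrite lef_pV2 ?posrE.
have h2 : (`|z' - z| / (z * z') * vnorm y' <= (D / ((1 - d) * (1 - d))) * d)%R.
  have zz'0 : (0 < z * z')%R by rewrite mulr_gt0.
  apply: ler_pM => //; [by rewrite divr_ge0// ltW|exact: vnorm_ge0|].
  apply: ler_pM => //; [by rewrite invr_ge0 ltW|by rewrite distrC|].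
  rewrite lef_pV2 ?posrE ?mulr_gt0//.
  by apply: ler_pM => //; exact: ltW.
apply: le_trans (lerD h1 h2) _.
by rewrite le_eqVlt; apply/orP; left; apply/eqP; field; rewrite gt_eqF.
Qed.

End gnomonic.

Section gnomonic_cap.
Context {R : realType} {n : nat}.
Local Notation mu := (@lebesgue_measure R).
Local Open Scope ereal_scope.
Variable (A : set (n.+1.-tuple R)).
Hypothesis mA : measurable A.
Hypothesis AS : A `<=` usphere R n.+1.

Let B := rad @^-1` A.

Let mB : measurable B.
Proof. by rewrite -[B]setTI; exact: measurable_rad. Qed.

Let E := gnomonic_inv @^-1` A.

Let mE : measurable E.
Proof. by rewrite -[E]setTI; exact: measurable_gnomonic_inv. Qed.

Let leb_slices : leb R n.+1 B = \int[mu]_w leb R n [set y | B (tcons (w, y))].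
Proof.
rewrite -[in LHS](setIT B) -integral_indic// ge0_integral_tupleS//; last first.
  by apply/measurable_EFinP; exact: measurable_indic.
apply: eq_integral => w _.
transitivity (\int[leb R n]_y (\1_[set y | B (tcons (w, y))] y : R)%:E).
  by apply: eq_integral => y _; rewrite !indicE.
rewrite integral_indic ?setIT//.
have mt : measurable_fun setT (fun y : n.-tuple R => tcons (w, y)).
  exact: (measurableT_comp (@measurable_tcons R n) (measurable_pair1 w)).
by have := mt measurableT B mB; rewrite setTI.
Qed.

(** For 0 < w <= c this is the volume of w E, the slice at height w of the unbounded cone over A. *)
Let cyl (c : R) (w : R) : \bar R := (leb R n E) * (w ^+ n * \1_`]0%R, c] w)%:E.

Let mJ (c : R) : measurable (`]0%R, c]%classic : set (measurableTypeR R)).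
Proof. exact: measurable_itv. Qed.

Let mcyl (c : R) :
  measurable_fun setT (fun w : measurableTypeR R => (w ^+ n * \1_`]0%R, c] w)%:E : \bar R).
Proof.
apply/measurable_EFinP; apply: measurable_funM; first exact: exprn_measurable.
by apply: measurable_indic; exact: mJ.
Qed.

Let cyl0 (c w : R) : (0 <= w ^+ n * \1_`]0%R, c] w)%R.
Proof.
rewrite indicE; have [/set_mem|] := boolP (w \in `]0%R, c]%classic); last by rewrite mulr0.
by rewrite /= in_itv/= mulr1 => /andP[w0 _]; rewrite exprn_ge0// ltW.
Qed.

Let integral_cyl (c : R) : (0 < c)%R ->
  \int[mu]_w cyl c w = leb R n E * (c ^+ n.+1 / n.+1%:R)%:E.
Proof.
move=> c0; rewrite ge0_integralZl//; last by move=> w _; rewrite lee_fin.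
rewrite -integral_exprn// [in RHS]integral_mkcond; congr (_ * _).
apply: eq_integral => w _; rewrite patchE indicE.
by case: (w \in _); rewrite ?mulr1 ?mulr0.
Qed.

Let mslice w : measurable [set y | B (tcons (w, y))].
Proof.
have mt : measurable_fun setT (fun y : n.-tuple R => tcons (w, y)).
  exact: (measurableT_comp (@measurable_tcons R n) (measurable_pair1 w)).
by have := mt measurableT B mB; rewrite setTI.
Qed.

Let mslices :
  measurable_fun setT (fun w : measurableTypeR R => leb R n [set y | B (tcons (w, y))]).
Proof.
rewrite (_ : (fun _ => _) =
    fun w : measurableTypeR R => \int[leb R n]_y (\1_B (tcons (w, y)) : R)%:E).
  apply: (measurable_integral_tcons (f := fun x => (\1_B x)%:E)).
    by apply/measurable_EFinP; exact: measurable_indic.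
  by move=> x; rewrite lee_fin.
apply/funext => w.
transitivity (\int[leb R n]_y (\1_[set y | B (tcons (w, y))] y : R)%:E).
  by rewrite integral_indic ?setIT//; exact: mslice.
by apply: eq_integral => y _; rewrite !indicE.
Qed.

Let leb_scaled w : (0 < w)%R ->
  leb R n ((fun y => vscale w^-1 y) @^-1` E) = leb R n E * (w ^+ n)%:E.
Proof.
move=> w0; rewrite leb_vscale//; last by rewrite invr_eq0 gt_eqF.
by rewrite gtr0_norm ?invr_gt0// invrK muleC.
Qed.

Let msc w : measurable ((fun y => vscale w^-1 y) @^-1` E).
Proof.
rewrite -[X in measurable X]setTI.
have : measurable_fun setT (fun y : n.-tuple R => vscale w^-1 y).
  by apply: measurable_vscale; [exact: measurable_cst|exact: measurable_id].
by apply.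
Qed.

Let thead_vdir (w : R) (y : n.-tuple R) :
  (thead (vdir (tcons (w, y))) = (vnorm (tcons (w, y)))^-1 * w)%R.
Proof. by rewrite /vdir vscale_tcons thead_tcons. Qed.

Let thead_le (w : R) (y : n.-tuple R) : (`|w| <= vnorm (tcons (w, y)))%R.
Proof. exact: (ler_tnth_vnorm (tcons (w, y)) ord0). Qed.

(** The truncated cone has slices only at heights 0 < w <= 1, each contained in w E, of volume w^n
    |E|; integration over w gives |E| / (n + 1). *)
Lemma leb_cap_le : (forall x, A x -> 0 < thead x)%R ->
  n.+1%:R%:E * leb R n.+1 B <= leb R n E.
Proof.
move=> A0; have := integral_cyl ltr01; rewrite expr1n => cyl1.
have -> : leb R n E = n.+1%:R%:E * \int[mu]_w cyl 1 w.
  by rewrite cyl1 muleCA -EFinM mul1r divff ?pnatr_eq0// mule1.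
apply: lee_wpmul2l => //; rewrite leb_slices.
apply: ge0_le_integral => //; first exact: measurable_funeM.
move=> w _; rewrite /cyl indicE.
have [/set_mem|] := boolP (w \in `]0%R, 1%R]%classic).
  rewrite /= in_itv/= => /andP[w0 w1]; rewrite mulr1 -leb_scaled//.
  apply: le_measure; rewrite ?inE; [exact: mslice|exact: msc|].
  move=> y; rewrite /B /E /= /rad; case: ifP => [_|_ /A0]; first by rewrite vdir_gnomonic.
  by rewrite /thead tnth_mktuple ltxx.
move=> w01; rewrite mulr0 mule0 (_ : [set y | _] = set0) ?measure0//.
apply/seteqP; split => // y; rewrite /B /= /rad; case: ifP => [/andP[x0 x1]|_] /A0.
  rewrite thead_vdir pmulr_rgt0 ?invr_gt0// => w0.
  move: w01; rewrite mem_set//= in_itv/= w0/=.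
  by apply: le_trans x1; apply: le_trans (thead_le w y); exact: ler_norm.
by rewrite /thead tnth_mktuple ltxx.
Qed.

(** Up to height c the truncation removes nothing: a point at height w of the cone has norm w
    divided by the height of its direction, hence at most w / c <= 1. The slice is then all of w
    E. *)
Lemma leb_cap_ge (c : R) : (0 < c)%R -> (forall x, A x -> c <= thead x)%R ->
  (c ^+ n.+1)%:E * leb R n E <= n.+1%:R%:E * leb R n.+1 B.
Proof.
move=> c0 Ac.
have -> : (c ^+ n.+1)%:E * leb R n E = n.+1%:R%:E * \int[mu]_w cyl c w.
  rewrite integral_cyl// muleCA -EFinM mulrCA divff ?pnatr_eq0// mulr1.
  by rewrite muleC.
apply: lee_wpmul2l => //; rewrite leb_slices.
apply: ge0_le_integral => //.
- by move=> w _; rewrite /cyl mule_ge0// lee_fin.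
- exact: measurable_funeM.
move=> w _; rewrite /cyl indicE.
have [/set_mem|] := boolP (w \in `]0%R, c]%classic); last by rewrite mulr0 mule0.
rewrite /= in_itv/= => /andP[w0 wc]; rewrite mulr1 -leb_scaled//.
apply: le_measure; rewrite ?inE; [exact: msc|exact: mslice|].
move=> y; rewrite /B /E /= -vdir_gnomonic// => Avy.
have x0 : (0 < vnorm (tcons (w, y)))%R.
  by apply: lt_le_trans (thead_le w y); rewrite gtr0_norm.
rewrite /rad x0 ifT//=.
have := Ac _ Avy; rewrite thead_vdir ler_pdivlMl// => h.
by rewrite -(ler_pM2r c0) mul1r (le_trans h).
Qed.

End gnomonic_cap.

(** The detour through the square applies [powR] to a nonnegative base only; the outer factor r
    gives the value 0 at 0. *)
Lemma measurable_inv (R : realType) : measurable_fun setT (fun r : R => r^-1).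
Proof.
rewrite (_ : (fun r => _) = fun r : R => r * (r ^+ 2) `^ (-1)).
  apply: measurable_funM => //; apply: (measurableT_comp (measurable_powR _)).
  exact: exprn_measurable.
apply/funext => r; rewrite powR_inv1 ?sqr_ge0//.
have [->|r0] := eqVneq r 0; first by rewrite invr0 mul0r.
by field.
Qed.

(** The limit d -> 0, by Bernoulli's inequality (1 - d)^m >= 1 - m d. All estimates that lose a
    power of 1 - d end here. *)
Lemma ler_pow_lim (R : realType) (m : nat) (s h : R) : 0 <= s ->
  (forall d, 0 < d < 1 -> (1 - d) ^+ m * s <= h) -> s <= h.
Proof.
move=> s0 H; have bern (d : R) : 0 < d < 1 -> 1 - m%:R * d <= (1 - d) ^+ m.
  move=> /andP[d0 d1]; elim: m {H} => [|m IH]; first by rewrite mul0r subr0 expr0.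
  rewrite exprS; apply: (@le_trans _ _ ((1 - d) * (1 - m%:R * d))); last first.
    by rewrite ler_wpM2l// subr_ge0 ltW.
  rewrite -natr1 -subr_ge0.
  rewrite (_ : _ - _ = m%:R * d ^+ 2); last by ring.
  by rewrite mulr_ge0// sqr_ge0.
apply/ler_addgt0Pr => e e0; pose d := e / (m%:R * s + e + 1).
have D0 : 0 < m%:R * s + e + 1 by rewrite ltr_wpDl// addr_ge0 ?mulr_ge0// ltW.
have ms : 0 <= m%:R * s by rewrite mulr_ge0.
have d01 : 0 < d < 1.
  by rewrite divr_gt0//= /d ltr_pdivrMr// mul1r; lra.
have h1 : (1 - m%:R * d) * s <= h.
  by apply: le_trans (H d d01); rewrite ler_wpM2r// bern.
have h2 : m%:R * d * s <= e.
  rewrite (_ : _ * s = (m%:R * s) * e / (m%:R * s + e + 1)); last by rewrite /d; field; rewrite gt_eqF.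
  rewrite ler_pdivrMr// [leRHS]mulrC ler_wpM2r ?ltW//; lra.
by move: h1; rewrite mulrBl mul1r; lra.
Qed.

Section hull.
Context {R : realType} {n : nat}.
Local Open Scope ereal_scope.

(** Coverings use arbitrary sets, and the images of these in a chart need not be measurable. The
    unions of all cubes of generation k that meet D are measurable, and their intersection over k
    contains D and obeys the same diameter bound, so the isodiametric inequality applies to it. *)
Lemma leb_hull (D : set (n.-tuple R)) (d : R) : D !=set0 ->
  (forall x y, D x -> D y -> eucl_dist x y <= d)%R ->
  exists D', [/\ measurable D', D `<=` D' &
    leb R n D' <= ((d / 2) ^+ n)%:E * leb R n (uball R n)].
Proof.
move=> [a Da] Dd.
pose T k := [set x : n.-tuple R | exists2 y, D y & dyadic_index k y = dyadic_index k x].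
have sT k : dyadic_saturated k (T k).
  by move=> x [y Dy yx] z; rewrite /dyadic_cube /= => zx; exists y => //; rewrite yx zx.
have DT : D `<=` \bigcap_k T k by move=> x Dx k _; exists x.
have mT : measurable (\bigcap_k T k).
  by apply: bigcapT_measurable => k; exact: dyadic_saturated_measurable (sT k).
exists (\bigcap_k T k); split => //; apply: isodiametric => //.
  by exists a; exact: DT.
move=> x y Tx Ty; apply/ler_addgt0Pr => e e0.
have [k ke] := half_power_small (Num.sqrt n%:R * 2) e0.
have [x' Dx' xx'] := Tx k I; have [y' Dy' yy'] := Ty k I.
apply: le_trans (eucl_dist_triangle x' _ _) _.
apply: (@le_trans _ _ (Num.sqrt n%:R * 2 ^- k + (d + Num.sqrt n%:R * 2 ^- k))%R).
  apply: lerD; first exact: (@dyadic_cube_dist _ _ k (dyadic_index k x)).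
  apply: le_trans (eucl_dist_triangle y' _ _) _; apply: lerD; first exact: Dd.
  exact: (@dyadic_cube_dist _ _ k (dyadic_index k y)).
by move: ke; rewrite mulrAC; lra.
Qed.

End hull.

(** * The Hausdorff measure on the sphere as a cone measure *)

Section sphere_measure.
Context {R : realType} {n : nat}.
Local Open Scope ereal_scope.
Implicit Types (A C : set (n.+1.-tuple R)).

(* Surface measure, as N times the volume of the cone over a set. *)
Definition sphere_measure : {measure set (n.+1.-tuple R) -> \bar R} :=
  mscale (NngNum (ler0n R n.+1)) (image_measure (leb R n.+1) measurable_rad).

Lemma sphere_measureE A :
  sphere_measure A = n.+1%:R%:E * leb R n.+1 (rad @^-1` A).
Proof. by []. Qed.

Lemma reflect_scale v (c : R) (x : n.+1.-tuple R) :
  reflect v (vscale c x) = vscale c (reflect v x).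
Proof.
by apply: eq_from_tnth => i; rewrite !(tnthE, dotE); ring.
Qed.

Lemma rad_reflect v (x : n.+1.-tuple R) : rad (reflect v x) = reflect v (rad x).
Proof.
rewrite /rad vnorm_reflect; case: ifP => _.
  by rewrite /vdir vnorm_reflect reflect_scale.
apply: eq_from_tnth => i; rewrite !tnthE !tnth_mktuple.
rewrite [dot v _](_ : _ = 0%R); first by rewrite mulr0 !mul0r subr0.
by rewrite /dot big1// => j _; rewrite tnth_mktuple mulr0.
Qed.

Lemma sphere_measure_reflect v A : measurable A ->
  sphere_measure (reflect v @^-1` A) = sphere_measure A.
Proof.
move=> mA; rewrite !sphere_measureE; congr (_ * _).
rewrite -[in RHS](leb_reflect v); last first.
  by rewrite -[X in measurable X]setTI; exact: measurable_rad.
by congr (leb R n.+1 _); apply/funext => x; rewrite /preimage /= rad_reflect.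
Qed.

Lemma sphere_measure_lty A : measurable A -> A `<=` usphere R n.+1 ->
  sphere_measure A < +oo.
Proof.
move=> mA AS; rewrite sphere_measureE; apply: lte_mul_pinfty; rewrite ?lee_fin//.
apply: (le_lt_trans _ (@leb_uball_lty R n.+1)).
apply: le_measure; rewrite ?inE.
- by rewrite -[X in measurable X]setTI; exact: measurable_rad.
- exact: measurable_uball.
move=> x /= /AS; rewrite /rad /usphere /= -/(vnorm _).
case: ifP => [/andP[_ x1] _|_]; first exact: x1.
rewrite /vnorm /dot big1 ?sqrtr0; last by move=> i _; rewrite tnth_mktuple mulr0.
by move=> /esym/eqP; rewrite oner_eq0.
Qed.

Lemma vnorm_pole : vnorm (pole : n.+1.-tuple R) = 1%R.
Proof.
rewrite /vnorm dot_tcons mulr1 /dot big1 ?addr0 ?sqrtr1// => i _.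
by rewrite tnth_mktuple mulr0.
Qed.

Lemma gnomonic_invK (q : n.-tuple R) : gnomonic (gnomonic_inv q) = q.
Proof.
rewrite /gnomonic_inv /vdir; set r := (vnorm _)^-1%R.
have r0 : r != 0%R by rewrite invr_eq0 gt_eqF// (lt_le_trans _ (vnorm_tcons1 _)).
rewrite vscale_tcons /gnomonic thead_tcons mulr1.
rewrite behead_tcons.
by apply: eq_from_tnth => i; rewrite !tnthE mulrA mulVf ?mul1r.
Qed.

Lemma measurable_gnomonic : measurable_fun setT (@gnomonic R n).
Proof.
apply: measurable_vscale; last exact: measurable_behead.
apply: (measurableT_comp (@measurable_inv R)).
exact: measurable_tnth.
Qed.

(** A reflection exchanges c with the pole, so the chart at the pole serves at every point. That f
    does not increase distances carries coverings from the hyperplane to the sphere; the bound for g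
    carries diameters of small sets back. *)
Lemma sphere_chart (c : n.+1.-tuple R) (d : R) : vnorm c = 1%R -> (0 <= d < 1)%R ->
  exists (f : n.-tuple R -> n.+1.-tuple R) (g : n.+1.-tuple R -> n.-tuple R),
  [/\ measurable_fun setT f, measurable_fun setT g, cancel f g,
      (forall q q', eucl_dist (f q) (f q') <= eucl_dist q q')%R &
  [/\
      (forall x, vnorm x = 1 -> eucl_dist x c <= d -> f (g x) = x)%R,
      (forall x x', eucl_dist x c <= d -> eucl_dist x' c <= d ->
        eucl_dist (g x) (g x') <= eucl_dist x x' / (1 - d) ^+ 2)%R &
      forall A, measurable A -> A `<=` usphere R n.+1 ->
        (forall x, A x -> eucl_dist x c <= d)%R ->
        sphere_measure A <= leb R n (f @^-1` A) /\
        ((1 - d) ^+ n.+1)%:E * leb R n (f @^-1` A) <= sphere_measure A]].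
Proof.
move=> c1 /andP[d0 d1]; pose v := vsub c pole.
have vc : reflect v c = pole by apply: reflect_swap; rewrite c1 vnorm_pole.
have distc x : eucl_dist (reflect v x) pole = eucl_dist x c.
  by rewrite -vc eucl_dist_reflect.
exists (reflect v \o gnomonic_inv), (gnomonic \o reflect v); split.
- exact: (measurableT_comp (measurable_reflect v) measurable_gnomonic_inv).
- exact: (measurableT_comp measurable_gnomonic (measurable_reflect v)).
- by move=> q /=; rewrite reflectK gnomonic_invK.
- by move=> q q' /=; rewrite eucl_dist_reflect gnomonic_inv_lipschitz.
split.
- move=> x x1 xd /=; rewrite gnomonicK ?reflectK ?vnorm_reflect//.
  by rewrite (lt_le_trans _ (thead_pole (_ : _ <= d)%R)) ?subr_gt0// distc.
- by move=> x x' xd x'd /=; rewrite -(eucl_dist_reflect v x) gnomonic_lipschitz// distc.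
move=> A mA AS Ad; pose A' := reflect v @^-1` A.
have mA' : measurable A'.
  by rewrite -[A']setTI; exact: measurable_reflect.
have A'd x : A' x -> (1 - d <= thead x)%R.
  by move=> /Ad; rewrite -distc reflectK => /thead_pole.
rewrite -(sphere_measure_reflect v mA) sphere_measureE comp_preimage; split.
  by apply: leb_cap_le => // x /A'd; apply: lt_le_trans; rewrite subr_gt0.
by apply: leb_cap_ge => //; rewrite subr_gt0.
Qed.

(** One set C of a covering. In a chart centred at a point of A and C, the diameter grows by at most
    (1 - d)^-2, and the isodiametric inequality bounds the volume of the image by the gauge of C. A
    measurable A' takes the place of the intersection of A and C, as C is arbitrary. *)
Lemma sphere_measure_gauge A C (d : R) : (0 < d < 1)%R -> measurable A ->
  A `<=` usphere R n.+1 -> diam C <= d%:E ->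
  exists A', [/\ measurable A', A `&` C `<=` A' , A' `<=` A &
    (((1 - d) ^+ 2) ^+ n)%:E * sphere_measure A' <= hausdorff_gauge n C].
Proof.
move=> /andP[d0 d1] mA AS Cd; have [AC|/set0P[c [Ac Cc]]] := eqVneq (A `&` C) set0.
  exists set0; rewrite AC; split => //; rewrite measure0 mule0.
  exact: hausdorff_gauge_ge0.
have d01 : (0 <= d < 1)%R by rewrite ltW.
have [f [g [mf mg fK f1 [gK gL fA]]]] := sphere_chart (AS _ Ac) d01.
have C0 : C !=set0 by exists c.
have diamfin : diam C \is a fin_num.
  by rewrite ge0_fin_numE ?diam_ge0// (le_lt_trans Cd)// ltry.
pose t := fine (diam C).
have Ct x y : C x -> C y -> (eucl_dist x y <= t)%R.
  by move=> Cx Cy; rewrite -lee_fin fineK// diam_ge.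
have td : (t <= d)%R by rewrite -lee_fin fineK.
have t0 : (0 <= t)%R by apply: fine_ge0; exact: diam_ge0.
pose r := (1 - d)%R; have r0 : (0 < r)%R by rewrite subr_gt0.
pose D := g @` (A `&` C).
have D0 : D !=set0 by exists (g c), c.
have [||D' [mD' DD' lD']] := @leb_hull _ _ D (t / r ^+ 2)%R => //.
  move=> _ _ [x [Ax Cx] <-] [y [Ay Cy] <-].
  apply: le_trans (gL _ _ _ _) _; [by apply: le_trans td; exact: Ct..|].
  by rewrite ler_pM2r ?invr_gt0 ?exprn_gt0// Ct.
pose A' := A `&` [set x | (eucl_dist x c <= d)%R] `&` (g @^-1` D').
have mA' : measurable A'.
  apply: measurableI; last by rewrite -[X in measurable X]setTI; exact: mg.
  apply: measurableI => //; apply: measurable_ler => //.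
  by apply: measurable_eucl_dist; [exact: measurable_id|exact: measurable_cst].
exists A'; split => //.
- move=> x [Ax Cx]; split; last by apply: DD'; exists x.
  by split => //=; apply: le_trans (Ct _ _ Cx Cc) td.
- by move=> x [[]].
have [] := fA A' mA'; [by move=> x [[/AS]]|by move=> x [[_]]|].
move=> h _.
have {}h : sphere_measure A' <= ((t / r ^+ 2 / 2) ^+ n)%:E * leb R n (uball R n).
  apply: le_trans h _; apply: le_trans lD'.
  apply: le_measure; rewrite ?inE//.
    by rewrite -[X in measurable X]setTI; exact: mf.
  by move=> y [_]; rewrite /= fK.
rewrite /hausdorff_gauge ifN; last exact/set0P.
apply: (@le_trans _ _ ((((r ^+ 2) ^+ n)%:E) *
   (((t / r ^+ 2 / 2) ^+ n)%:E * leb R n (uball R n)))).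
  by apply: lee_wpmul2l => //; rewrite lee_fin !exprn_ge0// ltW.
rewrite muleA -EFinM -exprMn muleC -(fineK diamfin) -/t -EFinM -EFin_expe.
rewrite (_ : r ^+ 2 * (t / r ^+ 2 / 2) = t / 2)%R//.
by field; rewrite gt_eqF.
Qed.

Lemma sphere_measure_le_pre A (d : R) : (0 < d < 1)%R -> measurable A ->
  A `<=` usphere R n.+1 ->
  (((1 - d) ^+ 2) ^+ n)%:E * sphere_measure A <= hausdorff_pre n d A.
Proof.
move=> d01 mA AS; apply: le_ereal_inf_tmp => _ [C [AC Cd] <-].
have /choice[A' HA'] := fun k => sphere_measure_gauge d01 mA AS (Cd k).
have mA' k : measurable (A' k) by have [] := HA' k.
have mUA' := bigcupT_measurable _ mA'.
have AA' : sphere_measure A <= \sum_(k <oo) sphere_measure (A' k).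
  apply: (le_trans _ (generalized_Boole_inequality _ mA' mUA')).
  apply: le_measure; rewrite ?inE// => x Ax.
  by have [k _ Cx] := AC x Ax; exists k => //; have [_ + _ _] := HA' k; apply.
have r0 : (0 <= ((1 - d) ^+ 2) ^+ n)%R.
  by rewrite exprn_ge0// sqr_ge0.
apply: (@le_trans _ _ ((((1 - d) ^+ 2) ^+ n)%:E * \sum_(k <oo) sphere_measure (A' k))).
  by apply: lee_wpmul2l => //; rewrite lee_fin.
rewrite -nneseriesZl//; apply: lee_nneseries => k _.
  by move=> _; rewrite mule_ge0.
by have [] := HA' k.
Qed.

(** Dyadic cubes of diameter less than d cut A into pieces, each inside a single chart centred at
    one of its points. There the flat estimate applies, and the factor (1 - d)^(n+1) pays for
    passing from Lebesgue measure in the chart to cone measure. The size d of the pieces is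
    unrelated to the mesh delta of the coverings. *)
Lemma hausdorff_pre_le_sphere A (delta d : R) : (0 < delta)%R ->
  (0 < d < 1)%R -> measurable A -> A `<=` usphere R n.+1 ->
  ((1 - d) ^+ n.+1)%:E * hausdorff_pre n delta A <= sphere_measure A.
Proof.
move=> delta0 /andP[d0 d1] mA AS.
have r0 : (0 <= (1 - d) ^+ n.+1)%R by rewrite exprn_ge0// subr_ge0 ltW.
have [k kd] := half_power_small (Num.sqrt n.+1%:R) d0.
have sT : dyadic_saturated k [set: n.+1.-tuple R] by [].
pose F i := A `&` dyadic_piece k setT i.
have EF : A = \bigcup_i F i.
  by rewrite /F -setI_bigcupr -(bigcup_dyadic_piece sT) setIT.
have mF i : measurable (F i).
  by apply: measurableI => //; exact: measurable_dyadic_piece.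
rewrite EF measure_bigcupT//; last first.
  apply: trivIset_setIl; exact: trivIset_dyadic_piece.
apply: (@le_trans _ _ (((1 - d) ^+ n.+1)%:E *
    \sum_(i <oo) hausdorff_pre n delta (F i))).
  apply: lee_wpmul2l; first by rewrite lee_fin.
  exact: hausdorff_pre_sigma_subadditive.
rewrite -nneseriesZl; last by move=> i _; exact: hausdorff_pre_ge0.
apply: lee_nneseries => i _.
  by move=> _; rewrite mule_ge0// ?hausdorff_pre_ge0// lee_fin.
have [->|/set0P[c Fc]] := eqVneq (F i) set0.
  by rewrite hausdorff_pre_set0 mule0 measure0.
have Fd x : F i x -> (eucl_dist x c <= d)%R.
  move=> [_]; move: Fc => [_]; rewrite /dyadic_piece.
  case: pickle_inv => // w; case: ifP => // _ cw xw.
  exact: le_trans (dyadic_cube_dist xw cw) (ltW kd).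
have FS : F i `<=` usphere R n.+1 by move=> x [/AS].
have d01 : (0 <= d < 1)%R by rewrite ltW.
have [f [g [mf mg fK f1 [gK gL fA]]]] := sphere_chart (FS _ Fc) d01.
have [_ h] := fA _ (mF i) FS Fd.
apply: le_trans h; apply: lee_wpmul2l; first by rewrite lee_fin.
have fF : f @` (f @^-1` F i) = F i.
  apply/seteqP; split => [_ [y Fy <-]//|x Fx].
  have xfg : f (g x) = x by apply: gK; [exact: FS|exact: Fd].
  by exists (g x); rewrite //= xfg.
rewrite -{1}fF; apply: le_trans (hausdorff_pre_image _ _ _ f1) _.
apply: hausdorff_pre_le_leb => //.
by rewrite -[X in measurable X]setTI; exact: mf.
Qed.

Theorem hausdorff_sphere A : measurable A -> A `<=` usphere R n.+1 ->
  hausdorff n A = sphere_measure A.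
Proof.
move=> mA AS; have sfin : sphere_measure A \is a fin_num.
  by rewrite ge0_fin_numE// sphere_measure_lty.
have s0 : (0 <= fine (sphere_measure A))%R by rewrite fine_ge0.
have half01 : (0 < (2^-1 : R))%R && ((2^-1 : R) < 1)%R by rewrite invr_gt0 ltr0n/= invf_lt1// ltr1n.
have pre_le delta : (0 < delta)%R -> hausdorff_pre n delta A <= sphere_measure A.
  (* The limit d -> 0 is taken among real numbers; the estimate at d = 1/2 supplies the finiteness
     that this requires. *)
  move=> delta0; have pfin : hausdorff_pre n delta A \is a fin_num.
    rewrite ge0_fin_numE ?hausdorff_pre_ge0//.
    have := hausdorff_pre_le_sphere delta0 half01 mA AS.
    have r0 : (0 < (1 - 2^-1) ^+ n.+1 :> R)%R.
      by rewrite exprn_gt0// subr_gt0; case/andP: half01.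
    have [->|//] := eqVneq (hausdorff_pre n delta A) +oo; last by rewrite ltey.
    by rewrite gt0_muley ?lte_fin// leye_eq => /eqP E; move: sfin; rewrite E.
  rewrite -(fineK pfin) -(fineK sfin) lee_fin; apply: (@ler_pow_lim _ n.+1).
    by rewrite fine_ge0// hausdorff_pre_ge0.
  move=> d d01; rewrite -lee_fin EFinM (fineK pfin) (fineK sfin).
  exact: hausdorff_pre_le_sphere.
have Hle : hausdorff n A <= sphere_measure A.
  by apply: ge_ereal_sup => _ [delta delta0 <-]; exact: pre_le.
have H0 : 0 <= hausdorff n A.
  exact: le_trans (hausdorff_pre_ge0 n 1 A) (hausdorff_pre_le_hausdorff n A ltr01).
have Hfin : hausdorff n A \is a fin_num.
  by rewrite ge0_fin_numE// (le_lt_trans Hle)// sphere_measure_lty.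
apply/eqP; rewrite eq_le Hle /=.
rewrite -(fineK Hfin) -(fineK sfin) lee_fin; apply: (@ler_pow_lim _ (2 * n)) => //.
move=> d d01; rewrite -lee_fin EFinM (fineK Hfin) (fineK sfin) exprM.
apply: le_trans (sphere_measure_le_pre d01 mA AS) _.
by apply: hausdorff_pre_le_hausdorff; case/andP: d01.
Qed.

End sphere_measure.

(** * Polar coordinates *)

Section eq_set_function_integral.
Import HBNNSimple.

(** The integral is built from suprema over simple functions below the restricted integrand, which
    vanishes off D. The nonzero levels of such functions lie in D, where m1 and m2 agree; the zero
    level may leave D, but it is weighted by 0. *)
Lemma eq_set_function_integral d (T : measurableType d) (R : realType)
    (m1 m2 : set T -> \bar R) (D : set T) (f : T -> \bar R) :
  (forall A, measurable A -> A `<=` D -> m1 A = m2 A) ->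
  (\int[m1]_(x in D) f x = \int[m2]_(x in D) f x)%E.
Proof.
move=> m12.
have key m m' (g : T -> \bar R) : (forall x, ~ D x -> g x = 0%E) ->
    (forall A, measurable A -> A `<=` D -> m A = m' A) ->
    [set sintegral m h | h in [set h : {nnsfun T >-> R} | forall x, ((h x)%:E <= g x)%E]]
    `<=`
    [set sintegral m' h | h in [set h : {nnsfun T >-> R} | forall x, ((h x)%:E <= g x)%E]].
  move=> g0 mm' _ [h hg <-]; exists h => //; apply: eq_fsbigr => r _.
  have [->|r0] := eqVneq r 0; first by rewrite !mul0e.
  rewrite mm'// => x /= hx; apply: contrapT => Dx.
  have := hg x; rewrite g0// lee_fin hx => r_le0.
  have : 0 <= h x by exact: fun_ge0.
  rewrite hx => r_ge0.
  by move: r0; rewrite eq_le r_le0 r_ge0.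
have pos (g : T -> \bar R) : (forall x, ~ D x -> g x = 0%E) ->
    ereal_sup [set sintegral m1 h | h in [set h : {nnsfun T >-> R} | forall x, ((h x)%:E <= g x)%E]] =
    ereal_sup [set sintegral m2 h | h in [set h : {nnsfun T >-> R} | forall x, ((h x)%:E <= g x)%E]].
  move=> g0; congr ereal_sup; apply/seteqP; split; apply: key => //.
  by move=> A mA AD; rewrite m12.
rewrite /integral; congr (_ - _)%E; apply: pos => x Dx.
  by rewrite funeposE patchE memNset// maxxx.
by rewrite funenegE patchE memNset// oppe0 maxxx.
Qed.

End eq_set_function_integral.

Section Kconst.
Context {R : realType} {n : nat}.
Local Open Scope ereal_scope.
Variable p : R.
Hypothesis p0 : (0 < p)%R.
Implicit Types (x e : n.+1.-tuple R).

(** The 0-homogeneous extension of the integrand of K(p,N); it vanishes at the origin. *)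
Definition angular e x : R := (`|dot (vdir x) e| `^ p)%R.

Definition ball_integral (g : n.+1.-tuple R -> R) : \bar R :=
  \int[leb R n.+1]_x (\1_(uball R n.+1) x * g x)%:E.

Lemma fine_ball_integral_ge0 g : (forall x, 0 <= g x)%R ->
  (0 <= fine (ball_integral g))%R.
Proof.
by move=> g0; apply: fine_ge0; apply: integral_ge0 => x _; rewrite lee_fin mulr_ge0.
Qed.

Lemma measurable_angular e : measurable_fun setT (angular e).
Proof.
apply: (measurableT_comp (measurable_powR p)); apply: measurableT_comp => //.
by apply: measurable_dot; [exact: measurable_vdir|exact: measurable_cst].
Qed.

Lemma angular_ge0 e x : (0 <= angular e x)%R.
Proof. exact: powR_ge0. Qed.

Lemma angular_scale e (c : R) x : (0 < c)%R -> angular e (vscale c x) = angular e x.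
Proof. by move=> c0; rewrite /angular vdir_scale. Qed.

Lemma angular_le1 e x : vnorm e = 1%R -> (angular e x <= 1)%R.
Proof.
move=> e1.
have h : (`|dot (vdir x) e| <= 1)%R.
  apply: le_trans (Cauchy_Schwarz _ _) _; rewrite e1 mulr1.
  have [x0|x0] := eqVneq (vnorm x) 0%R.
    by rewrite /vdir x0 invr0 vnormZ normr0 mul0r.
  by rewrite vnorm_vdir// lt_neqAle eq_sym x0 vnorm_ge0.
by have := ge0_ler_powR (ltW p0) (_ : _ \in Num.nneg) (_ : _ \in Num.nneg) h;
  rewrite powR1; apply; rewrite nnegrE.
Qed.

Lemma measurable_usphere : measurable (usphere R n.+1).
Proof.
have mv := @measurable_vnormT R n.+1.
by have := mv measurableT [set 1%R] (measurable_set1 _); rewrite setTI.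
Qed.

(** The Hausdorff integral over the sphere becomes an integral over the cone above it, that is, the
    ball. The centre, where [rad] leaves the sphere, is harmless: both integrands are 0 there. *)
Lemma KconstE e : Kconst p e = (p^-1)%:E * (n.+1%:R%:E * ball_integral (angular e)).
Proof.
congr (_ * _); rewrite [n.+1.-1]/=.
rewrite (@eq_set_function_integral _ _ _ _ sphere_measure); last first.
  by move=> A; exact: hausdorff_sphere.
rewrite integral_mkcond; set f := _ \_ _.
have mf : measurable_fun setT f.
  apply/(measurable_restrictT _ measurable_usphere)/measurable_funTS/measurable_EFinP.
  apply: (measurableT_comp (measurable_powR p)); apply: measurableT_comp => //.
  by apply: measurable_dot; [exact: measurable_id|exact: measurable_cst].
have f0 x : 0 <= f x.
  by rewrite /f patchE; case: ifP => // _; rewrite lee_fin powR_ge0.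
rewrite ge0_integral_mscale//= (ge0_integral_image _ measurable_rad)//.
congr (_ * _).
apply: eq_integral => x _; rewrite /f patchE /rad indicE.
case: (boolP (0 < vnorm x <= 1)%R) => [/andP[x0 x1]|xout].
  have vS : usphere R n.+1 (vdir x) by exact: (vnorm_vdir x0).
  have xB : uball R n.+1 x by exact: x1.
  by rewrite (mem_set vS) (mem_set xB) mul1r.
rewrite (memNset (_ : ~ usphere R n.+1 _)); last first.
  rewrite /usphere /= /dot big1 ?sqrtr0; last first.
    by move=> i _; rewrite tnth_mktuple mulr0.
  by move/esym/eqP; rewrite oner_eq0.
have [xb|xb] := boolP (x \in uball R n.+1); last by rewrite mul0r.
rewrite mul1r; have x1 : (vnorm x <= 1)%R by exact/set_mem.
have x0 : vnorm x = 0%R.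
  apply/eqP; move: xout; rewrite x1 andbT -leNgt => x0.
  by rewrite eq_le x0 vnorm_ge0.
rewrite /angular /vdir x0 invr0 dotZl mul0r normr0 powR0//.
by rewrite gt_eqF.
Qed.

Lemma ball_integral_angular_dir a e : vnorm a = 1%R -> vnorm e = 1%R ->
  ball_integral (angular a) = ball_integral (angular e).
Proof.
move=> a1 e1; pose v := vsub a e.
have va : reflect v a = e by apply: reflect_swap; rewrite a1.
rewrite /ball_integral -(ge0_integral_reflect v); last 2 first.
- apply/measurable_EFinP; apply: measurable_funM; last exact: measurable_angular.
  by apply: measurable_indic; exact: measurable_uball.
- by move=> x; rewrite lee_fin mulr_ge0// angular_ge0.
apply: eq_integral => x _; congr (_ * _)%:E.
  rewrite !indicE; congr ((_ : bool)%:R).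
  by apply/idP/idP; rewrite !inE /uball /= -!/(vnorm _) vnorm_reflect.
rewrite /angular -va -[in RHS](dot_reflect v) reflectK.
by rewrite /vdir vnorm_reflect reflect_scale.
Qed.

End Kconst.

Lemma mem_setb (T : Type) (P : T -> bool) (x : T) : (x \in [set y | P y]) = P x.
Proof. by apply/idP/idP; rewrite inE. Qed.

Section powR_integral.
Context {R : realType}.
Local Notation mu := (@lebesgue_measure R).

Lemma continuous_powR (a t : R) : 0 < t -> {for t, continuous (fun x : R => x `^ a)}.
Proof.
move=> t0; apply: differentiable_continuous; apply/derivable1_diffP.
by apply: derivable_powR; rewrite in_itv/= t0.
Qed.

(** Two powers are integrated together because they occur below with coefficients of opposite signs,
    out of reach of linearity for nonnegative integrands. *)
Lemma integral_powR2 (c c' a b u r : R) : 0 < u -> u <= r -> a != 0 -> b != 0 ->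
  (\int[mu]_(t in `[u, r]) (c * t `^ (a - 1) + c' * t `^ (b - 1))%:E =
   (c / a * (r `^ a - u `^ a) + c' / b * (r `^ b - u `^ b))%:E)%E.
Proof.
move=> u0; rewrite le_eqVlt => /predU1P[<-|ur] a0 b0.
  by rewrite set_itv1 integral_set1 !subrr !mulr0 addr0.
pose F t := c / a * t `^ a + c' / b * t `^ b.
have dF (t : R) : 0 < t -> is_derive t (1 : R) F (c * t `^ (a - 1) + c' * t `^ (b - 1)).
  move=> t0.
  have da := is_derive1_powR a t0.
  have db := is_derive1_powR b t0.
  have -> : c * t `^ (a - 1) + c' * t `^ (b - 1) =
     (c / a) *: (a * t `^ (a - 1)) + (c' / b) *: (b * t `^ (b - 1)).
    by rewrite /GRing.scale/=; field; rewrite a0 b0.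
  exact: is_deriveD.
have cF (t : R) : 0 < t -> {for t, continuous F}.
  move=> t0; apply: differentiable_continuous; apply/derivable1_diffP.
  by have [] := dF t t0.
have r0 : 0 < r by exact: lt_trans ur.
rewrite (@continuous_FTC2 _ _ F)//.
- by rewrite -EFinD; congr EFin; rewrite /F; ring.
- apply: continuous_in_subspaceT => t; rewrite inE/= in_itv/= => /andP[ut _].
  have t0 : 0 < t by exact: lt_le_trans ut.
  by apply: cvgD; apply: cvgM; try exact: cvg_cst; exact: continuous_powR.
- split.
  + move=> t; rewrite in_itv/= => /andP[ut _].
    by have [] := dF t (lt_trans u0 ut).
  + exact/cvg_at_right_filter/cF.
  + exact/cvg_at_left_filter/cF.
- move=> t; rewrite in_itv/= => /andP[ut _]; rewrite derive1E.
  by have [_ ->] := dF t (lt_trans u0 ut).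
Qed.

Lemma integral_powR (b u r : R) : 0 < u -> u <= r -> b != 0 ->
  (\int[mu]_(t in `[u, r]) (t `^ (b - 1))%:E = ((r `^ b - u `^ b) / b)%:E)%E.
Proof.
move=> u0 ur b0; have := integral_powR2 0 1 u0 ur b0 b0.
rewrite mul0r mul0r add0r mul1r mulrC => <-.
by apply: eq_integral => t _; rewrite mul0r add0r mul1r.
Qed.

End powR_integral.

(** * Polar coordinates for homogeneous functions on annuli *)

Section annulus.
Context {R : realType} {n : nat}.
Local Notation mu := (@lebesgue_measure R).
Local Open Scope ereal_scope.
Variable g : n.+1.-tuple R -> R.
Hypothesis mg : measurable_fun setT g.
Hypothesis g0 : forall x, (0 <= g x)%R.
Hypothesis g1 : forall x, (g x <= 1)%R.
Hypothesis gZ : forall (c : R) x, (0 < c)%R -> g (vscale c x) = g x.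

Definition annulus (rho r : R) : set (n.+1.-tuple R) :=
  [set x | (rho < vnorm x <= r)%R].

Lemma measurable_annulus rho r : measurable (annulus rho r).
Proof.
rewrite [annulus _ _](_ : _ = [set x | (rho < vnorm x)%R] `&` [set x | (vnorm x <= r)%R]).
  have mv := @measurable_vnormT R n.+1.
  by apply: measurableI; [exact: measurable_ltr|exact: measurable_ler].
by apply/seteqP; split => x /=; rewrite /annulus/= => /andP.
Qed.

Lemma mem_annulus rho r x : (x \in annulus rho r) = (rho < vnorm x <= r)%R.
Proof. exact: mem_setb. Qed.

Lemma ball_integral_fin : ball_integral g \is a fin_num.
Proof.
rewrite ge0_fin_numE; last by apply: integral_ge0 => x _; rewrite lee_fin mulr_ge0.
apply: le_lt_trans (@leb_uball_lty R n.+1).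
have -> : leb R n.+1 (uball R n.+1) = \int[leb R n.+1]_x (\1_(uball R n.+1) x : R)%:E.
  by rewrite integral_indic ?setIT//; exact: measurable_uball.
have mI : measurable_fun setT (\1_(uball R n.+1) : _ -> R).
  by apply: measurable_indic; exact: measurable_uball.
apply: ge0_le_integral => //.
- by move=> x _; rewrite lee_fin mulr_ge0.
- by apply/measurable_EFinP; exact: measurable_funM.
- exact/measurable_EFinP.
- by move=> x _; rewrite lee_fin ler_piMr.
Qed.

Let G := fine (ball_integral g).

(** The dilation x -> t x maps the unit ball onto the ball of radius t and leaves g unchanged. *)
Let integral_ball (t : R) : (0 < t)%R ->
  \int[leb R n.+1]_x (\1_[set x | (vnorm x <= t)%R] x * g x)%:E = (t ^+ n.+1 * G)%:E.
Proof.
move=> t0.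
have t0' : t != 0%R by rewrite gt_eqF.
have mB : measurable [set x : n.+1.-tuple R | (vnorm x <= t)%R].
  by apply: measurable_ler => //; exact: measurable_vnormT.
have mf : measurable_fun setT
    (fun x => (\1_[set x | (vnorm x <= t)%R] x * g x)%:E : \bar R).
  by apply/measurable_EFinP; apply: measurable_funM => //; exact: measurable_indic.
have := ge0_integral_vscale t0' mf.
move=> /(_ (fun x => ltac:(by rewrite lee_fin mulr_ge0))).
rewrite (_ : \int[leb R n.+1]_x _ = ball_integral g); last first.
  apply: eq_integral => x _; rewrite gZ//; congr (_ * _)%:E.
  rewrite !indicE; congr ((_ : bool)%:R); apply/idP/idP; rewrite !inE /= vnormZ gtr0_norm// /uball/= -/(vnorm _).
    by rewrite -ler_pdivlMl// mulVf.
  by rewrite -ler_pdivlMl// mulVf.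
rewrite -(fineK ball_integral_fin) -/G => E.
rewrite EFinM E muleA -EFinM gtr0_norm// -exprMn divff// expr1n mul1e.
by [].
Qed.

Let integral_annulus1 (rho t : R) : (0 < rho)%R -> (rho <= t)%R ->
  \int[leb R n.+1]_x (\1_(annulus rho t) x * g x)%:E =
  ((t ^+ n.+1 - rho ^+ n.+1) * G)%:E.
Proof.
move=> rho0 rt; have t0 : (0 < t)%R by exact: lt_le_trans rt.
have mB s : measurable [set x : n.+1.-tuple R | (vnorm x <= s)%R].
  by apply: measurable_ler => //; exact: measurable_vnormT.
have := integral_ball t0.
rewrite (eq_integral (fun x => (\1_[set x | (vnorm x <= rho)%R] x * g x)%:E +
    (\1_(annulus rho t) x * g x)%:E)); last first.
  move=> x _; rewrite -EFinD -mulrDl; congr (_ * _)%:E.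
  rewrite !indicE mem_annulus !mem_setb ltNge.
  case: (boolP (vnorm x <= rho)%R) => [xr|_] /=; last by rewrite add0r.
  by rewrite (le_trans xr rt) addr0.
rewrite ge0_integralD//; last 4 first.
- by move=> x _; rewrite lee_fin mulr_ge0.
- by apply/measurable_EFinP; apply: measurable_funM => //; exact: measurable_indic.
- by move=> x _; rewrite lee_fin mulr_ge0.
- by apply/measurable_EFinP; apply: measurable_funM => //; apply: measurable_indic; exact: measurable_annulus.
rewrite integral_ball// => E.
have -> : ((t ^+ n.+1 - rho ^+ n.+1) * G)%:E = (t ^+ n.+1 * G)%:E - (rho ^+ n.+1 * G)%:E.
  by rewrite -EFinD mulrBl.
by rewrite -E addeAC subee// add0e.
Qed.

Section radial_weight.
Variables (rho r b : R).
Hypotheses (rho0 : (0 < rho)%R) (rhor : (rho <= r)%R) (b01 : (0 < b < 1)%R).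

Let c : R := (b - n.+1%:R)%R.

Let c_lt0 : (c < 0)%R.
Proof.
rewrite /c subr_lt0; case/andP: b01 => _ b1; apply: (lt_le_trans b1).
by rewrite ler1n.
Qed.

Let powRcN (t : R) : (0 < t)%R -> (t `^ c * t ^+ n.+1 = t `^ b)%R.
Proof.
move=> t0; rewrite -powR_mulrn ?ltW// -powRD; first by rewrite /c subrK.
by rewrite (gt_eqF t0) implybT.
Qed.

Let D : set (n.+1.-tuple R * measurableTypeR R) :=
  [set z | [&& rho <= z.2 <= r, rho < vnorm z.1 & vnorm z.1 <= z.2]%R].

Let mD : measurable D.
Proof.
have m1 : measurable_fun setT (fun z : n.+1.-tuple R * measurableTypeR R => vnorm z.1).
  exact: (measurableT_comp measurable_vnormT).
have m2 : measurable_fun setT (fun z : n.+1.-tuple R * measurableTypeR R => z.2 : R).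
  exact: measurable_snd.
rewrite (_ : D = [set z | (rho <= z.2)%R] `&` [set z | (z.2 <= r)%R] `&`
    ([set z | (rho < vnorm z.1)%R] `&` [set z | (vnorm z.1 <= z.2)%R])).
  apply: measurableI; apply: measurableI; try exact: measurable_ler.
  exact: measurable_ltr.
apply/seteqP; split => z; rewrite /D /=; first by move=> /and3P[/andP[]].
by move=> [[-> ->] [-> ->]].
Qed.

(** The radial weight in layers: as c = b - N < 0, |x|^c is r^c plus -c times the integral of
    t^(c-1) over [|x|, r], with both terms nonnegative. Exchanging the integrals in x and t leaves
    integrals of g over annuli of radii rho and t, which are known by scaling. *)
Let K (z : n.+1.-tuple R * measurableTypeR R) : R :=
  (\1_D z * g z.1 * z.2 `^ (c - 1))%R.

Let K0 z : (0 <= K z)%R.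
Proof. by rewrite /K !mulr_ge0// powR_ge0. Qed.

Let mK : measurable_fun setT (fun z => (K z)%:E).
Proof.
apply/measurable_EFinP; apply: measurable_funM.
  apply: measurable_funM; first exact: measurable_indic.
  exact: (measurableT_comp mg).
by apply: (measurableT_comp (measurable_powR _)).
Qed.

Let K_x x : (\1_(annulus rho r) x * g x * vnorm x `^ c)%:E =
  (r `^ c)%:E * (\1_(annulus rho r) x * g x)%:E + (- c)%:E * \int[mu]_t (K (x, t))%:E.
Proof.
rewrite indicE mem_annulus; case: (boolP (rho < vnorm x <= r)%R) => [/andP[rx xr]|nx].
  have x0 : (0 < vnorm x)%R by exact: lt_trans rx.
  have -> : \int[mu]_t (K (x, t))%:E = (g x * ((r `^ c - vnorm x `^ c) / c))%:E.
    rewrite EFinM -integral_powR//; last by rewrite lt_eqF.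
    rewrite [in RHS]integral_mkcond -ge0_integralZl//; last 3 first.
    - apply/(measurable_restrictT _ (measurable_itv _))/measurable_EFinP.
      by apply: measurable_funTS; exact: measurable_powR.
    - by move=> t _; rewrite patchE; case: ifP => // _; rewrite lee_fin powR_ge0.
    - by rewrite lee_fin.
    apply: eq_integral => t _; rewrite patchE /K indicE mem_setb /=.
    rewrite (_ : (t \in `[vnorm x, r]%classic) = (vnorm x <= t <= r)%R); last first.
      by apply/idP/idP; rewrite inE /= in_itv.
    rewrite rx /=; case: (boolP (vnorm x <= t)%R) => xt; last by rewrite andbF !mul0r mule0.
    rewrite andbT (le_trans (ltW rx) xt)/=.
    by case: ifP => _; rewrite ?mul1r// !mul0r mule0.
  rewrite !mul1r -!EFinM -EFinD; congr EFin.
  by field; rewrite lt_eqF.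
rewrite !mul0r mule0 add0e integral0_eq ?mule0// => t _.
rewrite /K indicE mem_setb /=; case: (boolP [&& _, _ & _]) => [|_]; last by rewrite !mul0r.
move=> /and3P[/andP[_ tr] rx xt].
by move: nx; rewrite rx (le_trans xt tr).
Qed.

Let K_t (t : measurableTypeR R) : \int[leb R n.+1]_x (K (x, t))%:E =
  ((fun t => (G * t `^ (b - 1) + - (rho ^+ n.+1 * G) * t `^ (c - 1))%:E) \_ `[rho, r]) t.
Proof.
rewrite patchE (_ : (t \in `[rho, r]%classic) = (rho <= t <= r)%R); last first.
  by apply/idP/idP; rewrite inE /= in_itv.
case: (boolP (rho <= t <= r)%R) => [/andP[rt tr]|nt]; last first.
  apply: integral0_eq => x _; rewrite /K indicE mem_setb /=.
  by rewrite (negbTE nt) !mul0r.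
have t0 : (0 < t)%R by exact: lt_le_trans rt.
transitivity (\int[leb R n.+1]_x ((t `^ (c - 1))%:E * (\1_(annulus rho t) x * g x)%:E)).
  apply: eq_integral => x _; rewrite /K -EFinM; congr EFin.
  by rewrite mulrC !indicE mem_annulus mem_setb /= rt tr.
rewrite ge0_integralZl//; last 3 first.
- apply/measurable_EFinP; apply: measurable_funM => //.
  by apply: measurable_indic; exact: measurable_annulus.
- by move=> x _; rewrite lee_fin mulr_ge0.
- by rewrite lee_fin powR_ge0.
rewrite integral_annulus1// -EFinM; congr EFin.
have -> : (t `^ (b - 1) = t `^ (c - 1) * t ^+ n.+1)%R.
  rewrite -powR_mulrn ?ltW// -powRD; last by rewrite (gt_eqF t0) implybT.
  by congr powR; rewrite /c; ring.
ring.
Qed.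

(** Used with b = p (1 - s): the factor N / b, which blows up as s -> 1, is the one that 1 - s
    compensates. *)
Lemma integral_annulus :
  \int[leb R n.+1]_x (\1_(annulus rho r) x * g x * vnorm x `^ (b - n.+1%:R))%:E =
  (n.+1%:R / b * G * (r `^ b - rho `^ b))%:E.
Proof.
have /andP[b0 b1] := b01.
have mA : measurable_fun setT (fun x => (\1_(annulus rho r) x * g x)%:E : \bar R).
  apply/measurable_EFinP; apply: measurable_funM => //.
  by apply: measurable_indic; exact: measurable_annulus.
rewrite -/c; under eq_integral do rewrite K_x.
have Nc0 : (0 <= - c)%R by rewrite oppr_ge0 ltW.
have mF : measurable_fun setT (fun x => \int[mu]_t (K (x, t))%:E).
  apply: (@measurable_fun_fubini_tonelli_F _ _ _ _ _ mu (fun z => (K z)%:E)) => //.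
have F0 x : 0 <= \int[mu]_t (K (x, t))%:E.
  by apply: integral_ge0 => t _; rewrite lee_fin.
rewrite ge0_integralD//; first last.
- exact: measurable_funeM.
- by move=> x _; rewrite mule_ge0.
- exact: measurable_funeM.
- by move=> x _; rewrite mule_ge0// lee_fin ?powR_ge0// mulr_ge0.
have -> : \int[leb R n.+1]_x ((r `^ c)%:E * (\1_(annulus rho r) x * g x)%:E) =
    (r `^ c)%:E * \int[leb R n.+1]_x (\1_(annulus rho r) x * g x)%:E.
  rewrite ge0_integralZl//; last by rewrite lee_fin powR_ge0.
  by move=> x _; rewrite lee_fin mulr_ge0.
have -> : \int[leb R n.+1]_x ((- c)%:E * \int[mu]_t (K (x, t))%:E) =
    (- c)%:E * \int[leb R n.+1]_x \int[mu]_t (K (x, t))%:E.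
  by rewrite ge0_integralZl.
rewrite integral_annulus1//.
rewrite (fubini_tonelli (fun z => (K z)%:E))//.
under eq_integral do rewrite K_t.
rewrite -integral_mkcond integral_powR2//; last 2 first.
- by rewrite gt_eqF.
- by rewrite lt_eqF.
rewrite -!EFinM -EFinD; congr EFin.
have r0 : (0 < r)%R by exact: lt_le_trans rhor.
rewrite -(powRcN r0) -(powRcN rho0).
have -> : n.+1%:R = (b - c)%R :> R by rewrite /c opprB addrC subrK.
by field; rewrite gt_eqF//= lt_eqF.
Qed.

End radial_weight.

End annulus.

(** * The energy of a linear function *)

Section energy.
Context {R : realType} {n : nat}.
Local Open Scope ereal_scope.
Variable p : R.
Hypothesis p1 : (1 < p)%R.
Local Notation N := n.+1.
Local Notation Q := (cubeQ R N).
Implicit Types (x y h a : N.-tuple R) (u : N.-tuple R -> R) (s : R).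

Let p0 : (0 < p)%R. Proof. exact: lt_trans p1. Qed.

Let pn0 : p != 0%R. Proof. by rewrite gt_eqF. Qed.

Let I : set (measurableTypeR R) := [set t | (- 2^-1 < t < 2^-1)%R].

Let IE : I = `](- 2^-1)%R, 2^-1%R[%classic.
Proof. by apply/seteqP; split => t; rewrite /I /= in_itv. Qed.

Let mI : measurable I. Proof. by rewrite IE; exact: measurable_itv. Qed.

Lemma measurable_cubeQ : measurable Q.
Proof. exact: (measurable_cube mI). Qed.

Lemma leb_cubeQ : leb R N Q = 1.
Proof.
have lI : lebesgue_measure I = 1.
  rewrite IE lebesgue_measure_itv/= lte_fin.
  have h : (- 2^-1 < 2^-1 :> R)%R by lra.
  by rewrite h -EFinD opprK; congr EFin; field.
by rewrite [LHS](leb_cube N mI) lI -EFin_expe expr1n.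
Qed.

(** The indicators and the restriction of u to Q make this measurable on the whole product when u is
    measurable on Q only, so that Tonelli applies without domains. *)
Definition gagliardo_integrand s u (z : N.-tuple R * N.-tuple R) : R :=
  (\1_Q z.1 * \1_Q z.2 * (`|(u \_ Q) z.1 - (u \_ Q) z.2| `^ p /
    eucl_dist z.1 z.2 `^ (N%:R + s * p)))%R.

Lemma gagliardo_integrand_ge0 s u z : (0 <= gagliardo_integrand s u z)%R.
Proof. by rewrite !mulr_ge0// ?invr_ge0 powR_ge0. Qed.

Lemma measurable_gagliardo_integrand s u : measurable_fun Q u ->
  measurable_fun setT (gagliardo_integrand s u).
Proof.
move=> mu; have mur : measurable_fun setT (u \_ Q).
  exact/(measurable_restrictT _ measurable_cubeQ).
have m1 : measurable_fun setT (@fst (N.-tuple R) (N.-tuple R)) by [].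
have m2 : measurable_fun setT (@snd (N.-tuple R) (N.-tuple R)) by [].
have mQ : measurable_fun setT (\1_Q : N.-tuple R -> R).
  by apply: measurable_indic; exact: measurable_cubeQ.
apply: measurable_funM.
  by apply: measurable_funM; exact: (measurableT_comp mQ).
apply: measurable_funM.
  apply: (measurableT_comp (measurable_powR p)); apply: measurableT_comp => //.
  by apply: measurable_funB; exact: (measurableT_comp mur).
apply: (measurableT_comp (@measurable_inv R)).
apply: (measurableT_comp (measurable_powR _)).
exact: measurable_eucl_dist.
Qed.

Definition energy s u : \bar R :=
  \int[leb R N]_x \int[leb R N]_y (gagliardo_integrand s u (x, y))%:E.

Lemma gagliardoE s u : gagliardo p s u `^ p = energy s u.
Proof.
rewrite /gagliardo -poweRrM mulVf ?gt_eqF// poweRe1; last first.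
  apply: integral_ge0 => x _; apply: integral_ge0 => y _.
  by rewrite lee_fin divr_ge0// powR_ge0.
rewrite integral_mkcond; apply: eq_integral => x _; rewrite patchE.
case: ifPn => [xQ|xQ]; last first.
  rewrite integral0_eq// => y _.
  by rewrite /gagliardo_integrand indicE (negbTE xQ) !mul0r.
rewrite integral_mkcond; apply: eq_integral => y _; rewrite patchE.
rewrite /gagliardo_integrand !indicE xQ mul1r !patchE xQ.
by case: ifPn => yQ; rewrite ?mul1r// mul0r.
Qed.

(** The quotient |<a, h>|^p / |h|^p is 0-homogeneous, and the remaining power of |h| is the radial
    weight with b = p (1 - s). For h = 0 both sides are 0 because 0^p = 0. *)
Lemma kernelE a h s :
  (`|dot a h| `^ p / vnorm h `^ (N%:R + s * p) =
   angular p a h * vnorm h `^ (p * (1 - s) - N%:R))%R.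
Proof.
have [h0|h0] := eqVneq (vnorm h) 0%R.
  rewrite /angular /vdir h0 invr0 dotZl mul0r normr0 (powR0 pn0) [RHS]mul0r.
  suff -> : dot a h = 0%R by rewrite normr0 (powR0 pn0) mul0r.
  by apply/eqP; rewrite -normr_le0 (le_trans (Cauchy_Schwarz _ _))// h0 mulr0.
have {}h0 : (0 < vnorm h)%R by rewrite lt_neqAle eq_sym h0 vnorm_ge0.
have -> : (`|dot a h| = vnorm h * `|dot (vdir h) a|)%R.
  rewrite /vdir dotZl normrM gtr0_norm ?invr_gt0// mulrA divff ?gt_eqF// mul1r.
  by rewrite dotC.
rewrite powRM ?vnorm_ge0// -/(angular p a h) mulrAC mulrC; congr (_ * _)%R.
rewrite -powRB; last by rewrite (gt_eqF h0) implybT.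
by congr powR; ring.
Qed.

Variable a : N.-tuple R.
Hypothesis a1 : vnorm a = 1%R.

Let Gamma := fine (ball_integral (angular p a)).

Lemma Kconst_fin : Kconst p a = (p^-1 * N%:R * Gamma)%:E.
Proof.
rewrite KconstE// /Gamma !EFinM fineK ?muleA//.
by apply: ball_integral_fin; [exact: measurable_angular|exact: angular_ge0|
  move=> x; exact: angular_le1].
Qed.

Let mweight (b : R) :
  measurable_fun setT (fun h => (angular p a h * vnorm h `^ (b - N%:R))%R).
Proof.
apply: measurable_funM; first exact: measurable_angular.
exact: measurable_powR_vnorm.
Qed.

Let weight0 (b : R) h : (0 <= angular p a h * vnorm h `^ (b - N%:R))%R.
Proof. by rewrite mulr_ge0 ?angular_ge0// powR_ge0. Qed.

Lemma integral_angular_annulus (rho r b : R) : (0 < rho)%R -> (rho <= r)%R ->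
  (0 < b < 1)%R ->
  \int[leb R N]_h (\1_(annulus rho r) h * (angular p a h * vnorm h `^ (b - N%:R)))%:E =
  (N%:R / b * Gamma * (r `^ b - rho `^ b))%:E.
Proof.
move=> rho0 rr b01; rewrite /Gamma.
rewrite -(integral_annulus _ _ _ _ rho0 rr b01).
- by apply: eq_integral => h _; rewrite mulrA.
- exact: measurable_angular.
- exact: angular_ge0.
- by move=> x; exact: angular_le1.
- by move=> c x; exact: angular_scale.
Qed.

Lemma integral_angular_ball_le (r b : R) : (0 < r)%R -> (0 < b < 1)%R ->
  \int[leb R N]_h (\1_[set h | vnorm h <= r]%R h *
     (angular p a h * vnorm h `^ (b - N%:R)))%:E <=
  (N%:R / b * Gamma * r `^ b)%:E.
Proof.
move=> r0 b01; pose f h := (angular p a h * vnorm h `^ (b - N%:R))%:E.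
(* Annuli with inner radii tending to 0 exhaust the punctured ball; at the origin the integrand is
   0. *)
pose F (i : nat) : set (N.-tuple R) := annulus (r / i.+1%:R) r.
have ndF : nondecreasing_seq F.
  move=> i j ij; apply/subsetPset => h; rewrite /F /annulus /= => /andP[h1 ->].
  rewrite andbT (le_lt_trans _ h1)// ler_pM2l// lef_pV2 ?posrE//.
  by rewrite ler_nat.
have cF := @ge0_nondecreasing_set_cvg_integral _ _ R F f (leb R N) ndF.
have mF i : measurable (F i) by exact: measurable_annulus.
have mf : measurable_fun setT f by apply/measurable_EFinP; exact: mweight.
have {}cF := cF mF (fun i => measurable_funTS mf) (fun i x _ => weight0 b x).
have -> : \int[leb R N]_h (\1_[set h | vnorm h <= r]%R h *
     (angular p a h * vnorm h `^ (b - N%:R)))%:E = \int[leb R N]_(h in \bigcup_i F i) f h.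
  rewrite [RHS]integral_mkcond; apply: eq_integral => h _; rewrite patchE indicE mem_setb.
  have [h0|h0] := eqVneq (vnorm h) 0%R.
    rewrite /f /angular /vdir h0 invr0 dotZl mul0r normr0 (powR0 pn0) mul0r mulr0.
    by case: ifP.
  have {}h0 : (0 < vnorm h)%R by rewrite lt_neqAle eq_sym h0 vnorm_ge0.
  suff -> : (h \in \bigcup_i F i) = (vnorm h <= r)%R.
    by case: ifP; rewrite ?mul1r ?mul0r.
  apply/idP/idP => [|hr]; rewrite inE.
    by move=> [i _]; rewrite /F /annulus/= => /andP[].
  have rh : (0 <= r / vnorm h)%R by rewrite divr_ge0// ltW.
  exists (Num.bound (r / vnorm h)) => //; rewrite /F /annulus/= hr andbT.
  rewrite ltr_pdivrMr// mulrC -ltr_pdivrMr//; apply: lt_trans (archi_boundP rh) _.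
  by rewrite ltr_nat.
rewrite -(cvg_lim _ cF)//; apply: lime_le; first by apply/cvg_ex; eexists; exact: cF.
apply: nearW => i; rewrite integral_mkcond.
have ri : (0 < r / i.+1%:R)%R by rewrite divr_gt0.
have rir : (r / i.+1%:R <= r)%R by rewrite ler_pdivrMr// -[leLHS]mulr1 ler_pM2l// ler1n.
rewrite (_ : \int[leb R N]_x _ = (N%:R / b * Gamma * (r `^ b - (r / i.+1%:R) `^ b))%:E).
  have [b0 _] := andP b01.
  rewrite lee_fin ler_wpM2l ?lerBlDr ?lerDl ?powR_ge0//.
  rewrite mulr_ge0//; first by rewrite divr_ge0// ltW.
  by apply: fine_ball_integral_ge0 => x; exact: angular_ge0.
rewrite -integral_angular_annulus//; apply: eq_integral => h _.
by rewrite patchE indicE; case: ifP => _; rewrite ?mul1r ?mul0r.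
Qed.

End energy.

Section upper_bound.
Context {R : realType} {n : nat}.
Local Open Scope ereal_scope.
Variable p : R.
Hypothesis p1 : (1 < p)%R.
Local Notation N := n.+1.
Local Notation Q := (cubeQ R N).
Implicit Types (x y h a : N.-tuple R) (u : N.-tuple R -> R) (s : R).

Let p0 : (0 < p)%R. Proof. exact: lt_trans p1. Qed.

Lemma eucl_dist_cubeQ x y : Q x -> Q y -> (eucl_dist x y <= Num.sqrt N%:R)%R.
Proof.
move=> Qx Qy; rewrite eucl_distE -[leRHS]mulr1; apply: vnorm_le_sup => // i.
by rewrite tnthE ler_norml; have := Qx i; have := Qy i; lra.
Qed.

Lemma near_left1_mul : \forall s \near 1^'-, (0 < p * (1 - s) < 1)%R.
Proof.
have h : (1 - p^-1 < 1)%R by rewrite gtrBl invr_gt0.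
near=> s.
have s1 : (s < 1)%R by near: s; exact: nbhs_left_lt.
have sp : (1 - p^-1 < s)%R by near: s; exact: nbhs_left_gt.
rewrite mulr_gt0 ?subr_gt0//= -ltr_pdivlMl// mulr1; lra.
Unshelve. all: by end_near. Qed.

Lemma powR_left1_cvg (r : R) : (0 < r)%R ->
  (r `^ (p * (1 - s)))%R @[s --> 1^'-] --> (1 : R)%R.
Proof.
move=> r0; pose f (s : R) := (expR (p * (1 - s) * ln r))%R.
have -> : (fun s : R => r `^ (p * (1 - s)))%R = f.
  by apply/funext => s; rewrite /f /powR gt_eqF.
have f1 : f 1%R = 1%R by rewrite /f subrr mulr0 mul0r expR0.
have cg : {for (1 : R)%R, continuous (fun s : R => (p * (1 - s) * ln r)%R)}.
  apply: cvgM; last exact: cvg_cst.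
  by apply: cvgM; [exact: cvg_cst|apply: cvgB; [exact: cvg_cst|exact: cvg_id]].
have cf : {for (1 : R)%R, continuous f}.
  by apply: (continuous_comp cg); exact: continuous_expR.
have := cvg_at_left_filter cf.
by rewrite f1.
Qed.

Variable a : N.-tuple R.
Hypothesis a1 : vnorm a = 1%R.

(** For x in Q, every y in Q lies within sqrt N of x. The inner integral is therefore at most the
    one over the ball of radius sqrt N, whatever x is, and Q has volume 1. *)
Lemma energy_linear_le s : (0 < p * (1 - s) < 1)%R ->
  energy p s (dot a) <= (N%:R / (p * (1 - s)) *
    fine (ball_integral (angular p a)) * Num.sqrt N%:R `^ (p * (1 - s)))%:E.
Proof.
move=> b01; set b := (p * (1 - s))%R in b01 *.
pose r : R := Num.sqrt N%:R.
have r0 : (0 < r)%R by rewrite sqrtr_gt0.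
pose phi h := (\1_[set h | vnorm h <= r]%R h * (angular p a h * vnorm h `^ (b - N%:R)))%R.
have phi0 h : (0 <= phi h)%R by rewrite /phi !mulr_ge0// ?angular_ge0 ?powR_ge0.
have mphi : measurable_fun setT phi.
  apply: measurable_funM.
    apply: measurable_indic; apply: measurable_ler => //; exact: measurable_vnormT.
  apply: measurable_funM; first exact: measurable_angular.
  exact: measurable_powR_vnorm.
have ma := measurable_dotr a.
have mg := measurable_gagliardo_integrand p s (measurable_funTS ma : measurable_fun Q (dot a)).
have g0 := gagliardo_integrand_ge0 p s (dot a).
have Ephi : \int[leb R N]_h (phi h)%:E <=
    (N%:R / b * fine (ball_integral (angular p a)) * r `^ b)%:E.
  exact: integral_angular_ball_le.
have inner x : \int[leb R N]_y (gagliardo_integrand p s (dot a) (x, y))%:E <=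
    (\1_Q x)%:E * \int[leb R N]_h (phi h)%:E.
  rewrite -(ge0_integral_vsub x (f := fun h => (phi h)%:E)); last 2 first.
  - exact/measurable_EFinP.
  - by move=> h; rewrite lee_fin.
  have mphix : measurable_fun setT (fun y => (phi (vsub x y))%:E : \bar R).
    apply/measurable_EFinP; apply: (measurableT_comp mphi).
    exact: measurable_vsubr.
  rewrite -ge0_integralZl//; last by move=> y _; rewrite lee_fin.
  apply: ge0_le_integral => //.
  - by move=> y _; rewrite lee_fin.
  - by apply/measurable_EFinP; exact: (measurableT_comp mg).
  - exact: measurable_funeM.
  move=> y _; rewrite -EFinM lee_fin /gagliardo_integrand /= -mulrA.
  rewrite indicE; case: (boolP (x \in Q)) => [xQ|_]; last by rewrite !mul0r.
  rewrite !mul1r indicE; case: (boolP (y \in Q)) => [yQ|_]; last by rewrite mul0r.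
  rewrite mul1r !patchE xQ yQ -dotBr eucl_distE kernelE// /phi indicE mem_setb.
  by rewrite -eucl_distE eucl_dist_cubeQ ?mul1r//; exact/set_mem.
apply: (@le_trans _ _ (\int[leb R N]_x ((\1_Q x)%:E * \int[leb R N]_h (phi h)%:E))).
  apply: ge0_le_integral => //.
  - by move=> x _; apply: integral_ge0 => y _; rewrite lee_fin.
  - apply: (@measurable_fun_fubini_tonelli_F _ _ _ _ _ (leb R N)
      (fun z => (gagliardo_integrand p s (dot a) z)%:E)) => //.
    exact/measurable_EFinP.
  - apply: emeasurable_funM => //; apply/measurable_EFinP.
    by apply: measurable_indic; exact: measurable_cubeQ.
have mQ : measurable_fun setT (fun x : N.-tuple R => (\1_Q x)%:E : \bar R).
  by apply/measurable_EFinP; apply: measurable_indic; exact: measurable_cubeQ.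
rewrite ge0_integralZr//; last by apply: integral_ge0 => h _; rewrite lee_fin.
rewrite integral_indic//; last exact: measurable_cubeQ.
by rewrite setIT [X in X * _]leb_cubeQ mul1e.
Qed.

Lemma LpQ_linear : LpQ p (dot a).
Proof.
have ma := measurable_dotr a.
split; first exact: measurable_funTS.
have pn0 : p != 0%R by rewrite gt_eqF.
apply: (@lty_poweRy _ _ p) => //; rewrite powR_Lnorm//.
pose c : R := (Num.sqrt N%:R * 1)%R.
apply: (@le_lt_trans _ _ (\int[leb R N]_x ((c `^ p)%:E * (\1_Q x)%:E))).
  apply: ge0_le_integral => //.
  - by move=> x _; exact: poweR_ge0.
  - apply: (measurableT_comp (measurable_poweR p)); apply: measurableT_comp => //.
    by apply/measurable_EFinP/(measurable_restrictT _ measurable_cubeQ); exact: measurable_funTS.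
  - apply: measurable_funeM; apply/measurable_EFinP.
    by apply: measurable_indic; exact: measurable_cubeQ.
  move=> x _ /=; rewrite patchE indicE; case: ifPn => xQ.
    rewrite mule1 lee_fin.
    have h : (`|dot a x| <= c)%R.
      apply: le_trans (Cauchy_Schwarz _ _) _; rewrite a1 mul1r.
      apply: vnorm_le_sup => // i; move/set_mem : xQ => /(_ i).
      by rewrite ler_norml; lra.
    have c0 : (0 <= c)%R by rewrite /c mulr1 sqrtr_ge0.
    by have := ge0_ler_powR (ltW p0) (_ : _ \in Num.nneg) (_ : _ \in Num.nneg) h;
      apply; rewrite nnegrE.
  by rewrite normr0 powR0// mule0.
rewrite ge0_integralZl//; last 2 first.
- by apply/measurable_EFinP; apply: measurable_indic; exact: measurable_cubeQ.
- by rewrite lee_fin powR_ge0.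
rewrite integral_indic//; last exact: measurable_cubeQ.
by rewrite setIT [X in _ * X]leb_cubeQ mule1 ltry.
Qed.

Lemma Theta_le_Kconst : Theta p a <= Kconst p a.
Proof.
have pn0 : p != 0%R by rewrite gt_eqF.
apply: (@le_trans _ _ (limf_einf (fun s : R =>
    (1 - s)%:E * gagliardo p s (dot a) `^ p) 1^'-)).
  apply: ereal_inf_lbound; exists (fun=> dot a) => //; split.
    by move=> s _; exact: LpQ_linear.
  rewrite (_ : (fun s : R => _) = cst 0); first exact: cvg_cst.
  apply/funext => s; rewrite /LpQ_norm (_ : EFin \o _ = cst 0) ?Lnorm0//.
  by apply/funext => x /=; rewrite patchE; case: ifP => // _; rewrite subrr.
rewrite limf_einfE; apply: ge_ereal_sup => _ [V V1 <-].
rewrite Kconst_fin//; set G := fine _; apply/lee_addgt0Pr => e e0.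
pose k : R := (p^-1 * N%:R * G)%R.
have ck : (k * Num.sqrt N%:R `^ (p * (1 - s)))%R @[s --> 1^'-] --> (k * 1)%R.
  by apply: cvgM; [exact: cvg_cst|apply: powR_left1_cvg; rewrite sqrtr_gt0].
(* The infimum over V is at most its value at any one point; a point of V close enough to 1 is
   chosen. *)
have /filter_ex[s [Vs [b01 ks]]] : \forall s \near 1^'-, V s /\
   ((0 < p * (1 - s) < 1) /\ (k * Num.sqrt N%:R `^ (p * (1 - s)) < k + e))%R.
  apply: filterI; first exact: V1.
  apply: filterI; first exact: near_left1_mul.
  by apply: (cvgr_lt _ ck); rewrite mulr1 ltrDl.
apply: (@le_trans _ _ ((1 - s)%:E * gagliardo p s (dot a) `^ p)).
  by apply: ereal_inf_lbound; exists s.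
have s1 : (0 < 1 - s)%R by have /andP[+ _] := b01; rewrite pmulr_rgt0.
rewrite gagliardoE//; apply: (@le_trans _ _ ((1 - s)%:E * (N%:R / (p * (1 - s)) * G *
    Num.sqrt N%:R `^ (p * (1 - s)))%:E)).
  by apply: lee_wpmul2l; [rewrite lee_fin ltW|exact: energy_linear_le].
rewrite -EFinM -EFinD lee_fin; apply: le_trans (ltW ks).
rewrite le_eqVlt; apply/orP; left; apply/eqP; rewrite /k.
by field; rewrite !gt_eqF.
Qed.

End upper_bound.

(** * The lower bound for the energy *)

Section convexity.
Context {R : realType}.
Variable p : R.
Hypothesis p1 : 1 < p.

Let p0 : 0 < p. Proof. exact: lt_trans p1. Qed.

(** The positive part of the derivative of |.|^p. Keeping it apart from the negative part is what
    makes the kernels below nonnegative. *)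
Definition pos_pow (c : R) : R := p * Num.max c 0 `^ (p - 1).

Lemma pos_pow_ge0 c : 0 <= pos_pow c.
Proof. by rewrite mulr_ge0 ?powR_ge0// ltW. Qed.

(* The tangent line of |.|^p at c, whose slope is pos_pow c - pos_pow (- c). *)
Lemma powR_tangent (c t : R) :
  `|c| `^ p + (pos_pow c - pos_pow (- c)) * (t - c) <= `|t| `^ p.
Proof.
have pp0 : 0 < p - 1 by rewrite subr_gt0.
have pos0 r : r <= 0 -> pos_pow r = 0.
  by move=> r0; rewrite /pos_pow max_r// powR0 ?mulr0// gt_eqF.
wlog c0 : c t / 0 <= c => [H|].
  have [/H//|c0] := leP 0 c.
  have := H (- c) (- t); rewrite oppr_ge0 !normrN opprK => /(_ (ltW c0)).
  rewrite (_ : _ * (- t + c) = (pos_pow c - pos_pow (- c)) * (t - c))//.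
  by ring.
rewrite (pos0 (- c)) ?oppr_le0// subr0 ger0_norm// /pos_pow max_l//.
have cc : c * c `^ (p - 1) = c `^ p by exact: mulr_powRB1.
have pq : p^-1 + (p / (p - 1))^-1 = 1.
  by rewrite invf_div; field; rewrite gt_eqF.
(* The tangent inequality at c >= 0 amounts to p t c^(p-1) <= |t|^p + (p - 1) c^p, which is Young's
   inequality with exponents p and p / (p - 1). *)
have young := conjugate_powR (normr_ge0 t) (powR_ge0 c (p - 1)) p0
  (divr_gt0 p0 pp0) pq.
have cp : (c `^ (p - 1)) `^ (p / (p - 1)) = c `^ p.
  by rewrite -powRrM mulrC divfK// gt_eqF.
rewrite cp invf_div in young.
have h1 : t * c `^ (p - 1) <= `|t| * c `^ (p - 1).
  by rewrite ler_wpM2r ?powR_ge0// ler_norm.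
have h2 : p * (`|t| * c `^ (p - 1)) <= `|t| `^ p + (p - 1) * c `^ p.
  have := ler_wpM2l (ltW p0) young.
  rewrite (_ : p * (_ + _) = `|t| `^ p + (p - 1) * c `^ p)//.
  by field; rewrite gt_eqF.
have h3 := ler_wpM2l (ltW p0) h1.
rewrite (_ : _ + _ = p * (t * c `^ (p - 1)) - (p - 1) * c `^ p).
  by move: h2 h3; lra.
by rewrite -cc; ring.
Qed.

End convexity.

(** * Cancellation of the odd terms, with nonnegative integrands *)

Section bilinear.
Context {R : realType} {n : nat}.
Local Open Scope ereal_scope.
Local Notation N := n.+1.
Local Notation leb := (lebesgue_tuple R N).
Implicit Types (x y h : N.-tuple R).

Variables eta m : N.-tuple R -> R.
Variables L B : R.
Hypothesis meta : measurable_fun setT eta.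
Hypothesis eta0 : forall x, (0 <= eta x)%R.
Hypothesis eta1 : forall x, (eta x <= 1)%R.
Hypothesis L0 : (0 <= L)%R.
Hypothesis etaL : forall x y, (eta x <= eta y + L * eucl_dist x y)%R.
Hypothesis measurable_m : measurable_fun setT m.
Hypothesis m0 : forall h, (0 <= m h)%R.
Hypothesis integral_m_fin : \int[leb]_h (m h)%:E < +oo.
Hypothesis integral_m1 : \int[leb]_h (vnorm h * m h)%:E <= B%:E.

Let B0 : (0 <= B)%R.
Proof.
rewrite -lee_fin; apply: le_trans integral_m1.
by apply: integral_ge0 => h _; rewrite lee_fin mulr_ge0// vnorm_ge0.
Qed.

Let M := \int[leb]_h (m h)%:E.

Let M0 : 0 <= M. Proof. by apply: integral_ge0 => h _; rewrite lee_fin. Qed.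

Let Mfin : M \is a fin_num. Proof. by rewrite ge0_fin_numE. Qed.

Let mvsubr x : measurable_fun setT (fun y => vsub x y).
Proof. exact: measurable_vsubr. Qed.

Let mvsubl x : measurable_fun setT (fun y => vsub y x).
Proof. exact: measurable_vsubl. Qed.

Let mEm : measurable_fun setT (fun h => (m h)%:E : \bar R).
Proof. exact/measurable_EFinP. Qed.

Let Em0 h : 0 <= (m h)%:E.
Proof. by rewrite lee_fin. Qed.

Lemma integral_vsubl (f : N.-tuple R -> \bar R) x : measurable_fun setT f ->
  (forall y, 0 <= f y) -> \int[leb]_y f (vsub y x) = \int[leb]_y f y.
Proof.
move=> mf f0; rewrite -[RHS](ge0_integral_vadd (vscale (-1) x) mf f0).
apply: eq_integral => y _; congr f.
by apply: eq_from_tnth => i; rewrite !tnthE; ring.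
Qed.

Let m1 : measurable_fun setT (@fst (N.-tuple R) (N.-tuple R)). Proof. by []. Qed.
Let m2 : measurable_fun setT (@snd (N.-tuple R) (N.-tuple R)). Proof. by []. Qed.

(** Here f chooses between the differences x - y and y - x, and g the point x or y at which v is
    evaluated. With v the positive or the negative part of w, the eight combinations are the terms
    linear in w in the tangent inequality. *)
Definition bilinear (f g : N.-tuple R * N.-tuple R -> N.-tuple R)
    (v : N.-tuple R -> R) (z : N.-tuple R * N.-tuple R) : R :=
  (eta z.1 * m (f z) * v (g z))%R.

Let dif (z : N.-tuple R * N.-tuple R) := vsub z.1 z.2.
Let rdif (z : N.-tuple R * N.-tuple R) := vsub z.2 z.1.

Let mdif : measurable_fun setT dif. Proof. exact: measurable_vsub. Qed.
Let mrdif : measurable_fun setT rdif. Proof. exact: measurable_vsub. Qed.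

Section one_function.
Variable v : N.-tuple R -> R.
Hypothesis mv : measurable_fun setT v.
Hypothesis v0 : forall x, (0 <= v x)%R.

Let mEv : measurable_fun setT (fun x => (v x)%:E : \bar R).
Proof. exact/measurable_EFinP. Qed.

Let int f g := \int[leb \x leb]_z (bilinear f g v z)%:E.

Lemma bilinear_ge0 f g z : (0 <= bilinear f g v z)%R.
Proof. by rewrite !mulr_ge0. Qed.

Lemma measurable_bilinear f g : measurable_fun setT f -> measurable_fun setT g ->
  measurable_fun setT (fun z => (bilinear f g v z)%:E : \bar R).
Proof.
move=> mf mg; apply/measurable_EFinP; apply: measurable_funM; last first.
  exact: (measurableT_comp mv).
apply: measurable_funM; first exact: (measurableT_comp meta).
exact: (measurableT_comp measurable_m).
Qed.

Let tonelli1 f g : measurable_fun setT f -> measurable_fun setT g ->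
  int f g = \int[leb]_x \int[leb]_y (bilinear f g v (x, y))%:E.
Proof.
move=> mf mg; rewrite /int fubini_tonelli1//; first exact: measurable_bilinear.
by move=> z; rewrite lee_fin bilinear_ge0.
Qed.

Let tonelli2 f g : measurable_fun setT f -> measurable_fun setT g ->
  int f g = \int[leb]_y \int[leb]_x (bilinear f g v (x, y))%:E.
Proof.
move=> mf mg; rewrite /int fubini_tonelli2//; first exact: measurable_bilinear.
by move=> z; rewrite lee_fin bilinear_ge0.
Qed.

Let inner (f : N.-tuple R -> N.-tuple R) c : measurable_fun setT f -> (0 <= c)%R ->
  \int[leb]_y (m (f y) * c)%:E = c%:E * \int[leb]_y (m (f y))%:E.
Proof.
move=> mf c0; rewrite -ge0_integralZl//; last exact: (measurableT_comp mEm mf).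
by apply: eq_integral => y _; rewrite -EFinM mulrC.
Qed.

Let bilinear_dif1 : int dif fst = \int[leb]_x (M * (eta x * v x)%:E).
Proof.
apply: etrans (tonelli1 mdif m1) _; apply: eq_integral => x _; rewrite muleC.
have -> : M = \int[leb]_y (m (vsub x y))%:E.
  exact: (esym (ge0_integral_vsub x mEm Em0)).
rewrite -inner//; last by rewrite mulr_ge0.
by apply: eq_integral => y _; rewrite /bilinear mulrCA mulrA.
Qed.

Let bilinear_rdif1 : int rdif fst = \int[leb]_x (M * (eta x * v x)%:E).
Proof.
apply: etrans (tonelli1 mrdif m1) _; apply: eq_integral => x _; rewrite muleC.
have -> : M = \int[leb]_y (m (vsub y x))%:E.
  exact: (esym (integral_vsubl x mEm Em0)).
rewrite -inner//; last by rewrite mulr_ge0.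
by apply: eq_integral => y _; rewrite /bilinear mulrCA mulrA.
Qed.

(** When v is evaluated at x, integration in y sees the full mass [M] of m for either sign of the
    difference. *)
Lemma integral_bilinear_sym : int dif fst = int rdif fst.
Proof. by rewrite bilinear_dif1 bilinear_rdif1. Qed.

Hypothesis vfin : \int[leb]_x (v x)%:E < +oo.

Let Mvfin : \int[leb]_x (M * (v x)%:E) < +oo.
Proof.
rewrite ge0_integralZl//; last by move=> x _; rewrite lee_fin.
by apply: lte_mul_pinfty.
Qed.

Lemma integral_bilinear_fst_fin : int dif fst \is a fin_num.
Proof.
rewrite ge0_fin_numE; last first.
  by apply: integral_ge0 => z _; rewrite lee_fin bilinear_ge0.
rewrite bilinear_dif1; apply: le_lt_trans Mvfin.
apply: ge0_le_integral => //.
- by move=> x _; rewrite mule_ge0// lee_fin mulr_ge0.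
- by apply: measurable_funeM; apply/measurable_EFinP; exact: measurable_funM.
- exact: measurable_funeM.
by move=> x _; apply: lee_wpmul2l => //; rewrite lee_fin ler_piMl.
Qed.

Let snd_fin f : measurable_fun setT f ->
  (forall y, \int[leb]_x (m (f (x, y)))%:E = M) -> int f snd \is a fin_num.
Proof.
move=> mf fM; rewrite ge0_fin_numE; last first.
  by apply: integral_ge0 => z _; rewrite lee_fin bilinear_ge0.
rewrite tonelli2//; apply: le_lt_trans Mvfin.
apply: ge0_le_integral => //.
- by move=> y _; apply: integral_ge0 => x _; rewrite lee_fin bilinear_ge0.
- apply: (@measurable_fun_fubini_tonelli_G _ _ _ _ _ leb
    (fun z => (bilinear f snd v z)%:E)); last first.
    by move=> z; rewrite lee_fin bilinear_ge0.
  exact: measurable_bilinear.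
- exact: measurable_funeM.
have mfy y : measurable_fun setT (fun x => f (x, y)).
  by apply: (measurableT_comp mf); exact: measurable_fun_pair.
move=> y _; rewrite muleC -(fM y) -inner//; apply: ge0_le_integral => //.
- by move=> x _; rewrite lee_fin bilinear_ge0.
- have := measurable_bilinear mf m2 => /measurable_EFinP mb.
  by apply/measurable_EFinP; apply: (measurableT_comp mb); exact: measurable_fun_pair.
- apply/measurable_EFinP; apply: measurable_funM => //.
  exact: (measurableT_comp measurable_m (mfy y)).
by move=> x _; rewrite lee_fin; apply: ler_wpM2r => //; rewrite ler_piMl.
Qed.

Lemma integral_bilinear_snd_fin :
  int dif snd \is a fin_num /\ int rdif snd \is a fin_num.
Proof.
split; apply: snd_fin => // y.
- exact: (integral_vsubl y mEm Em0).
- exact: (ge0_integral_vsub y mEm Em0).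
Qed.

(** The terms with v evaluated at y, after the substitution h = x - y for e = 1 and h = y - x for e
    = -1. *)
Let conv (e : R) := \int[leb]_y \int[leb]_h (eta (vadd y (vscale e h)) * m h * v y)%:E.

Let conv_fun_ge0 e y h : 0 <= (eta (vadd y (vscale e h)) * m h * v y)%:E.
Proof. by rewrite lee_fin !mulr_ge0. Qed.

Let measurable_conv_fun e y :
  measurable_fun setT (fun h => (eta (vadd y (vscale e h)) * m h * v y)%:E : \bar R).
Proof.
apply/measurable_EFinP; apply: measurable_funM => //; apply: measurable_funM => //.
by apply: (measurableT_comp meta); exact: measurable_affine.
Qed.

Let dif_conv : int dif snd = conv 1.
Proof.
apply: etrans (tonelli2 mdif m2) _; apply: eq_integral => y _.
rewrite -[RHS](integral_vsubl y (measurable_conv_fun _ _) (conv_fun_ge0 _ _)).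
apply: eq_integral => x _; congr (eta _ * _ * _)%:E.
by apply: eq_from_tnth => i; rewrite !tnthE; ring.
Qed.

Let rdif_conv : int rdif snd = conv (-1).
Proof.
apply: etrans (tonelli2 mrdif m2) _; apply: eq_integral => y _.
rewrite -[RHS](ge0_integral_vsub y (measurable_conv_fun _ _) (conv_fun_ge0 _ _)).
apply: eq_integral => x _; congr (eta _ * _ * _)%:E.
by apply: eq_from_tnth => i; rewrite !tnthE; ring.
Qed.

(* eta (y + h) and eta (y - h) differ by at most 2 L |h|, which compensates the
   singularity of m at 0. *)
Let conv_le (e : R) (W : R) : (e = 1 \/ e = -1)%R -> (0 <= W)%R ->
  \int[leb]_x (v x)%:E <= W%:E -> conv e <= conv (- e) + (2 * L * B * W)%:E.
Proof.
move=> e1 W0 vW.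
pose F (c : R) (z : N.-tuple R * N.-tuple R) :=
  (eta (vadd z.1 (vscale c z.2)) * m z.2 * v z.1)%:E : \bar R.
pose G (z : N.-tuple R * N.-tuple R) :=
  (v z.1 * (2 * L * (vnorm z.2 * m z.2)))%:E : \bar R.
have mF c : measurable_fun setT (F c).
  apply/measurable_EFinP; apply: measurable_funM; last exact: (measurableT_comp mv).
  apply: measurable_funM; last exact: (measurableT_comp measurable_m).
  apply: (measurableT_comp meta); apply: measurable_vadd => //.
  by apply: measurable_vscale => //; exact: measurable_cst.
have mvm : measurable_fun setT (fun h => vnorm h * m h)%R.
  by apply: measurable_funM => //; exact: measurable_vnormT.
have mG : measurable_fun setT G.
  apply/measurable_EFinP; apply: measurable_funM; first exact: (measurableT_comp mv).
  by apply: measurable_funM => //; exact: (measurableT_comp mvm).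
have F0 c z : 0 <= F c z by rewrite lee_fin !mulr_ge0.
have G0 z : 0 <= G z by rewrite lee_fin !mulr_ge0// vnorm_ge0.
have convE c : conv c = \int[leb \x leb]_z F c z.
  exact: (esym (fubini_tonelli1 _ (mF c) (F0 c))).
rewrite !convE; apply: (@le_trans _ _ (\int[leb \x leb]_z (F (- e)%R z + G z))).
  apply: ge0_le_integral => //; first by apply: emeasurable_funD; [exact: mF|exact: mG].
  move=> [y h] _; rewrite /F /G /= -EFinD lee_fin.
  have := etaL (vadd y (vscale e h)) (vadd y (vscale (- e) h)).
  have -> : eucl_dist (vadd y (vscale e h)) (vadd y (vscale (- e) h)) = (2 * vnorm h)%R.
    rewrite eucl_distE (_ : vsub _ _ = vscale (2 * e) h).
      by rewrite vnormZ; case: e1 => ->; rewrite ?mulr1 ?mulrN1 ?normrN ger0_norm.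
    by apply: eq_from_tnth => i; rewrite !tnthE; ring.
  move: (eta _) (eta _) => e' e'' le_e.
  have := ler_wpM2r (mulr_ge0 (m0 h) (v0 y)) le_e.
  rewrite (mulrA e'') => le_mv; apply: (le_trans le_mv).
  by rewrite le_eqVlt; apply/orP; left; apply/eqP; ring.
rewrite ge0_integralD//.
apply: leeD2l.
have -> : \int[leb \x leb]_z G z = \int[leb]_y \int[leb]_h G (y, h).
  exact: (fubini_tonelli1 _ mG G0).
rewrite /G /=.
have innerG y : \int[leb]_h (v y * (2 * L * (vnorm h * m h)))%:E =
   (2 * L)%:E * \int[leb]_h (vnorm h * m h)%:E * (v y)%:E.
  rewrite muleAC -EFinM -ge0_integralZl//; last 3 first.
  - exact/measurable_EFinP.
  - by move=> h _; rewrite lee_fin mulr_ge0// vnorm_ge0.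
  - by rewrite lee_fin !mulr_ge0.
  by apply: eq_integral => h _; rewrite -EFinM mulrCA mulrA.
under eq_integral do rewrite innerG.
have I0 : 0 <= \int[leb]_h (vnorm h * m h)%:E.
  by apply: integral_ge0 => h _; rewrite lee_fin mulr_ge0// vnorm_ge0.
rewrite ge0_integralZl//; last 2 first.
- by move=> y _; rewrite lee_fin.
- by rewrite mule_ge0// lee_fin mulr_ge0.
rewrite (EFinM (2 * L * B)); apply: lee_pmul => //.
- by rewrite mule_ge0// lee_fin mulr_ge0.
- by apply: integral_ge0 => y _; rewrite lee_fin.
by rewrite (EFinM (2 * L)); apply: lee_wpmul2l; [rewrite lee_fin mulr_ge0|exact: integral_m1].
Qed.

Lemma integral_bilinear_snd_le (W : R) : (0 <= W)%R -> \int[leb]_x (v x)%:E <= W%:E ->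
  int dif snd <= int rdif snd + (2 * L * B * W)%:E /\
  int rdif snd <= int dif snd + (2 * L * B * W)%:E.
Proof.
move=> W0 vW; rewrite dif_conv rdif_conv; split; first by apply: conv_le => //; left.
by have := @conv_le (-1)%R W; rewrite opprK; apply => //; right.
Qed.

End one_function.

Let integral_sum5 (f g1 g2 g3 g4 : N.-tuple R * N.-tuple R -> R) :
  (forall z, 0 <= f z)%R -> (forall z, 0 <= g1 z)%R -> (forall z, 0 <= g2 z)%R ->
  (forall z, 0 <= g3 z)%R -> (forall z, 0 <= g4 z)%R ->
  measurable_fun setT (fun z => (f z)%:E : \bar R) ->
  measurable_fun setT (fun z => (g1 z)%:E : \bar R) ->
  measurable_fun setT (fun z => (g2 z)%:E : \bar R) ->
  measurable_fun setT (fun z => (g3 z)%:E : \bar R) ->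
  measurable_fun setT (fun z => (g4 z)%:E : \bar R) ->
  \int[leb \x leb]_z ((f z)%:E + ((g1 z)%:E + ((g2 z)%:E + ((g3 z)%:E + (g4 z)%:E)))) =
  \int[leb \x leb]_z (f z)%:E + (\int[leb \x leb]_z (g1 z)%:E +
  (\int[leb \x leb]_z (g2 z)%:E + (\int[leb \x leb]_z (g3 z)%:E +
   \int[leb \x leb]_z (g4 z)%:E))).
Proof.
move=> f0 g10 g20 g30 g40 mf mg1 mg2 mg3 mg4.
have e0 (g : N.-tuple R * N.-tuple R -> R) : (forall z, 0 <= g z)%R -> forall z : N.-tuple R * N.-tuple R, setT z ->
    0 <= (g z)%:E by move=> g0 z _; rewrite lee_fin.
have m34 := emeasurable_funD mg3 mg4.
have m234 := emeasurable_funD mg2 m34.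
have m1234 := emeasurable_funD mg1 m234.
have n34 z : 0 <= (g3 z)%:E + (g4 z)%:E by rewrite adde_ge0// lee_fin.
have n234 z : 0 <= (g2 z)%:E + ((g3 z)%:E + (g4 z)%:E) by rewrite adde_ge0// lee_fin.
have n1234 z : 0 <= (g1 z)%:E + ((g2 z)%:E + ((g3 z)%:E + (g4 z)%:E)).
  by rewrite adde_ge0// lee_fin.
rewrite (ge0_integralD _ measurableT (e0 _ f0) mf (fun z _ => n1234 z) m1234).
rewrite (ge0_integralD _ measurableT (e0 _ g10) mg1 (fun z _ => n234 z) m234).
rewrite (ge0_integralD _ measurableT (e0 _ g20) mg2 (fun z _ => n34 z) m34).
by rewrite (ge0_integralD _ measurableT (e0 _ g30) mg3 (e0 _ g40) mg4).
Qed.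

(** In the integrated inequality the terms evaluated at x agree on both sides, and each of the two
    pairs evaluated at y differs by at most 2 L B W. All of these are finite, so they can be
    subtracted even when the integral of C is infinite. *)
Lemma bilinear_comparison (A C : N.-tuple R * N.-tuple R -> R) (vp vn : N.-tuple R -> R)
    (W : R) : measurable_fun setT A -> (forall z, 0 <= A z)%R ->
  measurable_fun setT C -> (forall z, 0 <= C z)%R ->
  measurable_fun setT vp -> (forall x, 0 <= vp x)%R ->
  measurable_fun setT vn -> (forall x, 0 <= vn x)%R ->
  (0 <= W)%R -> \int[leb]_x (vp x)%:E <= W%:E -> \int[leb]_x (vn x)%:E <= W%:E ->
  (forall x y, A (x, y) + eta x * (m (vsub x y) * vp x + m (vsub y x) * vn x +
                 m (vsub x y) * vn y + m (vsub y x) * vp y) <=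
               C (x, y) + eta x * (m (vsub y x) * vp x + m (vsub x y) * vn x +
                 m (vsub x y) * vp y + m (vsub y x) * vn y))%R ->
  \int[leb \x leb]_z (A z)%:E <= \int[leb \x leb]_z (C z)%:E + (4 * L * B * W)%:E.
Proof.
move=> mA A0 mC C0 mvp vp0 mvn vn0 W0 vpW vnW AC.
have vpfin := le_lt_trans vpW (ltry W).
have vnfin := le_lt_trans vnW (ltry W).
have symp := integral_bilinear_sym mvp vp0.
have symn := integral_bilinear_sym mvn vn0.
have fp := integral_bilinear_fst_fin mvp vp0 vpfin.
have fn := integral_bilinear_fst_fin mvn vn0 vnfin.
have [_ sp] := integral_bilinear_snd_fin mvp vp0 vpfin.
have [sn _] := integral_bilinear_snd_fin mvn vn0 vnfin.
have [lep _] := integral_bilinear_snd_le mvp vp0 W0 vpW.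
have [_ len] := integral_bilinear_snd_le mvn vn0 W0 vnW.
have bp f g := @bilinear_ge0 _ vp0 f g.
have bn f g := @bilinear_ge0 _ vn0 f g.
have mEA : measurable_fun setT (fun z => (A z)%:E : \bar R) by exact/measurable_EFinP.
have mEC : measurable_fun setT (fun z => (C z)%:E : \bar R) by exact/measurable_EFinP.
have mp f g := @measurable_bilinear _ mvp f g.
have mn f g := @measurable_bilinear _ mvn f g.
pose lhs z := (A z)%:E + ((bilinear dif fst vp z)%:E + ((bilinear rdif fst vn z)%:E +
  ((bilinear dif snd vn z)%:E + (bilinear rdif snd vp z)%:E))).
pose rhs z := (C z)%:E + ((bilinear rdif fst vp z)%:E + ((bilinear dif fst vn z)%:E +
  ((bilinear dif snd vp z)%:E + (bilinear rdif snd vn z)%:E))).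
have le_lr : \int[leb \x leb]_z lhs z <= \int[leb \x leb]_z rhs z.
  apply: ge0_le_integral => //.
  - by move=> z _; rewrite /lhs !adde_ge0// lee_fin.
  - by do !apply: emeasurable_funD => //; first [exact: mp|exact: mn].
  - by do !apply: emeasurable_funD => //; first [exact: mp|exact: mn].
  move=> [x y] _; rewrite /lhs /rhs /bilinear /dif /rdif -!EFinD lee_fin /=.
  by have := AC x y; rewrite !mulrDr !mulrA !addrA.
move: le_lr; rewrite /lhs /rhs.
rewrite (integral_sum5 A0 (bp _ _) (bn _ _) (bn _ _) (bp _ _) mEA
  (mp _ _ mdif m1) (mn _ _ mrdif m1) (mn _ _ mdif m2) (mp _ _ mrdif m2)).
rewrite (integral_sum5 C0 (bp _ _) (bn _ _) (bp _ _) (bn _ _) mEC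
  (mp _ _ mrdif m1) (mn _ _ mdif m1) (mp _ _ mdif m2) (mn _ _ mrdif m2)).
rewrite -symp -symn.
move: fp fn sp sn lep len.
set x1 := \int[_]_z _; set x2 := \int[_]_z _; set y1 := \int[_]_z _;
set y2 := \int[_]_z _; set y3 := \int[_]_z _; set y4 := \int[_]_z _.
clearbody x1 x2 y1 y2 y3 y4; 
case: x1 => [x1 _|//|//]; case: x2 => [x2 _|//|//].
case: y1 => [y1 _|//|//]; case: y2 => [y2 _|//|//] lep len le_AC.
have : \int[leb \x leb]_z (A z)%:E + (x1 + (x2 + (y2 + y1)))%:E <=
    \int[leb \x leb]_z (C z)%:E + (4 * L * B * W)%:E + (x1 + (x2 + (y2 + y1)))%:E.
  apply: (le_trans le_AC); rewrite -addeA; apply: leeD2l.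
  apply: (@le_trans _ _ (x1%:E + (x2%:E + (y1%:E + (2 * L * B * W)%:E +
      (y2%:E + (2 * L * B * W)%:E))))).
    by apply: leeD2l; apply: leeD2l; exact: leeD.
  rewrite -!EFinD lee_fin.
  by rewrite le_eqVlt; apply/orP; left; apply/eqP; ring.
by rewrite leeD2rE.
Qed.

End bilinear.

Section energy_lower_bound.
Context {R : realType} {n : nat}.
Local Open Scope ereal_scope.
Local Notation N := n.+1.
Local Notation Q := (cubeQ R N).
Local Notation leb := (lebesgue_tuple R N).
Implicit Types (x y h : N.-tuple R).
Variable p : R.
Hypothesis p1 : (1 < p)%R.
Let p0 : (0 < p)%R. Proof. exact: lt_trans p1. Qed.
Variable a : N.-tuple R.
Hypothesis a1 : vnorm a = 1%R.
Variable s : R.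
Let b : R := (p * (1 - s))%R.
Hypothesis b01 : (0 < b < 1)%R.
Variables rho r : R.
Hypotheses (rho0 : (0 < rho)%R) (rhor : (rho <= r)%R).

Variable eta : N.-tuple R -> R.
Variable L : R.
Hypothesis meta : measurable_fun setT eta.
Hypothesis eta0 : forall x, (0 <= eta x)%R.
Hypothesis eta1 : forall x, (eta x <= 1)%R.
Hypothesis L0 : (0 <= L)%R.
Hypothesis etaL : forall x y, (eta x <= eta y + L * eucl_dist x y)%R.
Hypothesis etaQ : forall x y, eta x != 0%R -> (eucl_dist x y <= r)%R -> Q y.

(** The inner radius makes the kernel integrable. The outer radius, together with [etaQ], forces y
    into Q as soon as eta x is nonzero. *)
Let kern h : R := (\1_(annulus rho r) h / vnorm h `^ (N%:R + s * p))%R.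
Let m h : R := (pos_pow p (dot a h) * kern h)%R.

Let kern0 h : (0 <= kern h)%R.
Proof. by rewrite divr_ge0// powR_ge0. Qed.

Let m0 h : (0 <= m h)%R.
Proof. by rewrite mulr_ge0// pos_pow_ge0. Qed.

Let measurable_kern : measurable_fun setT kern.
Proof.
apply: measurable_funM; first by apply: measurable_indic; exact: measurable_annulus.
apply: (measurableT_comp (@measurable_inv R)).
exact: measurable_powR_vnorm.
Qed.

Let measurable_m : measurable_fun setT m.
Proof.
apply: measurable_funM; last exact: measurable_kern.
apply: measurable_funM => //; apply: (measurableT_comp (measurable_powR _)).
apply: measurable_maxr => //.
exact: measurable_dotr.
Qed.

Let kernC x y : kern (vsub y x) = kern (vsub x y).
Proof.
have -> : vsub y x = vscale (-1) (vsub x y).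
  by apply: eq_from_tnth => i; rewrite !tnthE; ring.
by rewrite /kern !indicE !mem_annulus vnormZ normrN normr1 mul1r.
Qed.

Let dotC_vsub x y : dot a (vsub y x) = (- dot a (vsub x y))%R.
Proof. by rewrite !dotBr opprB. Qed.

Let omega := fine (ball_integral (fun _ : N.-tuple R => 1%R)).

Let omega0 : (0 <= omega)%R.
Proof.
exact: fine_ball_integral_ge0.
Qed.

(** The extra factor |h| tames the singularity: |h| m(h) is at most p |h|^(b - N). The bound does
    not involve rho, unlike the total mass of m. *)
Let integral_m1 : \int[leb]_h (vnorm h * m h)%:E <=
  (p * (N%:R / b * omega * r `^ b))%:E.
Proof.
have /andP[b0 b1] := b01.
have c1 : measurable_fun setT (fun _ : N.-tuple R => 1%R : R) by exact: measurable_cst.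
have := integral_annulus c1 (fun _ => ler01) (fun _ => lexx _) (fun _ _ _ => erefl) rho0 rhor b01.
rewrite -/omega => E.
have le1 : \int[leb]_h (vnorm h * m h)%:E <= \int[leb]_h (p%:E *
    (\1_(annulus rho r) h * 1 * vnorm h `^ (b - N%:R))%:E).
  apply: ge0_le_integral => //.
  - by move=> h _; rewrite lee_fin mulr_ge0// vnorm_ge0.
  - by apply/measurable_EFinP; apply: measurable_funM => //; exact: measurable_vnormT.
  - apply: measurable_funeM; apply/measurable_EFinP; apply: measurable_funM.
      apply: measurable_funM => //.
      by apply: measurable_indic; exact: measurable_annulus.
    exact: measurable_powR_vnorm.
  move=> h _; rewrite -EFinM lee_fin /m /kern /pos_pow mulr1 indicE mem_annulus.
  case: (boolP (rho < vnorm h <= r)%R) => [/andP[rh hr]|_]; last by rewrite !mul0r !mulr0.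
  have h0 : (0 < vnorm h)%R by exact: lt_trans rh.
  rewrite !mul1r.
  have dh : (Num.max (dot a h) 0 <= vnorm h)%R.
    rewrite ge_max vnorm_ge0 andbT; apply: le_trans (ler_norm _) _.
    by apply: le_trans (Cauchy_Schwarz _ _) _; rewrite a1 mul1r.
  have pp0 : (0 <= p - 1)%R by rewrite subr_ge0 ltW.
  have dhp : (Num.max (dot a h) 0 `^ (p - 1) <= vnorm h `^ (p - 1))%R.
    apply: ge0_ler_powR => //; rewrite nnegrE ?vnorm_ge0//.
    by rewrite le_max lexx orbT.
  have -> : (vnorm h `^ (b - N%:R) = vnorm h * vnorm h `^ (p - 1) / vnorm h `^ (N%:R + s * p))%R.
    rewrite mulr_powRB1 ?vnorm_ge0// -powRB; last by rewrite (gt_eqF h0) implybT.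
    by congr powR; rewrite /b; ring.
  move: (vnorm h `^ (N%:R + s * p))%R (powR_ge0 (vnorm h) (N%:R + s * p)%R) dhp => k kk.
  move: (_ `^ (p - 1))%R (vnorm h `^ (p - 1))%R => A B AB.
  rewrite -subr_ge0 (_ : (_ - _)%R = (p * vnorm h * k^-1 * (B - A))%R); last by ring.
  by rewrite !mulr_ge0 ?subr_ge0 ?invr_ge0// ltW.
apply: (le_trans le1); rewrite ge0_integralZl//; last 3 first.
- apply/measurable_EFinP; apply: measurable_funM.
    by apply: measurable_funM => //; apply: measurable_indic; exact: measurable_annulus.
  exact: measurable_powR_vnorm.
- by move=> h _; rewrite lee_fin !mulr_ge0// powR_ge0.
- by rewrite lee_fin ltW.
rewrite E -EFinM lee_fin; apply: ler_wpM2l; first exact: ltW.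
apply: ler_wpM2l; last by rewrite lerBlDr lerDl powR_ge0.
by rewrite mulr_ge0// divr_ge0// ltW.
Qed.

Let integral_m_fin : \int[leb]_h (m h)%:E < +oo.
Proof.
apply: (@le_lt_trans _ _ ((rho^-1)%:E * \int[leb]_h (vnorm h * m h)%:E)); last first.
  apply: lte_mul_pinfty; [by rewrite lee_fin invr_ge0 ltW|by []|].
  by apply: le_lt_trans integral_m1 _; rewrite ltry.
have mvm : measurable_fun setT (fun h => (vnorm h * m h)%:E : \bar R).
  by apply/measurable_EFinP; apply: measurable_funM => //; exact: measurable_vnormT.
rewrite -ge0_integralZl//; last 2 first.
- by move=> h _; rewrite lee_fin mulr_ge0// vnorm_ge0.
- by rewrite lee_fin invr_ge0 ltW.
apply: ge0_le_integral => //.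
- by move=> h _; rewrite lee_fin.
- exact/measurable_EFinP.
- exact: measurable_funeM.
move=> h _; rewrite -EFinM lee_fin ler_pdivlMl// /m /kern indicE mem_annulus.
case: (boolP (rho < vnorm h <= r)%R) => [/andP[rh hr]|_]; last by rewrite !mul0r !mulr0.
apply: ler_wpM2r; last exact: ltW.
by rewrite mulr_ge0 ?pos_pow_ge0// mul1r invr_ge0 powR_ge0.
Qed.


Let Gamma := fine (ball_integral (angular p a)).

Variables (u : N.-tuple R -> R) (W : R).
Hypothesis mu : measurable_fun Q u.
Hypothesis W0 : (0 <= W)%R.
Let w := (fun x => u x - dot a x)%R \_ Q.
Hypothesis wW : \int[leb]_x (`|w x|)%:E <= W%:E.

Let mw : measurable_fun setT w.
Proof.
apply/(measurable_restrictT _ measurable_cubeQ); apply: measurable_funB => //.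
apply: measurable_funTS.
exact: measurable_dotr.
Qed.

Let wp x := Num.max (w x) 0%R.
Let wn x := Num.max (- w x)%R 0%R.

Let w_decomp x : w x = (wp x - wn x)%R.
Proof. by rewrite /wp /wn; case: (leP (w x) 0%R) => h; case: leP => h'; lra. Qed.

Let A z := (eta z.1 * (kern (vsub z.1 z.2) * `|dot a (vsub z.1 z.2)| `^ p))%R.

Let mvsub : measurable_fun setT (fun z : N.-tuple R * N.-tuple R => vsub z.1 z.2).
Proof. exact: measurable_vsub. Qed.

Let measurable_kerna : measurable_fun setT (fun h => kern h * `|dot a h| `^ p)%R.
Proof.
apply: measurable_funM => //; apply: (measurableT_comp (measurable_powR _)).
apply: measurableT_comp => //.
exact: measurable_dotr.
Qed.

Let measurable_A : measurable_fun setT A.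
Proof.
apply: measurable_funM; first exact: (measurableT_comp meta).
exact: (measurableT_comp measurable_kerna).
Qed.

Let A0 z : (0 <= A z)%R.
Proof. by apply: mulr_ge0 => //; apply: mulr_ge0 => //; exact: powR_ge0. Qed.

Let integral_A : \int[leb \x leb]_z (A z)%:E =
  \int[leb]_x (eta x)%:E * (N%:R / b * Gamma * (r `^ b - rho `^ b))%:E.
Proof.
have mEA : measurable_fun setT (fun z => (A z)%:E : \bar R) by exact/measurable_EFinP.
have EA0 z : 0 <= (A z)%:E by rewrite lee_fin.
have mk : measurable_fun setT (fun h => (kern h * `|dot a h| `^ p)%:E : \bar R).
  exact/measurable_EFinP.
have k0 h : 0 <= (kern h * `|dot a h| `^ p)%:E.
  by rewrite lee_fin mulr_ge0// powR_ge0.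
have E : \int[leb]_h (kern h * `|dot a h| `^ p)%:E =
    (N%:R / b * Gamma * (r `^ b - rho `^ b))%:E.
  rewrite -(integral_angular_annulus p1 a1 rho0 rhor b01).
  apply: eq_integral => h _; congr EFin.
  by rewrite /kern -kernelE// mulrAC mulrA.
apply: etrans (fubini_tonelli1 _ mEA EA0) _; rewrite -E.
rewrite -ge0_integralZr//; last 3 first.
- exact/measurable_EFinP.
- by move=> x _; rewrite lee_fin.
- by apply: integral_ge0 => h _; exact: k0.
apply: eq_integral => x _; rewrite -(ge0_integral_vsub x mk k0) -ge0_integralZl//.
  have mx : measurable_fun setT (fun y => vsub x y).
    exact: measurable_vsubr.
  exact: (measurableT_comp mk mx).
by rewrite lee_fin.
Qed.

(** The tangent inequality at c = <a, x - y>, multiplied by eta(x) and the kernel, with negative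
    terms moved across. As the kernel is even, [pos_pow (- c)] times the kernel is m(y - x). If
    eta(x) or the kernel vanishes, only the nonnegativity of the energy integrand remains; otherwise
    x and y lie in Q, and all restrictions to Q disappear. *)
Let pointwise x y : (A (x, y) + eta x * (m (vsub x y) * wp x + m (vsub y x) * wn x +
    m (vsub x y) * wn y + m (vsub y x) * wp y) <=
  gagliardo_integrand p s u (x, y) + eta x * (m (vsub y x) * wp x +
    m (vsub x y) * wn x + m (vsub x y) * wp y + m (vsub y x) * wn y))%R.
Proof.
have g0 := gagliardo_integrand_ge0 p s u (x, y).
rewrite /A /= /m (dotC_vsub x y) (kernC x y).
have [eta_0|eta_n0] := eqVneq (eta x) 0%R; first by rewrite eta_0 !mul0r !addr0.
have [kern_0|kern_n0] := eqVneq (kern (vsub x y)) 0%R.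
  by rewrite kern_0 !(mulr0, mul0r, addr0).
have dxy : (rho < vnorm (vsub x y) <= r)%R.
  by move: kern_n0; rewrite /kern indicE mem_annulus; case: (_ < _ <= _)%R; rewrite ?mul0r ?eqxx.
have [Qx Qy] : Q x /\ Q y.
  split; apply: (etaQ eta_n0); last by rewrite eucl_distE; case/andP: dxy.
  rewrite eucl_distE (_ : vnorm _ = 0%R); last first.
    by apply/eqP; rewrite vnorm_eq0; apply/forallP => i; rewrite !tnthE subrr.
  by rewrite ltW// (lt_le_trans rho0).
have ->: gagliardo_integrand p s u (x, y) = (kern (vsub x y) * `|u x - u y| `^ p)%R.
  rewrite /gagliardo_integrand /kern !indicE mem_annulus dxy /= !patchE.
  by rewrite !mem_set// !mul1r -eucl_distE mulrC.
have := powR_tangent p1 (dot a (vsub x y)) (u x - u y)%R.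
have -> : (u x - u y - dot a (vsub x y) = (wp x - wn x) - (wp y - wn y))%R.
  by rewrite -!w_decomp /w !patchE !mem_set// dotBr; ring.
(* The bound eta <= 1 removes the cutoff from the energy term. *)
have e01 : (eta x * (kern (vsub x y) * `|u x - u y| `^ p) <= kern (vsub x y) * `|u x - u y| `^ p)%R.
  by rewrite ler_piMl// mulr_ge0// powR_ge0.
move=> /(ler_wpM2l (mulr_ge0 (eta0 x) (kern0 (vsub x y)))); move: e01.
move: (_ `^ p)%R (_ `^ p)%R (pos_pow _ _) (pos_pow _ _) (kern _) => q1 q2 q3 q4 k.
by nra.
Qed.

Lemma energy_lower_bound :
  \int[leb]_x (eta x)%:E * (N%:R / b * Gamma * (r `^ b - rho `^ b))%:E <=
  energy p s u + (4 * L * (p * (N%:R / b * omega * r `^ b)) * W)%:E.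
Proof.
have mG := measurable_gagliardo_integrand p s mu.
have g0 := gagliardo_integrand_ge0 p s u.
have mwp : measurable_fun setT wp by apply: measurable_maxr.
have mwn : measurable_fun setT wn.
  by apply: measurable_maxr => //; exact: measurableT_comp.
have wp0 x : (0 <= wp x)%R by rewrite /wp le_max lexx orbT.
have wn0 x : (0 <= wn x)%R by rewrite /wn le_max lexx orbT.
have wpW : \int[leb]_x (wp x)%:E <= W%:E.
  apply: le_trans wW; apply: ge0_le_integral => //.
  - by move=> x _; rewrite lee_fin.
  - exact/measurable_EFinP.
  - by apply/measurable_EFinP; exact: measurableT_comp.
  by move=> x _; rewrite lee_fin /wp ge_max ler_norm normr_ge0.
have wnW : \int[leb]_x (wn x)%:E <= W%:E.
  apply: le_trans wW; apply: ge0_le_integral => //.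
  - by move=> x _; rewrite lee_fin.
  - exact/measurable_EFinP.
  - by apply/measurable_EFinP; exact: measurableT_comp.
  by move=> x _; rewrite lee_fin /wn ge_max -normrN ler_norm normr_ge0.
have := bilinear_comparison meta eta0 eta1 L0 etaL measurable_m m0 integral_m_fin
  integral_m1 measurable_A A0 mG g0 mwp wp0 mwn wn0 W0 wpW wnW pointwise.
rewrite integral_A => /le_trans; apply; rewrite leeD2r//.
have mEG : measurable_fun setT (fun z => (gagliardo_integrand p s u z)%:E : \bar R).
  exact/measurable_EFinP.
have Eg0 z : 0 <= (gagliardo_integrand p s u z)%:E by rewrite lee_fin.
by rewrite (fubini_tonelli1 _ mEG Eg0).
Qed.

End energy_lower_bound.

(** * The cutoff function of the cube *)

Section cutoff.
Context {R : realType} {n : nat}.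
Local Open Scope ereal_scope.
Local Notation N := n.+1.
Local Notation Q := (cubeQ R N).
Local Notation leb := (lebesgue_tuple R N).
Implicit Types (x y : N.-tuple R).
Variable r : R.
Hypothesis r01 : (0 < r < 4^-1)%R.

Let r0 : (0 < r)%R. Proof. by case/andP: r01. Qed.

Let ramp (t : R) : R := (Num.max 0 ((`|t| - (2^-1 - 2 * r)) / r))%R.

(* 1 on the cube of side 1 - 4 r and 0 off the cube of side 1 - 2 r. *)
Definition cutoff x : R := (Num.max 0 (1 - \sum_(i < N) ramp (tnth x i)))%R.

Let ramp_ge0 t : (0 <= ramp t)%R.
Proof. by rewrite /ramp le_max lexx. Qed.

Lemma cutoff_ge0 x : (0 <= cutoff x)%R.
Proof. by rewrite /cutoff le_max lexx. Qed.

Lemma cutoff_le1 x : (cutoff x <= 1)%R.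
Proof. by rewrite /cutoff ge_max ler01 gerBl sumr_ge0. Qed.

Lemma measurable_cutoff : measurable_fun setT cutoff.
Proof.
apply: measurable_maxr; first exact: measurable_cst.
apply: measurable_funB; first exact: measurable_cst.
apply: measurable_sum => i; apply: measurable_maxr; first exact: measurable_cst.
apply: measurable_funM; last exact: measurable_cst.
apply: measurable_funB; last exact: measurable_cst.
by apply: measurableT_comp => //; exact: measurable_tnth.
Qed.

(** The constant adds up N ramps of slope 1 / r, one for each coordinate. *)
Lemma cutoff_lipschitz x y : (cutoff x <= cutoff y + N%:R / r * eucl_dist x y)%R.
Proof.
have ramp_lip (t t' : R) : (ramp t <= ramp t' + `|t - t'| / r)%R.
  rewrite /ramp ge_max; apply/andP; split.
    by rewrite addr_ge0 ?ramp_ge0// divr_ge0// ltW.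
  apply: (@le_trans _ _ ((`|t'| - (2^-1 - 2 * r)) / r + `|t - t'| / r)%R); last first.
    by rewrite lerD2r le_max lexx orbT.
  rewrite -mulrDl ler_pM2r ?invr_gt0//.
  have := ler_normD (t - t')%R t'; rewrite subrK; lra.
have d0 : (0 <= N%:R / r * eucl_dist x y)%R.
  by rewrite mulr_ge0 ?eucl_dist_ge0// divr_ge0// ltW.
rewrite {1}/cutoff ge_max addr_ge0 ?cutoff_ge0//=.
apply: (@le_trans _ _ (1 - \sum_(i < N) ramp (tnth y i) + N%:R / r * eucl_dist x y)%R).
  rewrite addrAC lerBrDr addrAC lerBlDr -addrA lerD2l.
  have -> : (N%:R / r * eucl_dist x y = \sum_(i < N) eucl_dist x y / r)%R.
    by rewrite sumr_const card_ord -mulr_natl; ring.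
  rewrite addrC -big_split; apply: ler_sum => i _.
  apply: le_trans (ramp_lip _ (tnth x i)) _; rewrite lerD2l ler_pM2r ?invr_gt0//.
  rewrite eucl_distC eucl_distE.
  by have := ler_tnth_vnorm (vsub y x) i; rewrite tnthE.
by rewrite lerD2r /cutoff le_max lexx orbT.
Qed.

(** A nonzero value forces every ramp below 1, that is |x_i| < 1/2 - r, which leaves a margin r in
    each coordinate. *)
Lemma cutoff_support x y : cutoff x != 0%R -> (eucl_dist x y <= r)%R -> Q y.
Proof.
move=> x0 xy i.
have sx : (\sum_(i < N) ramp (tnth x i) < 1)%R.
  rewrite ltNge; apply: contra x0 => sx.
  by rewrite /cutoff max_l// subr_le0.
have rx : (ramp (tnth x i) < 1)%R.
  by apply: le_lt_trans sx; rewrite (bigD1 i)//= lerDl sumr_ge0.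
have hx : (`|tnth x i| < 2^-1 - r)%R.
  have : ((`|tnth x i| - (2^-1 - 2 * r)) / r < 1)%R.
    by apply: le_lt_trans rx; rewrite /ramp le_max lexx orbT.
  by rewrite ltr_pdivrMr// mul1r; lra.
have hxy : (`|tnth x i - tnth y i| <= r)%R.
  apply: le_trans xy; rewrite eucl_distE.
  by have := ler_tnth_vnorm (vsub x y) i; rewrite tnthE.
by move: hx hxy; rewrite ltr_norml ler_norml; lra.
Qed.

Lemma integral_cutoff_ge : ((1 - 4 * r) ^+ N)%:E <= \int[leb]_x (cutoff x)%:E.
Proof.
have /andP[_ r4] := r01.
pose I : set (measurableTypeR R) := `](- (2^-1 - 2 * r))%R, (2^-1 - 2 * r)%R[%classic.
have mI : measurable I by exact: measurable_itv.
have -> : ((1 - 4 * r) ^+ N)%:E = leb [set x | forall i, I (tnth x i)].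
  rewrite [RHS](leb_cube N mI) lebesgue_measure_itv/= lte_fin.
  have h : (- (2^-1 - 2 * r) < 2^-1 - 2 * r)%R by lra.
  rewrite h -EFinD.
  by rewrite (_ : (1 - 4 * r = 2^-1 - 2 * r - - (2^-1 - 2 * r))%R) ?EFin_expe//; lra.
rewrite -(setIT [set x | _]) -integral_indic//; last exact: (measurable_cube mI).
apply: ge0_le_integral => //.
- by apply/measurable_EFinP; apply: measurable_indic; exact: (measurable_cube mI).
- by apply/measurable_EFinP; exact: measurable_cutoff.
move=> x _; rewrite lee_fin indicE; case: (boolP (_ \in _)) => [|_]; last exact: cutoff_ge0.
move=> /set_mem xI; rewrite /cutoff big1 ?subr0 ?le_max ?lexx ?orbT// => i _.
have := xI i; rewrite /I/= in_itv/= => /andP[h1 h2].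
have hx : (`|tnth x i| - (2^-1 - 2 * r) <= 0)%R.
  by rewrite subr_le0 ler_norml (ltW h1) ltW.
by rewrite /ramp max_l// mulr_le0_ge0// invr_ge0 ltW.
Qed.

End cutoff.

(** * The limits rho -> 0 and s -> 1 *)

Section liminf.
Context {R : realType} {n : nat}.
Local Open Scope ereal_scope.
Local Notation N := n.+1.
Local Notation Q := (cubeQ R N).
Local Notation leb := (lebesgue_tuple R N).
Implicit Types (x y h : N.-tuple R).
Variable p : R.
Hypothesis p1 : (1 < p)%R.
Let p0 : (0 < p)%R. Proof. exact: lt_trans p1. Qed.
Variable a : N.-tuple R.
Hypothesis a1 : vnorm a = 1%R.

Let Gamma := fine (ball_integral (angular p a)).
Let omega := fine (ball_integral (fun _ : N.-tuple R => 1%R)).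

Let Gamma0 : (0 <= Gamma)%R.
Proof. by apply: fine_ball_integral_ge0 => x; exact: angular_ge0. Qed.

(** Multiplying by 1 - s turns N / b into N / p in the main term, and p N / b into N in the error,
    since b = p (1 - s). What is left of the error is proportional to W. *)
Lemma energy_ge (s r : R) (u : N.-tuple R -> R) (W : R) :
  (0 < p * (1 - s) < 1)%R -> (0 < r < 4^-1)%R -> measurable_fun Q u -> (0 <= W)%R ->
  \int[leb]_x (`|((fun x => u x - dot a x)%R \_ Q) x|)%:E <= W%:E ->
  ((1 - 4 * r) ^+ N * (N%:R / p * Gamma * r `^ (p * (1 - s))))%:E <=
  (1 - s)%:E * energy p s u +
    (4 * (N%:R / r) * (N%:R * omega * r `^ (p * (1 - s))) * W)%:E.
Proof.
move=> b01 r01 mu W0 uW; set b := (p * (1 - s))%R in b01 *.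
have /andP[r0 r4] := r01; have /andP[b0 b1] := b01.
have s1 : (0 < 1 - s)%R by rewrite -(pmulr_rgt0 _ p0).
have c0 : (0 <= (1 - 4 * r) ^+ N)%R by apply: exprn_ge0; lra.
set c := ((1 - 4 * r) ^+ N)%R in c0 *.
pose k : R := (N%:R / b * Gamma)%R.
have k0 : (0 <= k)%R by rewrite mulr_ge0// divr_ge0// ltW.
pose e' : R := (4 * (N%:R / r) * (p * (N%:R / b * omega * r `^ b)) * W)%R.
suff main : (c * (k * r `^ b))%:E <= energy p s u + e'%:E.
  have : (1 - s)%:E * (c * (k * r `^ b))%:E <= (1 - s)%:E * (energy p s u + e'%:E).
    by apply: lee_wpmul2l => //; rewrite lee_fin ltW.
  rewrite ge0_muleDr; last 2 first.
  - by apply: integral_ge0 => x _; apply: integral_ge0 => y _; rewrite lee_fin gagliardo_integrand_ge0.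
  - rewrite lee_fin /e' !mulr_ge0 ?powR_ge0// ?invr_ge0; try exact: ltW.
    exact: fine_ball_integral_ge0.
  rewrite -!EFinM /k /e' /b.
  set E1 := (_ * energy _ _ _); move=> le1.
  rewrite (_ : (c * _)%R = ((1 - s) * (c * (N%:R / (p * (1 - s)) * Gamma * r `^ (p * (1 - s)))))%R); last first.
    by field; rewrite !gt_eqF.
  apply: (le_trans le1); apply: leeD2l; rewrite lee_fin le_eqVlt; apply/orP; left; apply/eqP.
  by field; rewrite !gt_eqF.
apply/lee_addgt0Pr => e e0.
(* The value wanted for rho^b: d <= r^b gives rho <= r, and d <= e / (c k + 1) makes the loss c k
   rho^b at most e. The summand 1 covers c k = 0. *)
pose d : R := (Num.min (r `^ b) (e / (c * k + 1)))%R.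
have ck0 : (0 <= c * k)%R by exact: mulr_ge0.
have d0 : (0 < d)%R by rewrite lt_min powR_gt0// divr_gt0// ltr_wpDl.
pose rho : R := (d `^ b^-1)%R.
have rhob : (rho `^ b = d)%R by rewrite -powRrM mulVf ?gt_eqF// powRr1// ltW.
have rho0 : (0 < rho)%R by exact: powR_gt0.
have rhor : (rho <= r)%R.
  have -> : r = ((r `^ b) `^ b^-1)%R by rewrite -powRrM mulfV ?gt_eqF// powRr1// ltW.
  apply: ge0_ler_powR; rewrite ?nnegrE ?powR_ge0// ?invr_ge0 ?(ltW b0) ?(ltW d0)//.
  by rewrite ge_min lexx.
have L0 : (0 <= N%:R / r)%R by rewrite divr_ge0// ltW.
have := energy_lower_bound p1 a1 b01 rho0 rhor (measurable_cutoff r) (cutoff_ge0 r)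
  (cutoff_le1 r) L0 (cutoff_lipschitz r01) (cutoff_support r01) mu W0 uW.
rewrite -/b -/Gamma -/omega -/e' => le1.
apply: (@le_trans _ _ ((c * (k * (r `^ b - d)))%:E + e%:E)).
  rewrite -EFinD lee_fin.
  have : (c * k * d <= e)%R.
    apply: (@le_trans _ _ (c * k * (e / (c * k + 1)))%R).
      by apply: ler_wpM2l => //; rewrite ge_min lexx orbT.
    rewrite mulrA ler_pdivrMr ?ltr_wpDl// mulrC ler_wpM2l ?ltW//; lra.
  lra.
rewrite leeD2r//; apply: le_trans le1; rewrite rhob EFinM.
apply: lee_wpmul2r; last exact: integral_cutoff_ge.
by rewrite lee_fin mulr_ge0// subr_ge0 ge_min lexx.
Qed.

End liminf.

Section lower_bound.
Context {R : realType} {n : nat}.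
Local Open Scope ereal_scope.
Local Notation N := n.+1.
Local Notation Q := (cubeQ R N).
Local Notation leb := (lebesgue_tuple R N).
Implicit Types (x y h : N.-tuple R).
Variable p : R.
Hypothesis p1 : (1 < p)%R.
Let p0 : (0 < p)%R. Proof. exact: lt_trans p1. Qed.

(** Hoelder's inequality against the indicator of Q, whose dual norm is 1 because Q has volume 1. *)
Lemma L1_le_LpQ_norm (f : N.-tuple R -> R) : measurable_fun Q f ->
  \int[leb]_x (`|(f \_ Q) x|)%:E <= LpQ_norm p f.
Proof.
move=> mf; pose q : R := (p / (p - 1))%R.
have pp0 : (0 < p - 1)%R by rewrite subr_gt0.
have q0 : (0 < q)%R by exact: divr_gt0.
have pq : (p^-1 + q^-1 = 1)%R by rewrite invf_div; field; rewrite gt_eqF.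
have mfQ : measurable_fun setT (f \_ Q).
  exact/(measurable_restrictT _ measurable_cubeQ).
have mQ : measurable_fun setT (\1_Q : N.-tuple R -> R).
  by apply: measurable_indic; exact: measurable_cubeQ.
have := hoelder leb mfQ mQ p0 q0 pq.
have -> : 'N[leb]_q%:E[EFin \o (\1_Q : N.-tuple R -> R)] = 1.
  set Nq := 'N[leb]_q%:E[_].
  transitivity ((Nq `^ q) `^ q^-1).
    by rewrite -poweRrM mulfV ?gt_eqF// poweRe1 ?Lnorm_ge0.
  rewrite powR_Lnorm ?gt_eqF// [X in X `^ _](_ : _ = leb Q) ?[X in X `^ _]leb_cubeQ ?poweR1r//.
  rewrite -[in RHS](setIT Q) -integral_indic//; last exact: measurable_cubeQ.
  apply: eq_integral => x _ /=; rewrite indicE; case: (_ \in _) => /=.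
    by rewrite normr1 powR1.
  by rewrite normr0 powR0// gt_eqF.
rewrite mule1 Lnorm1; apply: le_trans.
rewrite le_eqVlt; apply/orP; left; apply/eqP; apply: eq_integral => x _ /=.
by rewrite patchE indicE; case: (_ \in _); rewrite ?mulr1// mul0r.
Qed.

Variable a : N.-tuple R.
Hypothesis a1 : vnorm a = 1%R.

Lemma Kconst_le_Theta : Kconst p a <= Theta p a.
Proof.
have ma : measurable_fun Q (dot a).
  by apply: measurable_funTS; exact: measurable_dotr.
apply: le_ereal_inf_tmp => _ [u [uL /fine_cvgP[ufin ucvg]] <-].
set l := limf_einf _ _; rewrite Kconst_fin//.
set G := fine _; pose K : R := (p^-1 * N%:R * G)%R; rewrite -/K.
have K0 : (0 <= K)%R.
  rewrite /K /G !mulr_ge0 ?invr_ge0 ?(ltW p0)//.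
  by apply: fine_ball_integral_ge0 => x; exact: angular_ge0.
(* The factor (1 - d)^N is the loss due to the cutoff and is removed after the limit in s. The case
   d = 1/2 already rules out l = -oo. *)
suff main (d : R) : (0 < d < 1)%R -> ((1 - d) ^+ N * K)%:E <= l.
  have : ((1 - 2^-1) ^+ N * K)%:E <= l by apply: main; lra.
  case: l main => [l main _|_ _|_]; rewrite ?leey ?leeNy_eq//.
  by rewrite lee_fin; apply: (@ler_pow_lim _ N) => // d /main; rewrite lee_fin.
(* With r = d / 4 the lower bound (1 - 4 r)^N for the integral of the cutoff is (1 - d)^N. *)
move=> d01; pose r : R := (d / 4)%R.
have r01 : (0 < r < 4^-1)%R by rewrite /r; lra.
have [r0 _] := andP r01.
set c := ((1 - d) ^+ N)%R.
pose om := fine (ball_integral (fun _ : N.-tuple R => 1%R)).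
pose W s := fine (LpQ_norm p (fun x => u s x - dot a x)%R).
(* The bound from [energy_ge] with r fixed. As s -> 1, r^(p(1-s)) tends to 1 and W s to 0, so g
   tends to c K although N / r may be large. *)
pose g s := (c * K * r `^ (p * (1 - s)) -
  4 * (N%:R / r) * (N%:R * om) * (r `^ (p * (1 - s)) * W s))%R.
have gcvg : g s @[s --> 1^'-] --> (c * K * 1 - 4 * (N%:R / r) * (N%:R * om) * (1 * 0))%R.
  have rc := powR_left1_cvg p r0.
  by apply: cvgB; (apply: cvgM; first exact: cvg_cst) => //; exact: cvgM.
apply/lee_addgt0Pr => e e0.
have near_le : \forall s \near 1^'-, (c * K - e)%:E <= (1 - s)%:E * gagliardo p s (u s) `^ p.
  near=> s.
  have s1 : (s < 1)%R by near: s; exact: nbhs_left_lt.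
  have s0 : (0 < s)%R by near: s; exact: nbhs_left_gt.
  have b01 : (0 < p * (1 - s) < 1)%R by near: s; exact: near_left1_mul.
  have sfin : LpQ_norm p (fun x => u s x - dot a x)%R \is a fin_num by near: s.
  have gs : (c * K - e < g s)%R.
    by near: s; apply: (cvgr_gt _ gcvg); rewrite mulr1 mul1r mulr0 subr0 gtrBl.
  have [mus _] := uL s (introT andP (conj s0 s1)).
  have mw : measurable_fun Q (fun x => u s x - dot a x)%R by exact: measurable_funB.
  have W0 : (0 <= W s)%R by apply: fine_ge0; exact: Lnorm_ge0.
  have wW := L1_le_LpQ_norm mw; rewrite -[leRHS]fineK// -/(W s) in wW.
  have := energy_ge p1 a1 b01 r01 mus W0 wW.
  rewrite gagliardoE// -/G -/om => le1.
  apply: (@le_trans _ _ (g s)%:E); first by rewrite lee_fin ltW.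
  rewrite /g EFinB leeBlDr//; apply: le_trans (le_trans le1 _).
    rewrite lee_fin le_eqVlt; apply/orP; left; apply/eqP.
    rewrite /c /K (_ : (1 - 4 * r = 1 - d)%R); last by rewrite /r; field.
    by ring.
  apply: leeD2l; rewrite lee_fin le_eqVlt; apply/orP; left; apply/eqP; ring.
suff : (c * K - e)%:E <= l by rewrite EFinB leeBlDr.
pose f (s : R) := (1 - s)%:E * gagliardo p s (u s) `^ p.
(* The lower limit is a supremum of infima over the members of the filter; V is one such member,
   with infimum at least c K - e. *)
pose V := [set s | (c * K - e)%:E <= f s].
rewrite /l limf_einfE; apply: (@le_trans _ _ (ereal_inf [set f s | s in V])).
  by apply: le_ereal_inf_tmp => _ [s ? <-].
by apply: ereal_sup_ubound; exists V => //; exact: near_le.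
Unshelve. all: by end_near. Qed.

End lower_bound.

Theorem lemma3p9 (R : realType) (N : nat) (p : R) :
  (0 < N)%N -> 1 < p ->
  (forall a e : N.-tuple R, usphere R N a -> usphere R N e ->
     Kconst p e = Theta p a) /\
  (forall a b : N.-tuple R, usphere R N a -> usphere R N b ->
     Theta p a = Theta p b).
Proof.
case: N => // n _ p1; have p0 : 0 < p by exact: lt_trans p1.
have main (a e : n.+1.-tuple R) : usphere R n.+1 a -> usphere R n.+1 e ->
    Kconst p e = Theta p a.
  move=> a1 e1.
  transitivity (Kconst p a).
    by rewrite (Kconst_fin p1 e1) (Kconst_fin p1 a1) (ball_integral_angular_dir p e1 a1).
  by apply/eqP; rewrite eq_le (Kconst_le_Theta p1 a1) (Theta_le_Kconst p1 a1).
split=> // a b ha hb.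
by rewrite -(main a a ha ha) -(main b a hb ha).
Qed.
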